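(* Let $A$ be a unital simple separable infinite-dimensional C*-algebra, let $G$ be a second-countable compact group, and let $\alpha\colon G\to \mathrm{Aut}(A)$ be an action with the weak tracial Rokhlin property. If $A$ is purely infinite, then $\alpha$ has the weak tracial Rokhlin property with comparison.
   Context: Conventions. An action $\alpha\colon G\to\mathrm{Aut}(A)$ is a group homomorphism such that $g\mapsto\alpha_g(a)$ is norm continuous for every $a\in A$; $A^\alpha=\{a\in A:\alpha_g(a)=a\ \forall g\in G\}$. For a positive element $a$ and $\varepsilon>0$, $(a-\varepsilon)_+=f(a)$ with $f(t)=\max\{0,t-\varepsilon\}$. For a C*-algebra $B$ and $a,b\in (B\otimes K)_+$ ($K$ the compact operators on $\ell^2$, with $B\subset M_n(B)\subset B\otimes K$ as usual), $a\precsim_B b$ means there is a sequence $(r_n)$ in $B\otimes K$ with $\|r_n^*br_n-a\|\to 0$. On $C(G)$, $\mathrm{Lt}_g(f)(h)=f(g^{-1}h)$. Purely infinite is meant in the usual sense for simple C*-algebras: every nonzero hereditary C*-subalgebra contains an infinite projection. Definition (weak tracial Rokhlin property with comparison). Let $G$ be a second-countable compact group, $A$ a unital simple infinite-dimensional C*-algebra, $\alpha\colon G\to\mathrm{Aut}(A)$ an action. $\alpha$ has the weak tracial Rokhlin property with comparison if for every $\varepsilon>0$, every finite set $F\subseteq A$, every finite set $S\subseteq C(G)$, every $x\in A_+$ with $\|x\|=1$, and every $y\in(A^\alpha)_+\setminus\{0\}$, there exist a positive contraction $d\in A^\alpha$ and a contractive completely positive map $\psi\colon C(G)\to\overline{dAd}$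 such that: (1) $\|\psi(1)\psi(f_1f_2)-\psi(f_1)\psi(f_2)\|<\varepsilon$ for all $f_1,f_2\in S$; $\|\psi(f)a-a\psi(f)\|<\varepsilon$ for all $f\in S$, $a\in F$; and $\sup_{g\in G}\|\psi(\mathrm{Lt}_g(f))-\alpha_g(\psi(f))\|<\varepsilon$ for all $f\in S$; (2) $\psi(1)=d$; (3) $(1-d-\varepsilon)_+\precsim_A x$; (4) $(1-d-\varepsilon)_+\precsim_{A^\alpha} y$; (5) $(1-d-\varepsilon)_+\precsim_{A^\alpha} d$; (6) $\|dxd\|>1-\varepsilon$. Definition (weak tracial Rokhlin property, compact groups). The same definition with condition (5) omitted (all other conditions and quantifiers unchanged). *)

(* Defs.v *)
(* Complex scalars are R[i] for an arbitrary R : realType. *)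
From HB Require Import structures.
From mathcomp Require Import all_boot all_order all_algebra.
From mathcomp Require Import all_classical all_reals all_analysis.
From mathcomp.real_closed Require Import complex.

Set Implicit Arguments.
Unset Strict Implicit.
Unset Printing Implicit Defensive.

Import Order.TTheory GRing.Theory Num.Theory.
Import numFieldNormedType.Exports.

Local Open Scope classical_set_scope.
Local Open Scope complex_scope.
Local Open Scope ring_scope.

(* Unital C*-algebras, with a norm valued in R; the uniformity (hence the
   topology) is that of the distance induced by the norm. *)
HB.mixin Record isCStarAlgebra (R : realType) A
    & GRing.Algebra R[i] A & Uniform A := {
  star : A -> A;
  cstar_norm : A -> R;
  starK : involutive star;
  starD : forall a b : A, star (a + b) = star a + star b;
  starZ : forall (c : R[i]) (a : A), star (c *: a) = c^* *: star a;
  starM : forall a b : A, star (a * b) = star b * star a;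
  cstar_norm_eq0 : forall a : A, cstar_norm a = 0 -> a = 0;
  cstar_normD : forall a b : A, cstar_norm (a + b) <= cstar_norm a + cstar_norm b;
  cstar_normZ : forall (c : R[i]) (a : A),
    cstar_norm (c *: a) = complex.Re `|c| * cstar_norm a;
  cstar_normM : forall a b : A, cstar_norm (a * b) <= cstar_norm a * cstar_norm b;
  cstar_norm_starM : forall a : A, cstar_norm (star a * a) = cstar_norm a ^+ 2;
  cstar_entourageE : forall E : set (A * A), entourage E <->
    exists2 e : R, 0 < e & [set ab | cstar_norm (ab.1 - ab.2) < e] `<=` E;
  cstar_complete : forall F : set_system A,
    ProperFilter F -> cauchy F -> exists a : A, F --> a
}.

#[short(type="cstarAlgType")]
HB.structure Definition CStarAlgebra (R : realType) :=
  {A of GRing.Algebra R[i] A & Uniform A & isCStarAlgebra R A}.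

HB.mixin Record isTopologicalGroup G & Topological G & Group G := {
  mulg_continuous : continuous (fun p : G * G => (p.1 * p.2)%g);
  invg_continuous : continuous (fun x : G => (x^-1)%g)
}.

#[short(type="topologicalGroupType")]
HB.structure Definition TopologicalGroup :=
  {G of Topological G & Group G & isTopologicalGroup G}.

Section CStar.
Context {R : realType} {A : cstarAlgType R}.
Implicit Types (a b p q : A) (B J : set A).

(* B_+ for a C*-subalgebra B of A *)
Definition positive_in B : set A := [set a | exists2 b, B b & a = star b * b].

Definition cstar_le a b := positive_in [set: A] (b - a).

Definition closed_ideal J :=
  [/\ closed J, J 0, (forall a b, J a -> J b -> J (a + b)),
      (forall (c : R[i]) a, J a -> J (c *: a)) &
      (forall a b, J b -> J (a * b) /\ J (b * a))].

Definition cstar_subalgebra B :=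
  [/\ closed B, B 0, (forall a b, B a -> B b -> B (a + b)),
      (forall (c : R[i]) a, B a -> B (c *: a)) &
      (forall a b, B a -> B b -> B (a * b)) /\ (forall a, B a -> B (star a))].

Definition hereditary B := forall a b,
  positive_in [set: A] a -> positive_in [set: A] b ->
  cstar_le a b -> B b -> B a.

Definition projection p := star p = p /\ p * p = p.

Definition mvn_equiv p q := exists v : A, star v * v = p /\ v * star v = q.

Definition infinite_projection p := projection p /\
  exists q, [/\ projection q, cstar_le q p, q <> p & mvn_equiv p q].

(* l%:A is l *: 1 *)
Definition spectrum a : set R[i] :=
  [set l | ~ exists b, (a - l%:A) * b = 1 /\ b * (a - l%:A) = 1].

(* Continuous functional calculus f(a) of a self-adjoint a: the limit of p_n(a)
   for polynomials p_n converging to f uniformly on the spectrum of a. *)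
Definition cfc a (f : R -> R) : A := xget 0 [set b |
  exists p : nat -> {poly R},
    (forall e : R, 0 < e -> \forall n \near \oo,
       forall t : R, spectrum a t%:C -> `|(p n).[t] - f t| < e) /\
    ((fun n => horner_alg a (map_poly (real_complex R) (p n))) @ \oo --> b)].

(* (a - e)_+ *)
Definition cutdown a (e : R) : A := cfc a (fun t => Num.max 0 (t - e)).

(* The C*-norm of M_n(A): operator norm of T acting on the Hilbert A-module
   A^n, whose norm is the square root of the norm of \sum_i (x_i)^* x_i. *)
Definition column_norm n (x : 'cV[A]_n) : R :=
  Num.sqrt (cstar_norm (\sum_i star (x i 0) * x i 0)).

Definition matrix_norm n (T : 'M[A]_n) : R :=
  sup [set column_norm (T *m x) | x in [set x | column_norm x <= 1]].

(* Elements of A (x) K, K the compact operators on l^2, are represented by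
   their infinite matrices of coefficients in A.  The norm of such a matrix is
   the supremum of the norms of its n x n corners; A (x) K consists of the norm
   limits of matrices with finitely many nonzero coefficients, that is, it is
   the closure of the union of the M_n(A). *)
Definition infmx := nat -> nat -> A.

Definition infmx_norm (T : infmx) : \bar R :=
  ereal_sup [set (matrix_norm (\matrix_(i < n, j < n) T i j))%:E
            | n in [set: nat]].

Definition finitely_supported (T : infmx) :=
  exists n : nat, forall i j, ~~ ((i < n)%N && (j < n)%N) -> T i j = 0.

(* B (x) K, as a subalgebra of A (x) K, for a C*-subalgebra B of A *)
Definition stabilization B : set infmx := [set T |
  forall e : R, 0 < e -> exists F : infmx,
    [/\ finitely_supported F, (forall i j, B (F i j)) &
        (infmx_norm (T - F)%R <= e%:E)%E]].

Definition infmx_star (T : infmx) : infmx := fun i j => star (T j i).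

Definition infmx_mul (S T : infmx) : infmx := fun i j =>
  xget 0 [set l | (fun n => \sum_(k < n) S i k * T k j) @ \oo --> l].

Definition infmx_corner a : infmx := fun i j =>
  if (i == 0%N) && (j == 0%N) then a else 0.

(* Cuntz comparison of elements of (B (x) K)_+ relative to B *)
Definition cuntz_infmx B (a b : infmx) :=
  exists r : nat -> infmx, (forall n, stabilization B (r n)) /\
    ((fun n => infmx_norm
       (infmx_mul (infmx_mul (infmx_star (r n)) b) (r n) - a)) @ \oo --> 0%E).

Definition cuntz_in B a b :=
  cuntz_infmx B (infmx_corner a) (infmx_corner b).

Definition star_automorphism (phi : A -> A) :=
  [/\ bijective phi,
      (forall (c : R[i]) a b, phi (c *: a + b) = c *: phi a + phi b),
      (forall a b, phi (a * b) = phi a * phi b) &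
      (forall a, phi (star a) = star (phi a))].

End CStar.

Section CStarType.
Context {R : realType}.
Variable A : cstarAlgType R.

Definition simple_cstar :=
  forall J : set A, closed_ideal J -> J = [set 0] \/ J = [set: A].

Definition separable_cstar := exists2 D : set A, countable D & dense D.

Definition infinite_dimensional := ~ exists (n : nat) (e : 'I_n -> A),
  forall a : A, exists c : 'I_n -> R[i], a = \sum_i c i *: e i.

Definition purely_infinite := forall B : set A,
  cstar_subalgebra B -> hereditary B -> B <> [set 0] ->
  exists2 p, B p & infinite_projection p.

End CStarType.

(* The cone M_n(B)_+ of elements W^* W, where B is a *-subalgebra of the ring S
   with involution st. *)
Definition positive_mx (S : pzRingType) (st : S -> S) (B : set S) n :
    set 'M[S]_n :=
  [set T | exists2 W : 'M[S]_n, (forall i j, B (W i j)) &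
     T = map_mx st W^T *m W].

Section CompactGroup.
Context {R : realType} {G : topologicalGroupType}.

(* C(G), as a set of functions *)
Definition CG : set (G -> R[i]^o) := [set f | continuous f].

Definition CG_star (f : G -> R[i]^o) : G -> R[i]^o := fun g => (f g)^*.

Definition CG_norm (f : G -> R[i]^o) : R :=
  sup [set complex.Re `|f g| | g in [set: G]].

Definition Lt (g : G) (f : G -> R[i]^o) : G -> R[i]^o :=
  fun h => f (g^-1 * h)%g.

Context {A : cstarAlgType R}.

(* psi is a map on C(G): its values outside CG are irrelevant. *)
Definition contractive_cp (B : set A) (psi : (G -> R[i]^o) -> A) :=
  [/\ (forall f, CG f -> B (psi f)),
      (forall (c : R[i]) f h, CG f -> CG h ->
         psi (c *: f + h) = c *: psi f + psi h),
      (forall f, CG f -> cstar_norm (psi f) <= CG_norm f) &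
      (forall n (T : 'M[G -> R[i]^o]_n), positive_mx CG_star CG T ->
         positive_mx star B (map_mx psi T))].

Definition cstar_action (alpha : G -> A -> A) :=
  [/\ (forall g, star_automorphism (alpha g)),
      (forall g h a, alpha (g * h)%g a = alpha g (alpha h a)) &
      (forall a, continuous (fun g => alpha g a))].

Definition fixed_algebra (alpha : G -> A -> A) : set A :=
  [set a | forall g, alpha g a = a].

Variable alpha : G -> A -> A.

Definition rokhlin_conditions (e : R) (F : set A) (S : set (G -> R[i]^o))
    (x y d : A) (psi : (G -> R[i]^o) -> A) :=
  [/\ positive_in (fixed_algebra alpha) d /\ cstar_norm d <= 1,
      contractive_cp (closure [set d * a * d | a in [set: A]]) psi,
      [/\ (forall f1 f2, S f1 -> S f2 ->
             cstar_norm (psi 1 * psi (f1 * f2) - psi f1 * psi f2) < e),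
          (forall f a, S f -> F a ->
             cstar_norm (psi f * a - a * psi f) < e) &
          (forall f, S f ->
             sup [set cstar_norm (psi (Lt g f) - alpha g (psi f))
                 | g in [set: G]] < e)],
      psi 1 = d &
      [/\ cuntz_in [set: A] (cutdown (1 - d) e) x,
          cuntz_in (fixed_algebra alpha) (cutdown (1 - d) e) y &
          1 - e < cstar_norm (d * x * d)]].

Definition weak_tracial_rokhlin :=
  forall (e : R) (F : set A) (S : set (G -> R[i]^o)) (x y : A),
    0 < e -> finite_set F -> finite_set S -> S `<=` CG ->
    positive_in [set: A] x -> cstar_norm x = 1 ->
    positive_in (fixed_algebra alpha) y -> y <> 0 ->
    exists (d : A) (psi : (G -> R[i]^o) -> A),
      rokhlin_conditions e F S x y d psi.

Definition weak_tracial_rokhlin_comparison :=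
  forall (e : R) (F : set A) (S : set (G -> R[i]^o)) (x y : A),
    0 < e -> finite_set F -> finite_set S -> S `<=` CG ->
    positive_in [set: A] x -> cstar_norm x = 1 ->
    positive_in (fixed_algebra alpha) y -> y <> 0 ->
    exists (d : A) (psi : (G -> R[i]^o) -> A),
      rokhlin_conditions e F S x y d psi /\
      cuntz_in (fixed_algebra alpha) (cutdown (1 - d) e) d.

End CompactGroup.

(* Main.v *)
(* Condition (5) holds because every nonzero positive z in A^alpha satisfies
   n^* z n = 1 for some n in A^alpha. In A, pure infiniteness gives r_1, r_2 with
   r_j^* z r_k = delta_jk. For a fine partition of unity p_1, ..., p_m on G and
   suitable points x_i of G, the map a |-> d sum_i psi(p_i) alpha_{x_i}(a), where
   (d, psi) is a Rokhlin pair, sends r_1, r_2 to almost invariant elements, which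
   averages over finite subsets of G (Kakutani's substitute for Haar measure) turn
   into t_1, t_2 in A^alpha with t_j^* z t_k close to delta_jk d^4. Writing
   z = b^* b, the elements b t_1 and b t_2 have almost orthogonal ranges, so
   c = (b t_1)(b t_1)^* - (b t_2)(b t_2)^* has nonzero positive and negative parts.
   A second round compresses c_+ to almost d^4, now for another d, while condition
   (4) lets c_- cover the defect 1 - d; the two are orthogonal, and
   d^4 + (1 - d) >= 1/4 is invertible. *)
Require Import Defs.
From mathcomp Require Import all_boot all_order all_algebra.
From mathcomp Require Import all_classical all_reals all_analysis.
From mathcomp.real_closed Require Import complex.
From mathcomp Require Import ring lra.

Set Implicit Arguments.
Unset Strict Implicit.
Unset Printing Implicit Defensive.

Import Order.TTheory GRing.Theory Num.Theory.
Import numFieldNormedType.Exports.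

Local Open Scope classical_set_scope.
Local Open Scope complex_scope.
Local Open Scope ring_scope.

(** Pure infiniteness is given for [A] only, so every comparison in the fixed point algebra is
    imported from [A], and an imported relation holds only up to [d ^ 4]: each of the two
    transferred factors brings its own [d], and [psi(f) psi(k) ~ d psi(f k)], with a partition of
    unity sent to [psi(1) = d], brings two more. As [d] need not be invertible, one transfer cannot
    reach [1]; hence orthogonal room for [1 - d] is prepared beforehand by transferring two
    orthogonal relations. The second round compresses [c c_+] and [c c_-], not [c_+] and [c_-],
    because [c] has the form [b * m * star b]: the result then has [b] as a left factor and is again
    a compression of [z]. The main estimates must not depend on the number of pieces of the
    partition, which grows as the tolerance shrinks. Order bounds on sums [q b q] give this where
    the triangle inequality would not. Spectral theory is built from the norm axioms: the functional
    calculus rests on polynomial approximation, and averages over roots of unity replace analytic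
    functions in the spectral radius formula. *)

Local Notation nm := cstar_norm.
Local Notation selfadjoint a := (star a = a).

(** * Noncommutative ring identities *)

Section NoncommutativeRing.

(** Decision by reflection for noncommutative ring identities: an expression expands into signed
    words in the atoms, and an equation is accepted when the words of the difference cancel in
    opposite pairs. *)
Inductive ncexpr :=
  NVar of nat | NZero | NOne | NAdd of ncexpr & ncexpr | NOpp of ncexpr
| NMul of ncexpr & ncexpr.

Definition ncterm := (bool * seq nat)%type.

Fixpoint ncnorm (e : ncexpr) : seq ncterm :=
  match e with
  | NVar i => [:: (false, [:: i])]
  | NZero => [::]
  | NOne => [:: (false, [::])]
  | NAdd e1 e2 => ncnorm e1 ++ ncnorm e2
  | NOpp e1 => [seq (~~ t.1, t.2) | t <- ncnorm e1]
  | NMul e1 e2 => [seq (t.1 (+) u.1, t.2 ++ u.2) | t <- ncnorm e1, u <- ncnorm e2]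
  end.

Fixpoint nccancel (n : nat) (l : seq ncterm) : bool :=
  match n, l with
  | _, [::] => true
  | n'.+1, t :: l' =>
      ((~~ t.1, t.2) \in l') && nccancel n' (rem (~~ t.1, t.2) l')
  | _, _ => false
  end.

Context (S : pzRingType) (env : seq S).

Fixpoint nceval (e : ncexpr) : S :=
  match e with
  | NVar i => nth 0 env i
  | NZero => 0
  | NOne => 1
  | NAdd e1 e2 => nceval e1 + nceval e2
  | NOpp e1 => - nceval e1
  | NMul e1 e2 => nceval e1 * nceval e2
  end.

Definition ncword (w : seq nat) : S := \prod_(i <- w) nth 0 env i.
Definition ncterm_eval (t : ncterm) : S := if t.1 then - ncword t.2 else ncword t.2.

Lemma ncnormE e : nceval e = \sum_(t <- ncnorm e) ncterm_eval t.
Proof.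
elim: e => [i|||e1 h1 e2 h2|e h|e1 h1 e2 h2] /=.
- by rewrite big_seq1 /ncterm_eval /ncword /= big_seq1.
- by rewrite big_nil.
- by rewrite big_seq1 /ncterm_eval /ncword /= big_nil.
- by rewrite big_cat /= h1 h2.
- rewrite big_map h -sumrN; apply: eq_bigr => -[[] w] _ //=.
  by rewrite /ncterm_eval /= opprK.
- rewrite big_allpairs_dep h1 h2 mulr_suml; apply: eq_bigr => -[s v] _.
  rewrite mulr_sumr; apply: eq_bigr => -[s' w] _.
  rewrite /ncterm_eval /= /ncword big_cat /=.
  by case: s; case: s'; rewrite /= ?mulNr ?mulrN ?opprK.
Qed.

Lemma nccancelP n l : nccancel n l -> \sum_(t <- l) ncterm_eval t = 0.
Proof.
elim: n l => [|n IH] [|t l] //=; rewrite ?big_nil // => /andP[tl /IH h].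
rewrite big_cons (perm_big _ (perm_to_rem tl)) big_cons /= h addr0.
by case: t {h tl} => [[] w]; rewrite /ncterm_eval /= ?subrr // addrC subrr.
Qed.

Lemma ncring_correct e1 e2 :
  (let l := ncnorm (NAdd e1 (NOpp e2)) in nccancel (size l) l) ->
  nceval e1 = nceval e2.
Proof.
move=> /nccancelP; rewrite -ncnormE /= => h.
by apply/eqP; rewrite -subr_eq0 h.
Qed.

End NoncommutativeRing.

Ltac nc_index x l :=
  lazymatch l with
  | nil => constr:(O)
  | cons ?y ?l' =>
      let b := match goal with
               | _ => let _ := match goal with _ => unify x y end in constr:(true)
               | _ => constr:(false) end in
      lazymatch b with
      | true => constr:(O)
      | false => let n := nc_index x l' in constr:(Datatypes.S n)
      end
  end.

Ltac nc_atoms l t :=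
  lazymatch t with
  | (?x + ?y)%R => let l1 := nc_atoms l x in nc_atoms l1 y
  | (- ?x)%R => nc_atoms l x
  | (?x * ?y)%R => let l1 := nc_atoms l x in nc_atoms l1 y
  | 0%R => l
  | 1%R => l
  | _ =>
      let rec mem l := lazymatch l with
        | nil => constr:(false)
        | cons ?y ?l' =>
          match goal with
          | _ => let _ := match goal with _ => unify t y end in constr:(true)
          | _ => mem l'
          end
        end in
      let b := mem l in
      lazymatch b with true => l | false => constr:(cons t l) end
  end.

Ltac nc_reify l t :=
  lazymatch t with
  | (?x + ?y)%R => let a := nc_reify l x in let b := nc_reify l y in constr:(NAdd a b)
  | (- ?x)%R => let a := nc_reify l x in constr:(NOpp a)
  | (?x * ?y)%R => let a := nc_reify l x in let b := nc_reify l y in constr:(NMul a b)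
  | 0%R => constr:(NZero)
  | 1%R => constr:(NOne)
  | _ => let n := nc_index t l in constr:(NVar n)
  end.

(* Powers and scalar multiples are atoms. *)
Ltac ncring :=
  lazymatch goal with
  | |- @eq ?T ?x ?y =>
      let l0 := nc_atoms (@nil T) x in
      let l := nc_atoms l0 y in
      let e1 := nc_reify l x in
      let e2 := nc_reify l y in
      refine (@ncring_correct _ l e1 e2 _); vm_compute; reflexivity
  end.

(** * Norm *)

Section Norm.
Context {R : realType} {A : cstarAlgType R}.
Implicit Types (a b c x y : A) (u v : nat -> A).

Lemma ReC_norm (r : R) : complex.Re `|r%:C| = `|r|.
Proof. by rewrite normc_def /= expr0n /= addr0 sqrtr_sqr. Qed.

Lemma star0 : star (0 : A) = 0.
Proof. by apply: (addrI (star 0)); rewrite -starD !addr0. Qed.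

Lemma starN a : star (- a) = - star a.
Proof. by apply: (addrI (star a)); rewrite -starD !subrr star0. Qed.

Lemma starB a b : star (a - b) = star a - star b.
Proof. by rewrite starD starN. Qed.

Lemma star1 : star (1 : A) = 1.
Proof. by have := starM (star (1 : A)) 1; rewrite mulr1 !starK mulr1. Qed.

Lemma starX a n : star (a ^+ n) = star a ^+ n.
Proof. by elim: n => [|n IH]; rewrite ?expr0 ?star1// exprSr starM IH exprS. Qed.

Lemma star_sum I (r : seq I) (P : pred I) (F : I -> A) :
  star (\sum_(i <- r | P i) F i) = \sum_(i <- r | P i) star (F i).
Proof.
elim/big_rec2: _ => [|i y1 y2 _ <-]; [exact: star0 | by rewrite starD].
Qed.

Lemma starZr (r : R) a : star (r%:C *: a) = r%:C *: star a.
Proof. by rewrite starZ conj_Creal // complex_real. Qed.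

Lemma nm0 : nm (0 : A) = 0.
Proof. by rewrite -(scale0r (0 : A)) cstar_normZ normr0 mul0r. Qed.

Lemma nmZr (r : R) a : nm (r%:C *: a) = `|r| * nm a.
Proof. by rewrite cstar_normZ ReC_norm. Qed.

Lemma nmN a : nm (- a) = nm a.
Proof. by rewrite -scaleN1r cstar_normZ normrN1 mul1r. Qed.

Lemma nmC a b : nm (a - b) = nm (b - a).
Proof. by rewrite -nmN opprB. Qed.

Lemma nm_ge0 a : 0 <= nm a.
Proof.
have := cstar_normD a (- a); rewrite subrr nm0 nmN => h.
by move: h; rewrite -mulr2n pmulrn_lge0.
Qed.

Lemma nm_eq0 a : (nm a == 0) = (a == 0).
Proof. by apply/eqP/eqP => [/cstar_norm_eq0//|->]; rewrite nm0. Qed.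

Lemma nm_gt0 a : (0 < nm a) = (a != 0).
Proof. by rewrite lt_def nm_ge0 nm_eq0 andbT. Qed.

Lemma nm_star a : nm (star a) = nm a.
Proof.
suff H b : nm b <= nm (star b) by apply/eqP; rewrite eq_le H -{2}(starK a) H.
have [->|b0] := eqVneq b 0; first by rewrite star0.
have : nm b ^+ 2 <= nm (star b) * nm b by rewrite -cstar_norm_starM cstar_normM.
by rewrite expr2 ler_pM2r // nm_gt0.
Qed.

Lemma nm1 : nm (1 : A) = 1.
Proof.
have : nm (1 : A) ^+ 2 = nm (1 : A) by rewrite -cstar_norm_starM star1 mulr1.
move/eqP; rewrite expr2 -subr_eq0 -{3}(mulr1 (nm 1)) -mulrBr mulf_eq0 nm_eq0.
by rewrite oner_eq0 /= subr_eq0 => /eqP.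
Qed.

Lemma nm_subT c a b : nm (a - b) <= nm (a - c) + nm (c - b).
Proof. by rewrite -[a - b](subrKA c) cstar_normD. Qed.

Lemma nmB a b : nm (a - b) <= nm a + nm b.
Proof. by rewrite -(nmN b) cstar_normD. Qed.

Lemma nm_sum I (r : seq I) (P : pred I) (F : I -> A) :
  nm (\sum_(i <- r | P i) F i) <= \sum_(i <- r | P i) nm (F i).
Proof.
elim/big_rec2: _ => [|i y1 y2 _ h]; first by rewrite nm0.
by apply: le_trans (cstar_normD _ _) _; rewrite lerD2l.
Qed.

Lemma nm_sub_abs a b : `|nm a - nm b| <= nm (a - b).
Proof.
have h x y : nm x - nm y <= nm (x - y).
  by rewrite lerBlDr -{1}(subrK y x) cstar_normD.
by rewrite ler_norml h andbT lerNl opprB nmC h.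
Qed.

(** Powers of a selfadjoint element are selfadjoint, so the C*-identity applies at each squaring.
    This is what ties the norm to the spectrum in [spectral_radius1]. *)
Lemma nm_sa_exp2 a k : selfadjoint a -> nm (a ^+ (2 ^ k)) = nm a ^+ (2 ^ k).
Proof.
move=> sa; elim: k => [|k IH]; first by rewrite !expr1.
by rewrite expnSr !exprM -IH expr2 -cstar_norm_starM starX sa.
Qed.

Lemma nm_sa_sqr a : selfadjoint a -> nm (a * a) = nm a ^+ 2.
Proof. by move=> sa; rewrite -cstar_norm_starM sa. Qed.

Lemma nm_small_eq0 a : (forall e, 0 < e -> nm a <= e) -> a = 0.
Proof.
move=> h; apply/eqP; rewrite -nm_eq0 eq_le nm_ge0 andbT.
by apply/ler_addgt0Pl => e e0; rewrite addr0 h.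
Qed.

(** * Topology *)

Lemma nbhs_nmP a (U : set A) :
  nbhs a U <-> exists2 e : R, 0 < e & forall b, nm (a - b) < e -> U b.
Proof.
rewrite nbhsP; split.
- case=> E /= /cstar_entourageE[e e0 He] HU; exists e => // b hb; apply: HU.
  by rewrite /xsection /= inE; exact: He.
- case=> e e0 H; exists [set ab | nm (ab.1 - ab.2) < e].
    by apply/cstar_entourageE; exists e.
  by move=> b; rewrite /xsection /= inE /=; exact: H.
Qed.

Definition nm_cvg u a :=
  forall e : R, 0 < e -> exists N, forall n, (N <= n)%N -> nm (u n - a) < e.

Lemma nm_cvgP u a : (u @ \oo --> a) <-> nm_cvg u a.
Proof.
split.
- move=> h e e0.
  have : nbhs a [set b | nm (a - b) < e] by apply/nbhs_nmP; exists e.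
  by move/h => -[N _ HN]; exists N => n Nn; rewrite nmC; exact: HN.
- move=> h U /nbhs_nmP[e e0 HU]; have [N HN] := h _ e0.
  by exists N => // n Nn; apply: HU; rewrite nmC; exact: HN.
Qed.

Lemma nm_cvg_unique u a b : nm_cvg u a -> nm_cvg u b -> a = b.
Proof.
move=> ha hb; apply/eqP; rewrite -subr_eq0; apply/eqP/nm_small_eq0 => e e0.
have e2 : 0 < e / 2 by rewrite divr_gt0.
have [N HN] := ha _ e2; have [M HM] := hb _ e2.
apply: le_trans (nm_subT (u (maxn N M)) _ _) _.
rewrite [leRHS]splitr lerD // ltW //; last by apply: HM; exact: leq_maxr.
by rewrite nmC HN // leq_maxl.
Qed.

Lemma nm_cauchy_cvg u :
  (forall e : R, 0 < e -> exists N, forall n m, (N <= n)%N -> (N <= m)%N ->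
     nm (u n - u m) < e) -> exists a, nm_cvg u a.
Proof.
move=> h; have [a ha] : exists a : A, (u @ \oo --> a).
  apply: cstar_complete => /= E /cstar_entourageE[e e0 HE].
  have [N HN] := h _ e0.
  exists ([set x | exists2 n, (N <= n)%N & x = u n],
          [set x | exists2 n, (N <= n)%N & x = u n]) => /=.
    by split; exists N => // n Nn; exists n.
  by case=> x y [[n Nn /= ->] [m Mm /= ->]]; apply: HE; exact: HN.
by exists a; apply/nm_cvgP.
Qed.

Lemma closed_nm (B : set A) :
  (forall a, (forall e : R, 0 < e -> exists2 b, B b & nm (a - b) < e) -> B a) ->
  closed B.
Proof.
move=> h a ha; apply: h => e e0.
have /ha [b [Bb hb]] : nbhs a [set b | nm (a - b) < e] by apply/nbhs_nmP; exists e.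
by exists b.
Qed.

Lemma nm_closed (B : set A) a : closed B ->
  (forall e : R, 0 < e -> exists2 b, B b & nm (a - b) < e) -> B a.
Proof.
move=> cB h; apply: cB => U /nbhs_nmP[e e0 HU].
by have [b Bb hb] := h _ e0; exists b; split=> //; exact: HU.
Qed.

(** * Invertible elements and the Neumann series *)

Definition inverse a b := a * b = 1 /\ b * a = 1.
Definition invertible a := exists b, inverse a b.

Lemma inverseM a b a' b' : inverse a a' -> inverse b b' ->
  inverse (a * b) (b' * a').
Proof.
move=> [h1 h2] [h3 h4]; split.
  by rewrite mulrA -(mulrA a) h3 mulr1.
by rewrite mulrA -(mulrA b') h2 mulr1.
Qed.

Lemma invertibleM a b : invertible a -> invertible b -> invertible (a * b).
Proof. by move=> [a' ha] [b' hb]; exists (b' * a'); exact: inverseM. Qed.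

Lemma nmX a n : nm (a ^+ n) <= nm a ^+ n.
Proof.
elim: n => [|n IH]; first by rewrite !expr0 nm1.
rewrite !exprS; apply: le_trans (cstar_normM _ _) _.
by rewrite ler_wpM2l ?nm_ge0.
Qed.

Lemma nm_limit_le u a (M : R) : nm_cvg u a -> (forall n, nm (u n) <= M) ->
  nm a <= M.
Proof.
move=> h hM; apply/ler_addgt0Pl => e e0; have [N HN] := h _ e0.
have := HN N (leqnn _); rewrite nmC => h1.
rewrite -(subrK (u N) a); apply: le_trans (cstar_normD _ _) _.
by rewrite lerD // ltW.
Qed.

Lemma nm_cvgMl u a b : nm_cvg u a -> nm_cvg (fun n => b * u n) (b * a).
Proof.
move=> h e e0; have b0 : 0 < nm b + 1 by rewrite ltr_wpDl ?nm_ge0.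
have [N HN] := h (e / (nm b + 1)) (divr_gt0 e0 b0); exists N => n /HN {}HN.
rewrite -mulrBr; apply: le_lt_trans (cstar_normM _ _) _.
rewrite ltr_pdivlMr // mulrC in HN; apply: le_lt_trans HN.
by rewrite ler_wpM2r ?nm_ge0 // lerDl.
Qed.

Lemma nm_cvgMr u a b : nm_cvg u a -> nm_cvg (fun n => u n * b) (a * b).
Proof.
move=> h e e0; have b0 : 0 < nm b + 1 by rewrite ltr_wpDl ?nm_ge0.
have [N HN] := h (e / (nm b + 1)) (divr_gt0 e0 b0); exists N => n /HN {}HN.
rewrite -mulrBl; apply: le_lt_trans (cstar_normM _ _) _.
rewrite ltr_pdivlMr // in HN; apply: le_lt_trans HN.
by rewrite ler_wpM2l ?nm_ge0 // lerDl.
Qed.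

Lemma expr_small (r e : R) : 0 <= r -> r < 1 -> 0 < e ->
  exists N, forall n, (N <= n)%N -> r ^+ n < e.
Proof.
move=> r0 r1 e0.
have /cvgrPdist_lt/(_ _ e0) [N _ HN] : (fun n => r ^+ n) @ \oo --> (0 : R).
  by apply: cvg_expr; rewrite ger0_norm.
exists N => n Nn; have := HN n Nn; rewrite /= sub0r normrN ger0_norm //.
exact: exprn_ge0.
Qed.

(** Geometric series, with tail after [n] terms at most [r ^+ n / (1 - r)]. The explicit bound on
    the inverse is what later bounds resolvents locally uniformly. *)
Lemma neumann x (r : R) : nm x <= r -> r < 1 ->
  exists2 b, inverse (1 - x) b & nm b <= (1 - r)^-1.
Proof.
move=> xr r1; have r0 : 0 <= r := le_trans (nm_ge0 x) xr.
pose u n := \sum_(i < n) x ^+ i.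
have geoR n : \sum_(i < n) r ^+ i = (1 - r ^+ n) / (1 - r).
  apply: (mulfI (x := 1 - r)); first by rewrite subr_eq0 gt_eqF.
  rewrite mulrCA mulfV ?subr_eq0 ?gt_eqF // mulr1 -[1 in RHS](expr1n _ n) subrXX.
  by congr (_ * _); apply: eq_bigr => i _; rewrite expr1n mul1r.
have bnd n m : (n <= m)%N -> nm (u m - u n) <= r ^+ n / (1 - r).
  move=> nm'; rewrite /u -!(big_mkord xpredT (fun i => x ^+ i)).
  rewrite (big_cat_nat _ nm') //= addrAC subrr add0r.
  apply: le_trans (nm_sum _ _ _) _.
  apply: (@le_trans _ _ (\sum_(n <= i < m) r ^+ i)).
    apply: ler_sum => i _; apply: le_trans (nmX _ _) _.
    by rewrite lerXn2r // nnegrE ?nm_ge0.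
  have -> : \sum_(n <= i < m) r ^+ i = \sum_(i < m) r ^+ i - \sum_(i < n) r ^+ i.
    rewrite -!(big_mkord xpredT (fun i => r ^+ i)) [in RHS](big_cat_nat _ nm') //=.
    by rewrite addrAC subrr add0r.
  rewrite !geoR -mulrBl ler_wpM2r ?invr_ge0 ?subr_ge0 ?(ltW r1) //.
  by have := exprn_ge0 m r0; lra.
have [b hb] : exists b, nm_cvg u b.
  apply: nm_cauchy_cvg => e e0.
  have e1 : 0 < e * (1 - r) / 2 by rewrite divr_gt0 // mulr_gt0 // subr_gt0.
  have [N HN] := expr_small r0 r1 e1.
  exists N => n m Nn Nm; apply: le_lt_trans (nm_subT (u N) _ _) _.
  rewrite (nmC (u N)); have := HN N (leqnn _).
  rewrite ltr_pdivlMr // => h; have := bnd _ _ Nn; have := bnd _ _ Nm.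
  move=> h1 h2; apply: le_lt_trans (lerD h2 h1) _.
  by rewrite -mulr2n -mulr_natr mulrAC ltr_pdivrMr // subr_gt0.
have um n : (1 - x) * u n = 1 - x ^+ n.
  rewrite /u -[1 in RHS](expr1n _ n) subrXX_comm; last exact/commr_sym/commr1.
  by congr (_ * _); apply: eq_bigr => i _; rewrite expr1n mul1r.
have um' n : u n * (1 - x) = 1 - x ^+ n.
  rewrite -um /u mulr_suml mulr_sumr; apply: eq_bigr => i _.
  by rewrite mulrBl mulrBr mul1r mulr1 -exprS -exprSr.
have lim1 : nm_cvg (fun n => 1 - x ^+ n) 1.
  move=> e e0; have [N HN] := expr_small r0 r1 e0; exists N => n /HN h.
  rewrite addrAC subrr add0r nmN; apply: le_lt_trans h.
  by apply: le_trans (nmX _ _) _; rewrite lerXn2r // nnegrE ?nm_ge0.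
exists b; first split.
- apply: (nm_cvg_unique (nm_cvgMl (1 - x) hb)).
  by move=> e /lim1[N HN]; exists N => n /HN; rewrite um.
- apply: (nm_cvg_unique (nm_cvgMr (1 - x) hb)).
  by move=> e /lim1[N HN]; exists N => n /HN; rewrite um'.
- apply: (nm_limit_le hb) => n; rewrite -[u n]subr0.
  have -> : (0 : A) = u 0%N by rewrite /u big_ord0.
  by apply: le_trans (bnd _ _ (leq0n n)) _; rewrite expr0 mul1r.
Qed.

Lemma neumann_ex x : nm x < 1 -> invertible (1 - x).
Proof. by move=> h; have [b ib _] := neumann (lexx _) h; exists b. Qed.

Lemma invertibleZ (l : R[i]) a : l != 0 -> invertible a -> invertible (l *: a).
Proof.
move=> l0 [b [h1 h2]]; exists (l^-1 *: b); split.
  by rewrite -scalerAr -scalerAl scalerA h1 mulVf // scale1r.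
by rewrite -scalerAr -scalerAl scalerA h2 mulfV // scale1r.
Qed.

Lemma spectrum_le a (l : R[i]) : spectrum a l -> complex.Re `|l| <= nm a.
Proof.
move=> H; rewrite leNgt; apply/negP => h; apply: H.
have l0 : l != 0 by apply/eqP => l0; move: h; rewrite l0 normr0 ltNge nm_ge0.
have nl : complex.Re `|l^-1| = (complex.Re `|l|)^-1.
  by rewrite normfV normc_def -fmorphV.
have lp : 0 < complex.Re `|l| by rewrite (le_lt_trans (nm_ge0 a)).
have -> : a - l%:A = (- l) *: (1 - l^-1 *: a).
  by rewrite scaleNr -scalerN opprB scalerBr scalerA mulfV // scale1r.
apply: invertibleZ; first by rewrite oppr_eq0.
by apply: neumann_ex; rewrite cstar_normZ nl mulrC ltr_pdivrMr // mul1r.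
Qed.

End Norm.

(** * Spectrum of a selfadjoint element *)

Section Spectrum.
Context {R : realType} {A : cstarAlgType R}.
Implicit Types (a b c x y : A).

(** In [(a + it)(a - it)] the cross terms cancel, so an imaginary shift increases the squared norm
    by at most [t ^+ 2], with no term linear in [t]. *)
Lemma nm_sub_imag a (t : R) : selfadjoint a ->
  nm (a - (0 +i* t)%:A) ^+ 2 <= nm a ^+ 2 + t ^+ 2.
Proof.
move=> sa; rewrite -cstar_norm_starM starB sa starZ star1.
have -> : (0 +i* t)^* = - (0 +i* t) :> R[i].
  by rewrite /Num.conj /= /GRing.opp /= oppr0.
have -> : (a - - (0 +i* t) *: 1) * (a - (0 +i* t) *: 1) = a * a + (t ^+ 2)%:C *: 1.
  rewrite scaleNr opprK mulrDl !mulrBr -!scalerAl -!scalerAr !mulr1 !mul1r.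
  rewrite scalerA addrA subrK -scaleNr; congr (_ + _ *: _).
  rewrite /GRing.mul /GRing.opp /=; congr (_ +i* _); ring.
apply: le_trans (cstar_normD _ _) _.
by rewrite nm_sa_sqr // nmZr nm1 mulr1 ger0_norm ?sqr_ge0.
Qed.

Lemma scale_halfD x : (2^-1)%:C *: (x + x) = x.
Proof.
rewrite -mulr2n -[x *+ 2]scaler_nat scalerA -(rmorph_nat (real_complex R)).
by rewrite -rmorphM mulVf ?rmorph1 ?scale1r // pnatr_eq0.
Qed.

Lemma spectrum_shift a (l m : R[i]) : spectrum a l -> spectrum (a - m%:A) (l - m).
Proof.
move=> h [b hb]; apply: h; exists b.
by move: hb; rewrite scalerBl opprB addrA subrK.
Qed.

(** Arens' trick: if [is] with [s != 0] were in the spectrum of [b], then shifting by [it] would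
    give [(s - t) ^+ 2 <= nm b ^+ 2 + t ^+ 2] for every real [t], but the term [-2st] is
    unbounded. *)
Lemma spectrum_real a (l : R[i]) : selfadjoint a -> spectrum a l ->
  l = (complex.Re l)%:C.
Proof.
move=> sa; case: l => r s hl /=; congr (_ +i* _); apply/eqP/negPn/negP => s0.
pose b := a - r%:C%:A.
have sb : selfadjoint b by rewrite /b starB starZr star1 sa.
have hb : spectrum b (0 +i* s).
  have := spectrum_shift (m := r%:C) hl.
  by rewrite /GRing.add /GRing.opp /= subrr oppr0 addr0.
have key t : (s - t) ^+ 2 <= nm b ^+ 2 + t ^+ 2.
  apply: le_trans (nm_sub_imag t sb).
  have := spectrum_le (spectrum_shift (m := 0 +i* t) hb).
  have -> : 0 +i* s - 0 +i* t = 0 +i* (s - t) :> R[i].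
    by apply/eqP; rewrite eq_complex /= subrr !eqxx.
  rewrite normc_def /= expr0n /= add0r sqrtr_sqr => h; rewrite -real_normK ?num_real //.
  by rewrite lerXn2r ?nnegrE ?nm_ge0.
(* This [t] makes [-2st] equal to [nm b ^+ 2 + 1], just above what the inequality allows. *)
have := key (- (nm b ^+ 2 + 1) / (2 * s)).
set u := _ / _; have hu : 2 * s * u = - (nm b ^+ 2 + 1).
  by rewrite /u mulrC divfK // mulf_neq0 // pnatr_eq0.
have : 0 <= s ^+ 2 := sqr_ge0 s.
rewrite sqrrB -mulr_natl; nra.
Qed.

Lemma invertible_spectrum a (m : R[i]) :
  m != 0 -> ~ spectrum a m^-1 -> invertible (1 - m *: a).
Proof.
move=> m0 /contrapT h.
have -> : 1 - m *: a = (- m) *: (a - m^-1%:A).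
  by rewrite scaleNr -scalerN opprB scalerBr scalerA mulfV // scale1r.
by apply: invertibleZ => //; rewrite oppr_eq0.
Qed.

(** With [b] the inverse at [m], [1 - l a = (1 - (l - m) a b)(1 - m a)]; near [m] the first factor
    is within [1 / 2] of [1], so Neumann inverts it with inverse of norm at most [2]. *)
Lemma resolvent_local a (m : R[i]) : invertible (1 - m *: a) ->
  exists2 e : R, 0 < e & exists M : R, forall l : R[i],
    complex.Re `|l - m| < e ->
    exists2 b, inverse (1 - l *: a) b & nm b <= M.
Proof.
move=> [b hb]; pose C := nm a * nm b + 1.
have C0 : 0 < C by rewrite ltr_wpDl // mulr_ge0 ?nm_ge0.
exists (1 / 2 / C); first by rewrite !divr_gt0.
exists (nm b * (1 - 1 / 2)^-1) => l hl.
have hx : nm ((l - m) *: (a * b)) <= 1 / 2.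
  rewrite cstar_normZ; move: hl; rewrite ltr_pdivlMr // => /ltW; apply: le_trans.
  have l0 : 0 <= complex.Re `|l - m| by rewrite normc_def /= sqrtr_ge0.
  rewrite ler_wpM2l //; apply: le_trans (cstar_normM _ _) _.
  by rewrite /C lerDl.
have h1 : 1 / 2 < 1 :> R by lra.
have [b' hb' nb'] := neumann hx h1.
exists (b * b').
  have -> : 1 - l *: a = (1 - (l - m) *: (a * b)) * (1 - m *: a).
    rewrite mulrBl mul1r -scalerAl -mulrA hb.2 mulr1 scalerBl opprB.
    by rewrite addrA subrK.
  exact: inverseM.
apply: le_trans (cstar_normM _ _) _.
by rewrite ler_wpM2l ?nm_ge0.
Qed.

Lemma normc_split (x y : R) : complex.Re `|x +i* y| <= `|x| + `|y|.
Proof.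
rewrite normc_def /= -[leRHS]ger0_norm ?addr_ge0 // -sqrtr_sqr ler_wsqrtr //.
rewrite -(real_normK (num_real x)) -(real_normK (num_real y)) sqrrD.
by rewrite lerD2r lerDl mulrn_wge0 // mulr_ge0.
Qed.

(** Compactness turns the local bounds into one. A square is used because it is a product of
    segments; it contains the unit disc, where the bound is needed. *)
Lemma resolvent_bounded a :
  (forall x y : R, `|x| <= 1 -> `|y| <= 1 -> invertible (1 - (x +i* y) *: a)) ->
  exists M : R, forall x y : R, `|x| <= 1 -> `|y| <= 1 ->
    exists2 b, inverse (1 - (x +i* y) *: a) b & nm b <= M.
Proof.
move=> H; pose K := `[-1, 1]%classic `*` `[-1, 1]%classic : set (R * R).
have cK : compact K by apply: compact_setX; exact: segment_compact.
have [|M [_ HM]] := (compact_near_coveringP K).1 cK R (pinfty_nbhs R)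
    (fun M p => exists2 b, inverse (1 - (p.1 +i* p.2) *: a) b & nm b <= M) _.
  move=> [x y] [/=]; rewrite !in_itv /= -!ler_norml => hx hy.
  have [e e0 [M hM]] := resolvent_local (H _ _ hx hy).
  exists ([set p | `|x - p.1| < e / 2 /\ `|y - p.2| < e / 2], [set N | M < N]).
    split => /=.
      have e2 : 0 < e / 2 by rewrite divr_gt0.
      exists (ball x (e / 2), ball y (e / 2)); last by move=> [u v].
      by split; exact: nbhsx_ballx.
    exact: nbhs_pinfty_gt (num_real M).
  case=> [[u v] N] /= [[hu hv] hN].
  have [|b ib nb] := hM (u +i* v).
    rewrite {1}/GRing.add {1}/GRing.opp /=; apply: le_lt_trans (normc_split _ _) _.
    by rewrite [ltRHS]splitr distrC (distrC v) ltrD.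
  by exists b => //; rewrite (le_trans nb) // ltW.
exists (M + 1) => x y hx hy; have /= := HM (M + 1) _ (x, y); apply.
  by rewrite ltrDl.
by split; rewrite /= in_itv /= -ler_norml.
Qed.

(** The resolvent identity [f l - f m = (l - m) f(l) a f(m)] combined with the uniform bound. *)
Lemma resolvent_lipschitz a :
  (forall x y : R, `|x| <= 1 -> `|y| <= 1 -> invertible (1 - (x +i* y) *: a)) ->
  exists f : R[i] -> A, exists2 C : R, 0 <= C &
    (forall m : R[i], `|m| <= 1 -> inverse (1 - m *: a) (f m)) /\
    (forall l m : R[i], `|l| <= 1 -> `|m| <= 1 ->
       nm (f l - f m) <= C * complex.Re `|l - m|).
Proof.
move=> /resolvent_bounded[M HM].
pose P (m : R[i]) b := `|m| <= 1 -> inverse (1 - m *: a) b /\ nm b <= M.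
have HP m : exists b, P m b.
  case: (boolP (`|m| <= 1)) => [h|/negP h]; last by exists 0 => /h.
  case: m h => x y h.
  have [hx hy] : `|x| <= 1 /\ `|y| <= 1.
    have h1 : Num.sqrt (x ^+ 2 + y ^+ 2) <= 1 by move: h; rewrite normc_def lecE /= => /andP[].
    by split; apply: le_trans h1; rewrite -sqrtr_sqr ler_wsqrtr // ?lerDl ?lerDr sqr_ge0.
  by have [b h1 h2] := HM _ _ hx hy; exists b => _.
have [f Hf] := choice HP.
have M0 : 0 <= M.
  by have [b _ h] := HM 0 0 ltac:(by rewrite normr0) ltac:(by rewrite normr0);
    rewrite (le_trans _ h) ?nm_ge0.
exists f, (M * (nm a * M)); first by rewrite !mulr_ge0 ?nm_ge0.
split=> [m /Hf[]//|l m /Hf[[h1 h2] h3] /Hf[[h4 h5] h6]].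
have -> : f l - f m = (l - m) *: (f l * (a * f m)).
  rewrite scalerAr scalerAl scalerBl.
  have -> : l *: a - m *: a = (1 - m *: a) - (1 - l *: a).
    by rewrite opprB [RHS]addrC addrA subrK.
  by rewrite mulrBl h4 mulrBr mulrA h2 mul1r mulr1.
rewrite cstar_normZ mulrC ler_wpM2r //; first by rewrite normc_def /= sqrtr_ge0.
apply: le_trans (cstar_normM _ _) _; rewrite ler_pM ?nm_ge0 //.
apply: le_trans (cstar_normM _ _) _; rewrite ler_pM ?nm_ge0 //.
Qed.

(* The average of (1 - y)^-1 and (1 + y)^-1 is (1 - y^2)^-1: averaging the
   resolvent over 2^k-th roots of unity keeps its Lipschitz constant and yields
   the inverse of 1 - (m a)^(2^k). *)
Lemma resolvent_power_lipschitz a (f : R[i] -> A) (C : R) k :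
  (forall m : R[i], `|m| <= 1 -> inverse (1 - m *: a) (f m)) ->
  (forall l m : R[i], `|l| <= 1 -> `|m| <= 1 ->
     nm (f l - f m) <= C * complex.Re `|l - m|) ->
  exists g : R[i] -> A,
    (forall m : R[i], `|m| <= 1 -> inverse (1 - (m *: a) ^+ (2 ^ k)) (g m)) /\
    (forall l m : R[i], `|l| <= 1 -> `|m| <= 1 ->
       nm (g l - g m) <= C * complex.Re `|l - m|).
Proof.
move=> hf hC; elim: k => [|k [g [hg gC]]]; first by exists f.
(* Replacing [m] by [z * m] changes the sign of [(m a) ^+ (2 ^ k)] and keeps [|m|]. *)
pose z : R[i] := (2 ^ k).-root (-1).
have k0 : (0 < 2 ^ k)%N by rewrite expn_gt0.
have zk : z ^+ (2 ^ k) = -1 by rewrite rootCK.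
have nz : `|z| = 1.
  by apply/eqP; rewrite -(@pexpr_eq1 _ _ (2 ^ k)) // -?normrX ?zk ?normrN1.
have nzm (m : R[i]) : `|m| <= 1 -> `|z * m| <= 1 by rewrite normrM nz mul1r.
exists (fun m => (2^-1)%:C *: (g m + g (z * m))); split.
- move=> m hm; have [h1 h2] := hg _ hm; have [h3 h4] := hg _ (nzm _ hm).
  have e : ((z * m) *: a) ^+ (2 ^ k) = - (m *: a) ^+ (2 ^ k).
    by rewrite -scalerA exprZn zk scaleN1r.
  move: h3 h4; rewrite e opprK => h3 h4; set y := (m *: a) ^+ (2 ^ k) in h1 h2 h3 h4 *.
  have -> : 1 - (m *: a) ^+ (2 ^ k.+1) = 1 - y * y by rewrite expnSr exprM expr2.
  have half : (2^-1)%:C *: ((1 + y) + (1 - y)) = 1 :> A.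
    by rewrite addrACA subrr addr0 scale_halfD.
  have f1 : 1 - y * y = (1 + y) * (1 - y).
    by rewrite mulrDl !mulrBr !mul1r mulr1 addrA subrK.
  have f2 : 1 - y * y = (1 - y) * (1 + y).
    by rewrite mulrBl !mulrDr !mul1r mulr1 opprD addrA addrK.
  split.
    rewrite -scalerAr mulrDr {1}f1 f2 -!mulrA h1 h3 !mulr1.
    exact: half.
  rewrite -scalerAl mulrDl {1}f2 f1 !mulrA h2 h4 !mul1r.
  exact: half.
- move=> l m hl hm; rewrite -scalerBr nmZr ger0_norm ?invr_ge0 //.
  rewrite mulrC ler_pdivrMr // opprD addrACA.
  apply: le_trans (cstar_normD _ _) _; rewrite mulr_natr mulr2n lerD //; first exact: gC.
  apply: le_trans (gC _ _ (nzm _ hl) (nzm _ hm)) _.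
  by rewrite -mulrBr normrM nz mul1r.
Qed.

(** If [1] and [-1] are both missing, [1 - l a] is invertible on the whole square, and the inverses
    [g l] of [1 - (l a) ^+ (2 ^ N)] share a Lipschitz constant independent of [N]. For [m < 1] fixed
    and [N] large, [(m a) ^+ (2 ^ N)] is tiny, so [g m] is near [1], hence so is [g 1]. That forces
    [a ^+ (2 ^ N)] to be small, although its norm is [1]. *)
Lemma spectral_radius1 a : selfadjoint a -> nm a = 1 ->
  spectrum a 1 \/ spectrum a (-1).
Proof.
move=> sa na; apply: contrapT => /not_orP[n1 n2].
have H (x y : R) : `|x| <= 1 -> `|y| <= 1 -> invertible (1 - (x +i* y) *: a).
  move=> hx hy; have [m0|m0] := eqVneq (x +i* y) (0 : R[i]).
    by rewrite m0 scale0r subr0; exists 1; split; rewrite mulr1.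
  apply: invertible_spectrum => // h; have := spectrum_real sa h.
  move: (complex.Re _) => r hr.
  have r1 : `|r| <= 1.
    have := spectrum_le h; rewrite hr ReC_norm na //.
  have : (x +i* y) * r%:C = 1 by rewrite -hr mulfV.
  rewrite /GRing.mul /= !mulr0 subr0 add0r => -[xr yr].
  have r0 : r != 0 by apply: contra_eq_neq xr => ->; rewrite mulr0 eq_sym oner_eq0.
  have xr1 : `|r| = 1.
    apply/eqP; rewrite eq_le r1 /= -(ler_pM2l (x := `|r|)) ?normr_gt0 // mulr1.
    have : `|x| * `|r| = 1 by rewrite -normrM xr normr1.
    move=> e; have := normr_ge0 r; nra.
  have : r = 1 \/ r = -1.
    by move/eqP: xr1; rewrite eqr_norml => /andP[/orP[]/eqP]; auto.
  by case=> e; move: h; rewrite hr e ?rmorphN ?rmorph1.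
have [f [C C0 [hf hC]]] := resolvent_lipschitz H.
(* Chosen so that [C * (1 - m) <= 1 / 8], before [N] is fixed. The two errors, [1 / 8] and at most
   [1 / 7], add up to less than [1 / 3]. *)
pose m : R := 1 - (8 * (C + 1))^-1.
have C1 : 0 < C + 1 by rewrite ltr_wpDl.
have i1 : 0 < (8 * (C + 1))^-1 by rewrite invr_gt0 mulr_gt0.
have i2 : (8 * (C + 1)) * (8 * (C + 1))^-1 = 1 by rewrite mulfV // gt_eqF // mulr_gt0.
have m1 : m < 1 by rewrite /m; lra.
have m0 : 0 <= m by rewrite /m; nra.
have [N HN] := expr_small m0 m1 (e := 1 / 8) ltac:(lra).
have [g [hg gC]] := resolvent_power_lipschitz N hf hC.
have nm1' : `|m%:C| <= 1 :> R[i] by rewrite lecE ReC_norm normc_def /= eqxx ger0_norm // ltW.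
have nn1 : `|1| <= 1 :> R[i] by rewrite normr1.
have [h1 _] := hg _ nm1'; have [h2 _] := hg _ nn1.
have small : m ^+ (2 ^ N) < 1 / 8 by apply: HN; rewrite ltnW // ltn_expl.
have nd : complex.Re `|1 - m%:C| = 1 - m.
  have -> : 1 - m%:C = (1 - m)%:C.
    by apply/eqP; rewrite eq_complex /= subr0 !eqxx.
  by rewrite ReC_norm ger0_norm ?subr_ge0 ?(ltW m1).
have := gC _ _ nn1 nm1'; rewrite nd => hd.
have hd' : C * (1 - m) <= 1 / 8 by rewrite /m; nra.
have e1 : nm (g m%:C - 1) <= (1 + nm (g m%:C - 1)) * (1 / 8).
  have {1}-> : g m%:C - 1 = (m%:C *: a) ^+ (2 ^ N) * g m%:C.
    by rewrite -h1 mulrBl mul1r opprB addrC subrK.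
  apply: le_trans (cstar_normM _ _) _; rewrite mulrC; apply: ler_pM => //; rewrite ?nm_ge0 //.
    by have := cstar_normD (g m%:C - 1) 1; rewrite subrK nm1 addrC.
  rewrite exprZn cstar_normZ; apply: le_trans (ltW small).
  have -> : m%:C ^+ (2 ^ N) = (m ^+ (2 ^ N))%:C by rewrite rmorphXn.
  rewrite ReC_norm ger0_norm ?exprn_ge0 // nm_sa_exp2 // na expr1n mulr1 //.
have e2 : nm (g 1 - 1) <= 1 / 3.
  apply: le_trans (nm_subT (g m%:C) _ _) _.
  lra.
have b1 : nm (a ^+ (2 ^ N)) = 1 by rewrite nm_sa_exp2 // na expr1n.
have : nm (a ^+ (2 ^ N)) <= 1 / 3 * (1 + 1).
  have e : a ^+ (2 ^ N) = (g 1 - 1) * (1 - a ^+ (2 ^ N)).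
    have [_ h3] := hg _ nn1; rewrite scale1r in h3.
    by rewrite mulrBl h3 mul1r opprB addrC subrK.
  rewrite {1}e; apply: le_trans (cstar_normM _ _) _; apply: ler_pM; rewrite ?nm_ge0 //.
  by apply: le_trans (nmB _ _) _; rewrite nm1 b1.
by rewrite b1; lra.
Qed.

Lemma spectral_radius a : selfadjoint a ->
  exists2 t : R, spectrum a t%:C & `|t| = nm a.
Proof.
move=> sa; have [->|a0] := eqVneq a 0.
  exists 0; last by rewrite normr0 nm0.
  move=> [b [+ _]]; rewrite rmorph0 scale0r subrr mul0r => /eqP.
  by rewrite eq_sym oner_eq0.
have na : 0 < nm a by rewrite nm_gt0.
pose b := (nm a)^-1%:C *: a.
have sb : selfadjoint b by rewrite /b starZr sa.
have nb : nm b = 1 by rewrite nmZr ger0_norm ?invr_ge0 ?ltW // mulVf ?gt_eqF.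
have H (s : R) : spectrum b s%:C -> spectrum a (nm a * s)%:C.
  move=> h k; apply: h.
  have -> : b - s%:C%:A = (nm a)^-1%:C *: (a - (nm a * s)%:C%:A).
    by rewrite scalerBr scalerA -rmorphM mulKf // gt_eqF.
  by apply: invertibleZ => //; rewrite fmorph_eq0 invr_eq0 gt_eqF.
case: (spectral_radius1 sb nb) => h.
  exists (nm a); last by rewrite ger0_norm ?ltW.
  by rewrite -[X in X%:C]mulr1; apply: H; rewrite rmorph1.
exists (- nm a); last by rewrite normrN ger0_norm ?ltW.
by rewrite -mulrN1; apply: H; rewrite rmorphN rmorph1.
Qed.

End Spectrum.

(** * Weierstrass approximation *)

Section Weierstrass.
Context {R : realType}.
Implicit Types (f g h : R -> R).

(* Bernstein polynomial \sum_k g(k) C(n,k) X^k (1-X)^(n-k), by Pascal's rule *)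
Fixpoint bernstein n (g : nat -> R) : {poly R} :=
  if n is n'.+1 then 'X * bernstein n' (g \o S) + (1 - 'X) * bernstein n' g
  else (g 0%N)%:P.

Lemma bernsteinS n (g : nat -> R) (x : R) : (bernstein n.+1 g).[x] =
  x * (bernstein n (g \o S)).[x] + (1 - x) * (bernstein n g).[x].
Proof. by rewrite /= !hornerE. Qed.

Lemma bernstein_le n (g h : nat -> R) (x : R) : 0 <= x <= 1 ->
  (forall k, (k <= n)%N -> g k <= h k) -> (bernstein n g).[x] <= (bernstein n h).[x].
Proof.
move=> /andP[x0 x1]; elim: n g h => [|n IH] g h H; first by rewrite !hornerE H.
rewrite !bernsteinS lerD // ler_wpM2l ?subr_ge0 //; apply: IH => k kn; apply: H => //.
exact: leqW.
Qed.

(** Mean and variance of the binomial law. The offset [c] makes the induction work: the shift [k] to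
    [k + 1] in Pascal's rule becomes [c + 1]. *)
Lemma bernstein_quadratic n (u v c x : R) :
  (bernstein n (fun k => u + v * (k%:R + c) ^+ 2)).[x] =
  u + v * ((n%:R * x + c) ^+ 2 + n%:R * x * (1 - x)).
Proof.
elim: n c => [|n IH] c; first by rewrite /= hornerE !mul0r !add0r addr0.
rewrite bernsteinS IH.
have -> : (fun k => u + v * (k%:R + c) ^+ 2) \o S =
          (fun k => u + v * (k%:R + (c + 1)) ^+ 2).
  by apply/funext => k /=; rewrite -natr1 -addrA (addrC 1 c).
rewrite IH -natr1; ring.
Qed.

(** The hypothesis traps [f] between two parabolas around each [x]. Bernstein polynomials preserve
    order and send the parabola to its variance term, at most [C / n], so [n] is taken beyond
    [C / (e / 2)]. *)
Lemma weierstrass01 f :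
  (forall e : R, 0 < e -> exists2 C : R, 0 <= C &
     forall x y : R, 0 <= x <= 1 -> 0 <= y <= 1 ->
     `|f y - f x| <= e + C * (y - x) ^+ 2) ->
  forall e : R, 0 < e ->
    exists p : {poly R}, forall x : R, 0 <= x <= 1 -> `|p.[x] - f x| <= e.
Proof.
move=> H e e0; have [C C0 HC] := H _ (divr_gt0 e0 (ltr0n R 2)).
pose n := (Num.truncn (C / (e / 2))).+1.
have n0 : 0 < n%:R :> R by rewrite ltr0n.
have Cn : C / n%:R <= e / 2.
  rewrite ler_pdivrMr // mulrC -ler_pdivrMr ?divr_gt0 //.
  by apply/ltW/truncnS_gt.
exists (bernstein n (fun k => f (k%:R / n%:R))) => x hx.
have kn k : (k <= n)%N -> 0 <= (k%:R / n%:R : R) <= 1.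
  by move=> kn; rewrite divr_ge0 //= ler_pdivrMr // mul1r ler_nat.
have sq k : C * (k%:R / n%:R - x) ^+ 2 = C / n%:R ^+ 2 * (k%:R + (- (n%:R * x))) ^+ 2.
  by field; rewrite gt_eqF.
have var : C / n%:R ^+ 2 * ((n%:R * x + - (n%:R * x)) ^+ 2 + n%:R * x * (1 - x)) <= e / 2.
  apply: le_trans Cn; rewrite subrr expr0n add0r /=.
  have -> : C / n%:R ^+ 2 * (n%:R * x * (1 - x)) = C / n%:R * (x * (1 - x)).
    by field; rewrite gt_eqF.
  rewrite ler_piMr ?divr_ge0 //; move: hx => /andP[]; nra.
rewrite ler_norml; apply/andP; split.
- rewrite lerBrDr addrC; apply: le_trans (bernstein_le hx (g := fun k =>
    (f x - e / 2) + (- (C / n%:R ^+ 2)) * (k%:R + (- (n%:R * x))) ^+ 2) _).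
    by rewrite bernstein_quadratic mulNr; lra.
  move=> k /kn hk; rewrite mulNr -sq.
  by have := HC _ _ hx hk; rewrite ler_norml => /andP[]; lra.
- rewrite lerBlDr; apply: le_trans (bernstein_le hx (h := fun k =>
    (f x + e / 2) + (C / n%:R ^+ 2) * (k%:R + (- (n%:R * x))) ^+ 2) _) _.
    move=> k /kn hk; rewrite -sq.
    by have := HC _ _ hx hk; rewrite ler_norml => /andP[]; lra.
  by rewrite bernstein_quadratic; lra.
Qed.

(** Near a diagonal point continuity alone suffices; near any other point [(y - x) ^+ 2] is bounded
    below, so a large [C] wins. Compactness of the square yields a single [C]. *)
Lemma quadratic_modulus f (M e : R) : continuous f -> 0 < e ->
  exists2 C : R, 0 <= C & forall x y : R, `|x| <= M -> `|y| <= M ->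
    `|f y - f x| <= e + C * (y - x) ^+ 2.
Proof.
move=> cf e0.
have cE (x d : R) : 0 < d -> exists2 h, 0 < h & forall u, `|x - u| < h -> `|f x - f u| < d.
  move=> d0; have /cvgrPdist_lt/(_ _ d0) := cf x.
  by move=> /nbhs_ballP[h h0 Hh]; exists h => // u hu; exact: Hh.
pose K := `[-M, M]%classic `*` `[-M, M]%classic : set (R * R).
have cK : compact K by apply: compact_setX; exact: segment_compact.
have bx (x d : R) : 0 < d -> nbhs x [set u | `|x - u| < d] by move=> d0; exact: nbhsx_ballx.
have [|C [_ HC]] := (compact_near_coveringP K).1 cK R (pinfty_nbhs R)
    (fun C p => `|f p.2 - f p.1| <= e + C * (p.2 - p.1) ^+ 2) _.
  move=> [x y] [/= _ _]; have [<-|xy] := eqVneq x y.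
    have [h h0 Hh] := cE x _ (divr_gt0 e0 (ltr0n _ 2)).
    exists ([set p | `|x - p.1| < h /\ `|x - p.2| < h], [set N | 0 < N]).
      split=> /=; last exact: nbhs_pinfty_gt (num_real 0).
      exists (ball x h, ball x h); last by move=> [u v].
      by split; exact: nbhsx_ballx.
    case=> [[u v] N] /= [[/Hh hu /Hh hv] hN].
    have : 0 <= N * (v - u) ^+ 2 by rewrite mulr_ge0 ?sqr_ge0 // ltW.
    move: hu hv; rewrite ler_norml !ltr_norml => /andP[? ?] /andP[? ?] ?.
    by apply/andP; split; lra.
  pose D := `|y - x|; have D0 : 0 < D by rewrite normr_gt0 subr_eq0 eq_sym.
  have [h1 h10 Hh1] := cE x 1 ltr01; have [h2 h20 Hh2] := cE y 1 ltr01.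
  pose h := Num.min (Num.min h1 h2) (D / 4).
  have h0 : 0 < h by rewrite !lt_min h10 h20 /= divr_gt0.
  pose B := (`|f y - f x| + 2) / (D / 2) ^+ 2.
  exists ([set p | `|x - p.1| < h /\ `|y - p.2| < h], [set N | B < N]).
    split=> /=; last exact: nbhs_pinfty_gt (num_real B).
    exists (ball x h, ball y h); last by move=> [u v].
    by split; exact: nbhsx_ballx.
  case=> [[u v] N] /= [[]]; rewrite !lt_min => /andP[/andP[hu _] hu'].
  move=> /andP[/andP[_ hv] hv'] hN.
  have k1 := Hh1 _ hu; have k2 := Hh2 _ hv.
  have k3 : D / 2 <= `|v - u|.
    have : D <= `|y - v| + (`|v - u| + `|x - u|).
      rewrite /D; have -> : y - x = (y - v) + ((v - u) + - (x - u)) by ring.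
      apply: le_trans (ler_normD _ _) _; rewrite lerD2l.
      by apply: le_trans (ler_normD _ _) _; rewrite normrN.
    lra.
  have k4 : (D / 2) ^+ 2 <= (v - u) ^+ 2.
    by rewrite -(real_normK (num_real (v - u))) lerXn2r ?nnegrE // divr_ge0 // ltW.
  have k5 : `|f v - f u| <= `|f y - f x| + 2.
    have -> : f v - f u = (f y - f x) + (- (f y - f v) + (f x - f u)) by ring.
    apply: le_trans (ler_normD _ _) _; rewrite lerD2l.
    by apply: le_trans (ler_normD _ _) _; rewrite normrN; lra.
  apply: le_trans k5 _.
  have D2 : 0 < (D / 2) ^+ 2 by rewrite exprn_gt0 // divr_gt0.
  have <- : B * (D / 2) ^+ 2 = `|f y - f x| + 2 by rewrite /B divfK // gt_eqF.
  have B0 : 0 <= B by rewrite divr_ge0 ?addr_ge0 // ltW.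
  apply: le_trans (_ : N * (v - u) ^+ 2 <= _); last by rewrite lerDr ltW.
  by rewrite ler_pM // ltW.
pose C1 := `|C| + 1.
exists C1 => [|x y hx hy]; first by rewrite addr_ge0.
have /= := HC C1 _ (x, y); apply; first by rewrite (le_lt_trans (ler_norm C)) // ltrDl.
by split; rewrite /= in_itv /= -ler_norml.
Qed.

Theorem weierstrass f (M e : R) : continuous f -> 0 < e ->
  exists p : {poly R}, forall x : R, `|x| <= M -> `|p.[x] - f x| <= e.
Proof.
move=> cf e0; have [M0|M0] := ltP M 0.
  by exists 0 => x /le_lt_trans/(_ M0); rewrite normr_lt0.
have [N N0 MN] : exists2 N : R, 0 < N & M <= N.
  by exists (M + 1); rewrite ?ltr_wpDl // lerDl.
pose s (t : R) := 2 * N * t - N.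
have sN t : 0 <= t <= 1 -> `|s t| <= N.
  by move=> /andP[t0 t1]; rewrite ler_norml /s; apply/andP; split; nra.
have [|p Hp] := @weierstrass01 (f \o s) _ e e0.
  move=> d d0; have [C C0 HC] := quadratic_modulus N cf d0.
  exists (C * (2 * N) ^+ 2) => [|x y hx hy]; first by rewrite mulr_ge0 ?sqr_ge0.
  apply: le_trans (HC _ _ (sN _ hx) (sN _ hy)) _.
  by rewrite /s le_eqVlt; apply/orP; left; apply/eqP; ring.
exists (p \Po ((2 * N)^-1 *: ('X + N%:P))) => x hx.
rewrite horner_comp !hornerE.
have N2 : 0 < 2 * N by rewrite mulr_gt0.
have := Hp ((2 * N)^-1 * (x + N)); rewrite /= /s mulrA mulfV ?gt_eqF // mul1r addrK.
apply; rewrite mulrC; move: hx; rewrite ler_norml => /andP[h1 h2].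
apply/andP; split; first by apply: divr_ge0; lra.
by rewrite ler_pdivrMr // mul1r; lra.
Qed.

End Weierstrass.

(** * Continuous functional calculus *)

Section FunctionalCalculus.
Context {R : realType} {A : cstarAlgType R}.
Implicit Types (a b c x y : A) (f g h : R -> R) (p q : {poly R}) (B : set A).

Definition rpoly a p : A := horner_alg a (map_poly (real_complex R) p).

Lemma rpolyD a p q : rpoly a (p + q) = rpoly a p + rpoly a q.
Proof. by rewrite /rpoly !rmorphD. Qed.

Lemma rpolyB a p q : rpoly a (p - q) = rpoly a p - rpoly a q.
Proof. by rewrite /rpoly !rmorphB. Qed.

Lemma rpolyM a p q : rpoly a (p * q) = rpoly a p * rpoly a q.
Proof. by rewrite /rpoly !rmorphM. Qed.

Lemma rpolyC a (r : R) : rpoly a r%:P = r%:C%:A.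
Proof. by rewrite /rpoly map_polyC horner_algC. Qed.

Lemma rpolyX a : rpoly a 'X = a.
Proof. by rewrite /rpoly map_polyX horner_algX. Qed.

Lemma rpoly_ind a (P : A -> Prop) : P 0 ->
  (forall x (r : R), P x -> P (x * a + r%:C%:A)) -> forall p, P (rpoly a p).
Proof.
move=> P0 PS; apply: poly_ind => [|p r h]; first by rewrite /rpoly !rmorph0.
by rewrite rpolyD rpolyM rpolyX rpolyC; exact: PS.
Qed.

Lemma scalar_comm (l : R[i]) b : l%:A * b = b * l%:A.
Proof. by rewrite -scalerAl -scalerAr mul1r mulr1. Qed.

Lemma rpoly_sa a p : selfadjoint a -> selfadjoint (rpoly a p).
Proof.
move=> sa.
suff [] : a * rpoly a p = rpoly a p * a /\ selfadjoint (rpoly a p) by [].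
apply: (rpoly_ind (P := fun y => a * y = y * a /\ selfadjoint y)) => [|x r [c s]].
  by rewrite mulr0 mul0r star0.
split; first by rewrite mulrDl mulrDr scalar_comm mulrA c.
by rewrite starD starM sa s c starZr star1.
Qed.

(** Factor [q - l] over the algebraically closed field: if no root were in the spectrum, all
    factors, hence their product, would be invertible. Nonemptiness of the spectrum covers constant
    [q]. *)
Lemma spectrum_horner a (q : {poly R[i]}) (l : R[i]) :
  (exists m, spectrum a m) -> spectrum (horner_alg a q) l ->
  exists2 m, spectrum a m & q.[m] = l.
Proof.
move=> [m0 hm0] hl; apply: contrapT => H.
have [r0|r0] := eqVneq (q - l%:P) 0.
  apply: H; exists m0 => //; apply/eqP; rewrite -subr_eq0.
  by have := congr1 (horner^~ m0) r0; rewrite !hornerE => ->.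
apply: hl; have [rs hr] := closed_field_poly_normal (q - l%:P).
have -> : horner_alg a q - l%:A = horner_alg a (q - l%:P).
  by rewrite rmorphB /= horner_algC.
suff : invertible (horner_alg a (q - l%:P)) by [].
have hZ (c : R[i]) (s : {poly R[i]}) : horner_alg a (c *: s) = c *: horner_alg a s.
  by rewrite -mul_polyC rmorphM /= horner_algC -scalerAl mul1r.
rewrite hr hZ; apply: invertibleZ; first by rewrite lead_coef_eq0.
rewrite rmorph_prod big_seq; apply: big_ind => [||m mr].
- by exists 1; split; rewrite mulr1.
- exact: invertibleM.
- rewrite rmorphB /= horner_algX horner_algC; apply: contrapT => hm.
  apply: H; exists m => //; apply/eqP; rewrite -subr_eq0.
  have : root (q - l%:P) m.
    by rewrite hr rootZ ?lead_coef_eq0 // root_prod_XsubC.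
  by rewrite rootE !hornerE.
Qed.

Lemma horner_real p (t : R) : (map_poly (real_complex R) p).[t%:C] = p.[t]%:C.
Proof. by rewrite horner_map. Qed.

Lemma spectrum_rpoly a p (l : R[i]) : selfadjoint a -> spectrum (rpoly a p) l ->
  exists2 t : R, spectrum a t%:C & l = p.[t]%:C.
Proof.
move=> sa /spectrum_horner[].
  by have [t ht _] := spectral_radius sa; exists t%:C.
move=> m hm <-; have e := spectrum_real sa hm.
by exists (complex.Re m); rewrite -?e // -horner_real -e.
Qed.

(** [p - p.[t]] is divisible by ['X - t] on either side, so an inverse of its value gives a left and
    a right inverse of [a - t], which then coincide. *)
Lemma rpoly_spectrum a p (t : R) : spectrum a t%:C -> spectrum (rpoly a p) p.[t]%:C.
Proof.
move=> h [b [h1 h2]]; apply: h.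
have /factor_theorem[q hq] : root (p - p.[t]%:P) t by rewrite rootE !hornerE subrr.
have e : rpoly a p - p.[t]%:C%:A = rpoly a q * (a - t%:C%:A).
  by rewrite -(rpolyC a) -rpolyB hq rpolyM rpolyB rpolyX rpolyC.
have e' : rpoly a p - p.[t]%:C%:A = (a - t%:C%:A) * rpoly a q.
  by rewrite -(rpolyC a) -rpolyB hq mulrC rpolyM rpolyB rpolyX rpolyC.
have l1 : (b * rpoly a q) * (a - t%:C%:A) = 1 by rewrite -mulrA -e.
have r1 : (a - t%:C%:A) * (rpoly a q * b) = 1 by rewrite mulrA -e'.
exists (b * rpoly a q); split=> //.
suff -> : b * rpoly a q = rpoly a q * b by [].
by rewrite -[LHS]mulr1 -[X in _ * X]r1 mulrA l1 mul1r.
Qed.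

Lemma rpoly_le a p (M : R) : selfadjoint a ->
  (forall t : R, spectrum a t%:C -> `|p.[t]| <= M) -> nm (rpoly a p) <= M.
Proof.
move=> sa H; have [s hs <-] := spectral_radius (rpoly_sa p sa).
by have [t ht /complexI ->] := spectrum_rpoly sa hs; exact: H.
Qed.

Lemma rpoly_ge a p (t : R) : spectrum a t%:C -> `|p.[t]| <= nm (rpoly a p).
Proof. by move=> /(@rpoly_spectrum a p)/spectrum_le; rewrite ReC_norm. Qed.

Lemma poly_approx a f (e : R) : continuous f -> 0 < e ->
  exists p, forall t : R, spectrum a t%:C -> `|p.[t] - f t| <= e.
Proof.
move=> cf e0; have [p Hp] := weierstrass (nm a) cf e0.
by exists p => t /spectrum_le; rewrite ReC_norm; exact: Hp.
Qed.

(** Single access point to [cfc], which is a chosen limit: existence of some limit comes from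
    Weierstrass and completeness, and only then does the choice satisfy its specification. All later
    facts on [cfc] go through polynomials. *)
Lemma cfc_close a f p (e : R) : selfadjoint a -> continuous f ->
  (forall t : R, spectrum a t%:C -> `|p.[t] - f t| <= e) ->
  nm (rpoly a p - cfc a f) <= e.
Proof.
move=> sa cf hp.
have /choice[q Hq] : forall n : nat, exists q, forall t : R, spectrum a t%:C ->
    `|q.[t] - f t| <= n.+1%:R^-1.
  by move=> n; apply: poly_approx => //; rewrite invr_gt0.
have small (d : R) : 0 < d -> exists N, forall n, (N <= n)%N -> n.+1%:R^-1 < d :> R.
  move=> d0; have /cvgrPdist_lt/(_ _ d0)[N _ HN] := @cvg_harmonic R.
  by exists N => n /HN; rewrite /= sub0r normrN ger0_norm ?invr_ge0.
have [b hb] : exists b, nm_cvg (fun n => rpoly a (q n)) b.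
  apply: nm_cauchy_cvg => d d0; have [N HN] := small _ (divr_gt0 d0 (ltr0n R 3)).
  exists N => n m /HN hn /HN hm; rewrite -rpolyB.
  apply: (@le_lt_trans _ _ (d / 3 + d / 3)); last by lra.
  apply: rpoly_le => // t ht; rewrite hornerD hornerN.
  have -> : (q n).[t] - (q m).[t] = ((q n).[t] - f t) - ((q m).[t] - f t) by ring.
  apply: le_trans (ler_normB _ _) _.
  by rewrite lerD // (le_trans (Hq _ _ ht)) // ltW.
have : [set b | exists p : nat -> {poly R},
    (forall e : R, 0 < e -> \forall n \near \oo,
       forall t : R, spectrum a t%:C -> `|(p n).[t] - f t| < e) /\
    ((fun n => horner_alg a (map_poly (real_complex R) (p n))) @ \oo --> b)] (cfc a f).
  apply: (@xgetPex _ (0 : A)); exists b, q; split; last exact/nm_cvgP.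
  move=> d d0; have [N HN] := small _ d0; exists N => // n /HN hn t /Hq h.
  exact: le_lt_trans (h n) hn.
move=> [r [Hr /nm_cvgP cr]]; apply/ler_addgt0Pl => d d0.
have d2 : 0 < d / 2 by rewrite divr_gt0.
have [N _ HN] := Hr _ d2; have [N' HN'] := cr _ d2.
pose n := maxn N N'.
apply: le_trans (nm_subT (rpoly a (r n)) _ _) _.
have -> : d + e = (e + d / 2) + d / 2 by lra.
rewrite lerD //; last by apply/ltW/HN'; rewrite leq_maxr.
rewrite -rpolyB; apply: rpoly_le => // t ht; rewrite hornerD hornerN.
have -> : p.[t] - (r n).[t] = (p.[t] - f t) - ((r n).[t] - f t) by ring.
apply: le_trans (ler_normB _ _) _.
by rewrite lerD ?hp // ltW // (HN n) //= leq_maxl.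
Qed.

Lemma cfc_approx a f (e : R) : selfadjoint a -> continuous f -> 0 < e ->
  exists2 p, nm (rpoly a p - cfc a f) <= e &
             forall t : R, spectrum a t%:C -> `|p.[t] - f t| <= e.
Proof.
move=> sa cf e0; have [p Hp] := poly_approx a cf e0.
by exists p => //; exact: cfc_close.
Qed.

Lemma cfc_rpoly a f p : selfadjoint a -> continuous f ->
  (forall t : R, spectrum a t%:C -> f t = p.[t]) -> cfc a f = rpoly a p.
Proof.
move=> sa cf H; apply/eqP; rewrite eq_sym -subr_eq0; apply/eqP/nm_small_eq0 => e e0.
by apply: cfc_close => // t /H ->; rewrite subrr normr0 ltW.
Qed.

Lemma cfc_id a : selfadjoint a -> cfc a id = a.
Proof.
move=> sa; rewrite (@cfc_rpoly _ _ 'X) ?rpolyX // => [|t _]; last by rewrite hornerX.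
by move=> t; exact: cvg_id.
Qed.

Lemma cfc_cst a (r : R) : selfadjoint a -> cfc a (fun=> r) = r%:C%:A.
Proof.
move=> sa; rewrite (@cfc_rpoly _ _ r%:P) ?rpolyC // => [|t _]; last by rewrite hornerC.
exact: cst_continuous.
Qed.

Lemma cfc_ext a f g : selfadjoint a -> continuous f -> continuous g ->
  (forall t : R, spectrum a t%:C -> f t = g t) -> cfc a f = cfc a g.
Proof.
move=> sa cf cg H; apply/eqP; rewrite -subr_eq0; apply/eqP/nm_small_eq0 => e e0.
have [p h1 hp] := cfc_approx sa cf (divr_gt0 e0 (ltr0n R 2)).
apply: le_trans (nm_subT (rpoly a p) _ _) _; rewrite [leRHS]splitr lerD //.
  by rewrite nmC.
by apply: cfc_close => // t ht; rewrite -H // hp.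
Qed.

Lemma cfc_ge a f (t : R) : selfadjoint a -> continuous f -> spectrum a t%:C ->
  `|f t| <= nm (cfc a f).
Proof.
move=> sa cf ht; apply/ler_addgt0Pl => e e0.
have [p h1 hp] := cfc_approx sa cf (divr_gt0 e0 (ltr0n R 2)).
have -> : f t = p.[t] - (p.[t] - f t) by ring.
apply: le_trans (ler_normB _ _) _.
have := rpoly_ge p ht; have := hp _ ht.
have := cstar_normD (rpoly a p - cfc a f) (cfc a f); rewrite subrK; lra.
Qed.

Lemma cfcD a f g : selfadjoint a -> continuous f -> continuous g ->
  cfc a (fun t => f t + g t) = cfc a f + cfc a g.
Proof.
move=> sa cf cg; apply/eqP; rewrite -subr_eq0; apply/eqP/nm_small_eq0 => e e0.
have e4 : 0 < e / 4 by rewrite divr_gt0.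
have [p hp hp'] := cfc_approx sa cf e4; have [q hq hq'] := cfc_approx sa cg e4.
apply: le_trans (nm_subT (rpoly a (p + q)) _ _) _.
have -> : e = (e / 4 + e / 4) + (e / 4 + e / 4) by field.
apply: lerD; last first.
  by rewrite rpolyD opprD addrACA; apply: le_trans (cstar_normD _ _) _; rewrite lerD.
rewrite nmC; apply: cfc_close => //; first by move=> t; apply: cvgD; [exact: cf|exact: cg].
move=> t ht; rewrite hornerD opprD addrACA.
by apply: le_trans (ler_normD _ _) _; rewrite lerD ?hp' ?hq'.
Qed.

Lemma cfcM a f g : selfadjoint a -> continuous f -> continuous g ->
  cfc a (fun t => f t * g t) = cfc a f * cfc a g.
Proof.
move=> sa cf cg; apply/eqP; rewrite -subr_eq0; apply/eqP/nm_small_eq0 => e e0.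
pose F := nm (cfc a f); pose G := nm (cfc a g).
have F0 : 0 <= F by exact: nm_ge0.
have G0 : 0 <= G by exact: nm_ge0.
pose D := 4 * (F + G + 1); have D0 : 0 < D by rewrite mulr_gt0 // ltr_wpDl ?addr_ge0.
pose d := Num.min 1 (e / D).
have d0 : 0 < d by rewrite lt_min ltr01 divr_gt0.
have d1 : d <= 1 by rewrite ge_min lexx.
have de : d * D <= e by rewrite -ler_pdivlMr // ge_min lexx orbT.
have [p hp hp'] := cfc_approx sa cf d0; have [q hq hq'] := cfc_approx sa cg d0.
have small (x y x' y' : R) : 0 <= x <= F + 1 -> 0 <= y' <= G -> 0 <= x' <= d ->
   0 <= y <= d -> x * y + x' * y' <= e / 2.
  rewrite /D in de; move=> /andP[? ?] /andP[? ?] /andP[? ?] /andP[? ?].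
  have : x * y <= (F + 1) * d by rewrite ler_pM.
  have : x' * y' <= d * G by rewrite ler_pM.
  nra.
have np : nm (rpoly a p) <= F + 1.
  rewrite -(subrK (cfc a f) (rpoly a p)) addrC.
  apply: le_trans (cstar_normD _ _) _; rewrite lerD2l; exact: le_trans hp d1.
apply: le_trans (nm_subT (rpoly a (p * q)) _ _) _; rewrite [e]splitr.
apply: lerD; last first.
  have -> : rpoly a (p * q) - cfc a f * cfc a g =
     rpoly a p * (rpoly a q - cfc a g) + (rpoly a p - cfc a f) * cfc a g.
    by rewrite mulrBr mulrBl addrA subrK rpolyM.
  apply: le_trans (cstar_normD _ _) _.
  apply: le_trans (lerD (cstar_normM _ _) (cstar_normM _ _)) _.
  by apply: small; rewrite ?nm_ge0 // lexx.
rewrite nmC; apply: cfc_close => //; first by move=> t; apply: cvgM; [exact: cf|exact: cg].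
move=> t ht; rewrite hornerM.
have -> : p.[t] * q.[t] - f t * g t =
     p.[t] * (q.[t] - g t) + (p.[t] - f t) * g t by ring.
apply: le_trans (ler_normD _ _) _; rewrite !normrM.
apply: small; rewrite ?normr_ge0 ?hp' ?hq' ?cfc_ge //=.
exact: le_trans (rpoly_ge _ ht) np.
Qed.

Lemma cfc_in a f B : selfadjoint a -> continuous f -> closed B ->
  (forall p, B (rpoly a p)) -> B (cfc a f).
Proof.
move=> sa cf cB H; apply: nm_closed => // e e0.
have [p hp _] := cfc_approx sa cf (divr_gt0 e0 (ltr0n R 2)).
by exists (rpoly a p) => //; rewrite nmC; apply: le_lt_trans hp _; lra.
Qed.

Lemma cfc_sa a f : selfadjoint a -> continuous f -> selfadjoint (cfc a f).
Proof.
move=> sa cf; apply: (cfc_in (B := [set b | star b = b])) => // [|p]; last exact: rpoly_sa.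
apply: closed_nm => b H /=; apply/eqP; rewrite -subr_eq0; apply/eqP/nm_small_eq0 => e e0.
have [c /= sc hc] := H _ (divr_gt0 e0 (ltr0n R 2)).
apply: le_trans (nm_subT c _ _) _; rewrite [leRHS]splitr lerD //.
  by rewrite -sc -starB nm_star ltW.
by rewrite nmC ltW.
Qed.

End FunctionalCalculus.

(** * Positive elements *)

Section Positivity.
Context {R : realType} {A : cstarAlgType R}.
Implicit Types (a b c x y : A) (f g h : R -> R) (B : set A).

(** Spectral positivity. It is the working notion because sums are easy to control;
    [star_mul_nonneg] and [nonneg_positive] identify it with the algebraic [positive_in]. *)
Definition nonneg a := selfadjoint a /\ forall t : R, spectrum a t%:C -> 0 <= t.

Lemma continuous_maxr (u : R) : continuous (fun t : R => Num.max u t).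
Proof. by move=> t; apply: continuous_max; [exact: cst_continuous|move=> ?; exact: cvg_id]. Qed.

Lemma continuous_sqrt_comp f : continuous f -> continuous (fun t => Num.sqrt (f t)).
Proof.
by move=> cf t; apply: (@continuous_comp _ _ _ f Num.sqrt); [exact: cf|exact: sqrt_continuous].
Qed.

Lemma continuous_max0_comp f : continuous f -> continuous (fun t => Num.max 0 (f t)).
Proof.
by move=> cf t; apply: (@continuous_comp _ _ _ f (Num.max 0)); [exact: cf|exact: continuous_maxr].
Qed.

Lemma sqr_nonneg b : selfadjoint b -> nonneg (b * b).
Proof.
move=> sb; split; first by rewrite starM sb.
have -> : b * b = rpoly b ('X * 'X) by rewrite rpolyM rpolyX.
move=> t /(spectrum_rpoly sb)[s _ /complexI ->].
by rewrite hornerM hornerX -expr2 sqr_ge0.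
Qed.

Lemma cfc_sqrt_sqr a f : selfadjoint a -> continuous f ->
  (forall t : R, spectrum a t%:C -> 0 <= f t) ->
  cfc a f = cfc a (fun t => Num.sqrt (f t)) * cfc a (fun t => Num.sqrt (f t)).
Proof.
move=> sa cf H; have cs := continuous_sqrt_comp cf.
rewrite -cfcM //; apply: cfc_ext => //.
  by move=> t; apply: cvgM; exact: cs.
by move=> t /H f0; rewrite -expr2 sqr_sqrtr.
Qed.

Lemma cfc_nonneg a f : selfadjoint a -> continuous f ->
  (forall t : R, spectrum a t%:C -> 0 <= f t) -> nonneg (cfc a f).
Proof.
move=> sa cf H; rewrite cfc_sqrt_sqr //; apply: sqr_nonneg.
by apply: cfc_sa => //; exact: continuous_sqrt_comp.
Qed.

Definition sqrtA a := cfc a (fun t => Num.sqrt t).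

Lemma continuous_sqrt : continuous (fun t : R => Num.sqrt t).
Proof. by move=> t; exact: sqrt_continuous. Qed.

Lemma sqrtA_sa a : selfadjoint a -> selfadjoint (sqrtA a).
Proof. by move=> sa; apply: cfc_sa => //; exact: continuous_sqrt. Qed.

Lemma sqrtA_sqr a : nonneg a -> sqrtA a * sqrtA a = a.
Proof.
move=> [sa H]; rewrite -[RHS]cfc_id // [RHS]cfc_sqrt_sqr // => t; exact: cvg_id.
Qed.

Lemma nonneg_positive a : nonneg a -> positive_in [set: A] a.
Proof.
by move=> pa; exists (sqrtA a) => //; rewrite sqrtA_sa ?sqrtA_sqr //; case: pa.
Qed.

Lemma spectrum_rsub a (m t : R) : spectrum a t%:C -> spectrum (m%:C%:A - a) (m - t)%:C.
Proof.
move=> h [b [h1 h2]]; apply: h; exists (- b).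
have e : m%:C%:A - a - (m - t)%:C%:A = - (a - t%:C%:A).
  by rewrite rmorphB scalerBl; ncring.
by move: h1 h2; rewrite e !(mulNr, mulrN).
Qed.

Lemma spectrum_abs a (t : R) : spectrum a t%:C -> `|t| <= nm a.
Proof. by move=> /spectrum_le; rewrite ReC_norm. Qed.

Lemma rsub_le a (m : R) : nonneg a -> nm a <= m -> nm (m%:C%:A - a) <= m.
Proof.
move=> [sa pa] hm; have -> : m%:C%:A - a = rpoly a (m%:P - 'X).
  by rewrite rpolyB rpolyC rpolyX.
apply: rpoly_le => // t ht; rewrite !hornerE ger0_norm.
  by rewrite gerBl pa.
by rewrite subr_ge0 (le_trans _ hm) // (le_trans (ler_norm t)) // spectrum_abs.
Qed.

(** For [m >= nm a], positivity gives [nm (m - a) <= m]; these estimates add by the triangle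
    inequality, and the sum keeps the spectrum on the nonnegative side. *)
Lemma nonnegD a b : nonneg a -> nonneg b -> nonneg (a + b).
Proof.
move=> pa pb; split; first by rewrite starD pa.1 pb.1.
move=> t ht; have := spectrum_abs (spectrum_rsub (m := nm a + nm b) ht).
have -> : (nm a + nm b)%:C%:A - (a + b) = ((nm a)%:C%:A - a) + ((nm b)%:C%:A - b).
  by rewrite rmorphD scalerDl opprD addrACA.
move=> /le_trans/(_ (cstar_normD _ _)) h.
have := rsub_le pa (lexx _); have := rsub_le pb (lexx _).
have := ler_norm (nm a + nm b - t); lra.
Qed.

(** If [b] inverts [yx - l], then [l^-1 (x b y - 1)] inverts [xy - l]. *)
Lemma spectrum_swap x y (l : R[i]) : l != 0 -> spectrum (x * y) l -> spectrum (y * x) l.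
Proof.
move=> l0 h [b [h1 h2]]; apply: h.
pose d := l^-1 *: (x * b * y - 1).
have xyb : y * (x * b) = l *: b + 1.
  by rewrite -h1 mulrBl -scalerAl mul1r addrC subrK mulrA.
have byx : b * (y * x) = l *: b + 1.
  by rewrite -h2 mulrBr -scalerAr mulr1 addrC subrK.
exists d; rewrite /d -scalerAr -scalerAl; split.
- rewrite mulrBr mulr1 mulrBl -scalerAl mul1r.
  have -> : x * y * (x * b * y) = x * (y * (x * b)) * y by rewrite !mulrA.
  rewrite xyb mulrDr mulr1 mulrDl -scalerAr -!scalerAl.
  have -> : l *: (x * b * y) + x * y - l *: (x * b * y) - (x * y - l%:A) = l%:A.
    by ncring.
  by rewrite scalerA mulVf // scale1r.
- rewrite mulrBl mul1r mulrBr -scalerAr mulr1.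
  have -> : x * b * y * (x * y) = x * (b * (y * x)) * y by rewrite !mulrA.
  rewrite byx mulrDr mulr1 mulrDl -scalerAr -!scalerAl.
  have -> : l *: (x * b * y) + x * y - l *: (x * b * y) - (x * y - l%:A) = l%:A.
    by ncring.
  by rewrite scalerA mulVf // scale1r.
Qed.

Lemma spectrum_opp a (t : R) : spectrum a t%:C -> spectrum (- a) (- t)%:C.
Proof.
by move=> /(spectrum_rsub (m := 0)); rewrite rmorph0 scale0r !sub0r.
Qed.

Lemma nonneg_anti a : nonneg a -> nonneg (- a) -> a = 0.
Proof.
move=> [sa pa] [_ na]; apply/eqP; rewrite -nm_eq0.
have [t ht <-] := spectral_radius sa; rewrite normr_eq0 eq_le pa // andbT.
by rewrite -oppr_ge0 na //; exact: spectrum_opp.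
Qed.

(** Swapping factors makes [- (y * star y)] positive too. With [h = y + star y] and
    [k = i (y - star y)], the sum [h h + k k] is twice [star y * y + y * star y], so [star y * y] is
    both positive and negative. *)
Lemma nonneg_opp_star_mul y : nonneg (- (star y * y)) -> y = 0.
Proof.
move=> py; have sy : selfadjoint (star y * y) by rewrite starM starK.
have py' : nonneg (- (y * star y)).
  split; first by rewrite starN starM starK.
  move=> t ht; have [->|t0] := eqVneq t 0; first by [].
  apply: py.2; rewrite -mulNr; apply: spectrum_swap; first by rewrite fmorph_eq0.
  by rewrite mulrN.
pose h := y + star y; pose k := 'i%C *: (y - star y).
have sh : selfadjoint h by rewrite /h starD starK addrC.
have sk : selfadjoint k.
  rewrite /k starZ starB starK -[star y - y]opprB scalerN -scaleNr; congr (_ *: _).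
  by apply/eqP; rewrite eq_complex /= oppr0 opprK !eqxx.
have e : h * h + k * k = (star y * y + star y * y) + (y * star y + y * star y).
  rewrite /h /k -scalerAl -scalerAr scalerA.
  have -> : 'i%C * 'i%C = -1 :> R[i] by rewrite -expr2 sqr_i.
  by rewrite scaleN1r; ncring.
have pp : nonneg (star y * y + star y * y).
  have -> : star y * y + star y * y =
      (h * h + k * k) + (- (y * star y) + - (y * star y)).
    by rewrite e -opprD addrK.
  by do 2 ! apply: nonnegD => //; apply: sqr_nonneg.
have : star y * y + star y * y = 0.
  by apply: nonneg_anti => //; rewrite opprD; exact: nonnegD.
move/(congr1 (fun x => (2^-1)%:C *: x)); rewrite scale_halfD scaler0 => /eqP.
by rewrite -nm_eq0 cstar_norm_starM sqrf_eq0 nm_eq0 => /eqP.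
Qed.

Definition pos_part a := cfc a (fun t => Num.max 0 t).
Definition neg_part a := cfc a (fun t => Num.max 0 (- t)).

Lemma continuous_neg : continuous (fun t : R => Num.max 0 (- t)).
Proof. by apply: continuous_max0_comp => t; apply: cvgN; exact: cvg_id. Qed.

Lemma pos_part_sa a : selfadjoint a -> selfadjoint (pos_part a).
Proof. by move=> sa; apply: cfc_sa => //; exact: continuous_maxr. Qed.

Lemma neg_part_sa a : selfadjoint a -> selfadjoint (neg_part a).
Proof. by move=> sa; apply: cfc_sa => //; exact: continuous_neg. Qed.

Lemma pos_neg_mul a : selfadjoint a -> pos_part a * neg_part a = 0.
Proof.
move=> sa; rewrite -cfcM //; [|exact: continuous_maxr|exact: continuous_neg].
rewrite (@cfc_ext _ _ _ _ (fun=> 0)) ?cfc_cst ?rmorph0 ?scale0r //.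
- by move=> t; apply: cvgM; [exact: continuous_maxr|exact: continuous_neg].
- exact: cst_continuous.
- by move=> t _; rewrite /Num.max; case: ltP => h1; case: ltP => h2; nra.
Qed.

Lemma pos_neg_comm a : selfadjoint a -> neg_part a * pos_part a = 0.
Proof.
move=> sa; apply: (can_inj (@starK _ _)).
by rewrite starM pos_part_sa ?neg_part_sa // pos_neg_mul // star0.
Qed.

Lemma pos_neg_sub a : selfadjoint a -> a = pos_part a - neg_part a.
Proof.
move=> sa; have -> : - neg_part a = cfc a (fun=> -1) * neg_part a.
  by rewrite cfc_cst // rmorphN rmorph1 scaleN1r mulN1r.
have c1 : continuous (fun t : R => -1 * Num.max 0 (- t)).
  by move=> t; apply: cvgM; [exact: cst_continuous|exact: continuous_neg].
rewrite -cfcM //; [|exact: cst_continuous|exact: continuous_neg].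
rewrite -cfcD //; last exact: continuous_maxr.
rewrite -{1}(cfc_id sa); apply: cfc_ext => //.
- by move=> t; exact: cvg_id.
- by move=> t; apply: cvgD; [exact: continuous_maxr|exact: c1].
- by move=> t _; rewrite /Num.max; case: ltP => h1; case: ltP => h2; lra.
Qed.

Lemma pos_part_nonneg a : selfadjoint a -> nonneg (pos_part a).
Proof.
move=> sa; apply: cfc_nonneg => //; first exact: continuous_maxr.
by move=> t _; rewrite le_max lexx.
Qed.

Lemma neg_part_nonneg a : selfadjoint a -> nonneg (neg_part a).
Proof.
move=> sa; apply: cfc_nonneg => //; first exact: continuous_neg.
by move=> t _; rewrite le_max lexx.
Qed.

(** With [n] the negative part of [star x * x], the element [- star (x n) * (x n)] equals [n ^+ 3],
    which is positive; so [x n = 0], and then [n = 0]. *)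
Theorem star_mul_nonneg x : nonneg (star x * x).
Proof.
set a := star x * x; have sa : selfadjoint a by rewrite /a starM starK.
pose n := neg_part a; have sn : selfadjoint n by exact: neg_part_sa.
have an : a * n = - (n * n).
  by rewrite {1}(pos_neg_sub sa) mulrBl pos_neg_mul // sub0r.
have e : - (star (x * n) * (x * n)) = n * n * n.
  have -> : star (x * n) * (x * n) = n * (a * n) by rewrite starM sn /a; ncring.
  by rewrite an; ncring.
have n3 : nonneg (n * n * n).
  have cn := @continuous_neg.
  have c2 : continuous (fun t : R => Num.max 0 (- t) * Num.max 0 (- t)).
    by move=> t; apply: cvgM; exact: cn.
  rewrite /n /neg_part -!cfcM //; apply: cfc_nonneg => //.
    by move=> t; apply: cvgM; [exact: c2|exact: cn].
  by move=> t _; rewrite !mulr_ge0 // le_max lexx.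
have xn0 : x * n = 0 by apply: nonneg_opp_star_mul; rewrite e.
have n0 : n = 0.
  have n2 : n * n = 0 by apply: oppr_inj; rewrite -an /a -mulrA xn0 mulr0 oppr0.
  apply/eqP; rewrite -nm_eq0 -sqrf_eq0 -nm_sa_sqr // n2 nm0 //.
by rewrite (pos_neg_sub sa) -/n n0 subr0; exact: pos_part_nonneg.
Qed.

Lemma positive_nonneg B a : positive_in B a -> nonneg a.
Proof. by move=> [b _ ->]; exact: star_mul_nonneg. Qed.

Lemma nonneg_conj c a : nonneg a -> nonneg (star c * a * c).
Proof.
move=> /nonneg_positive[b _ ->].
have -> : star c * (star b * b) * c = star (b * c) * (b * c) by rewrite starM; ncring.
exact: star_mul_nonneg.
Qed.

Lemma nonneg_sum I (r : seq I) (F : I -> A) :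
  (forall i, nonneg (F i)) -> nonneg (\sum_(i <- r) F i).
Proof.
move=> H; apply: big_ind => //; last exact: nonnegD.
by rewrite -(mulr0 (star (0 : A))); exact: star_mul_nonneg.
Qed.

Lemma nonneg_rsub a (m : R) : selfadjoint a -> nm a <= m -> nonneg (m%:C%:A - a).
Proof.
move=> sa hm; split; first by rewrite starB starZr star1 sa.
have -> : m%:C%:A - a = rpoly a (m%:P - 'X) by rewrite rpolyB rpolyC rpolyX.
move=> t /(spectrum_rpoly sa)[s hs /complexI ->]; rewrite !hornerE subr_ge0.
by rewrite (le_trans _ hm) // (le_trans (ler_norm s)) // spectrum_abs.
Qed.

Lemma nonneg_le a (m : R) : nonneg a -> nonneg (m%:C%:A - a) -> nm a <= m.
Proof.
move=> [sa pa] pm; have [t ht <-] := spectral_radius sa; rewrite ger0_norm ?pa //.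
by rewrite -subr_ge0; apply: pm.2; exact: spectrum_rsub.
Qed.

Lemma nm_mono a b : nonneg a -> nonneg (b - a) -> nm a <= nm b.
Proof.
move=> pa pba; apply: nonneg_le => //.
rewrite -(subrK b (_%:A)) -addrA; apply: nonnegD => //.
apply: nonneg_rsub => //; rewrite -(subrK a b).
by have [] := nonnegD pba pa.
Qed.

Lemma sa_abs_le a (m : R) : selfadjoint a ->
  nonneg (m%:C%:A - a) -> nonneg (m%:C%:A + a) -> nm a <= m.
Proof.
move=> sa p1 p2; have [t ht <-] := spectral_radius sa.
have h1 : 0 <= m - t by apply: p1.2; exact: spectrum_rsub.
have h2 : 0 <= m - (- t).
  by apply: p2.2; have := spectrum_rsub (m := m) (spectrum_opp ht); rewrite opprK.
by rewrite ler_norml; lra.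
Qed.

End Positivity.

(** * Purely infinite algebras *)

Section PurelyInfinite.
Context {R : realType} {A : cstarAlgType R}.
Implicit Types (a b c x y z p q v e : A) (B J : set A).

(** Inverse square root truncated at [c], which keeps the function continuous at [0] and changes
    nothing when [a >= c]. *)
Definition isqrt (c : R) a := cfc a (fun t => Num.sqrt (Num.max c t)^-1).

Lemma continuous_isqrt (c : R) : 0 < c -> continuous (fun t : R => Num.sqrt (Num.max c t)^-1).
Proof.
move=> c0; apply: continuous_sqrt_comp => t; apply: cvgV.
  by rewrite gt_eqF // lt_max c0.
exact: continuous_maxr.
Qed.

Lemma isqrt_sa (c : R) a : 0 < c -> selfadjoint a -> selfadjoint (isqrt c a).
Proof. by move=> c0 sa; apply: cfc_sa => //; exact: continuous_isqrt. Qed.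

Lemma isqrt_conj (c : R) a f : 0 < c -> selfadjoint a -> continuous f ->
  (forall t : R, spectrum a t%:C -> f t = t / Num.max c t) ->
  isqrt c a * a * isqrt c a = cfc a f.
Proof.
move=> c0 sa cf H; have cg := continuous_isqrt c0.
have c1 : continuous (fun t : R => Num.sqrt (Num.max c t)^-1 * t).
  by move=> t; apply: cvgM; [exact: cg|exact: cvg_id].
rewrite -{2}(cfc_id sa) -!cfcM //; last by move=> t; exact: cvg_id.
apply: cfc_ext => //; first by move=> t; apply: cvgM; [exact: c1|exact: cg].
move=> t /H ->; rewrite mulrAC -expr2 sqr_sqrtr ?invr_ge0 ?le_max ?(ltW c0) //.
by rewrite mulrC.
Qed.

Lemma isqrt_inv (c : R) a : 0 < c -> nonneg (a - c%:C%:A) ->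
  isqrt c a * a * isqrt c a = 1.
Proof.
move=> c0 pa; have sa : selfadjoint a.
  by rewrite -(subrK (c%:C%:A) a) starD pa.1 starZr star1.
rewrite (isqrt_conj (f := fun=> 1)) //.
- by rewrite cfc_cst // rmorph1 scale1r.
- exact: cst_continuous.
- move=> t /(spectrum_shift (m := c%:C)); rewrite -rmorphB => /pa.2.
  by rewrite subr_ge0 => ct; rewrite max_r // mulfV // gt_eqF // (lt_le_trans c0).
Qed.

Lemma top_spectrum a : nonneg a -> spectrum a (nm a)%:C.
Proof.
by move=> [sa pa]; have [t ht <-] := spectral_radius sa; rewrite ger0_norm ?pa.
Qed.

(* H = (z - nm z / 2)_+; since G z G is a unit for H, compressions to the
   hereditary subalgebra of H can be written as compressions of z. *)
Lemma local_unit z : nonneg z -> z != 0 ->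
  exists G H : A, [/\ selfadjoint G, selfadjoint H, H != 0,
    (G * z * G) * H = H & H * (G * z * G) = H].
Proof.
move=> pz z0; have sz := pz.1.
pose c := nm z / 2; have c0 : 0 < c by rewrite divr_gt0 // nm_gt0.
have ch : continuous (fun t : R => Num.max 0 (t - c)).
  by apply: continuous_max0_comp => t; apply: cvgB; [exact: cvg_id|exact: cst_continuous].
have cf : continuous (fun t : R => t / Num.max c t).
  move=> t; apply: cvgM; first exact: cvg_id.
  by apply: cvgV; [rewrite gt_eqF // lt_max c0|exact: continuous_maxr].
have sH : selfadjoint (cfc z (fun t : R => Num.max 0 (t - c))) by exact: cfc_sa.
have sF : selfadjoint (cfc z (fun t : R => t / Num.max c t)) by exact: cfc_sa.
have FH : cfc z (fun t : R => t / Num.max c t) * cfc z (fun t : R => Num.max 0 (t - c)) =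
          cfc z (fun t : R => Num.max 0 (t - c)).
  rewrite -cfcM //; apply: cfc_ext => //.
    by move=> t; apply: cvgM; [exact: cf|exact: ch].
  move=> t _; have [tc|ct] := leP t c; last first.
    by rewrite mulfV ?mul1r // gt_eqF // (lt_trans c0).
  by rewrite max_l ?mulr0 // subr_le0.
exists (isqrt c z), (cfc z (fun t : R => Num.max 0 (t - c))).
rewrite (isqrt_conj c0 sz cf) //; split => //.
- exact: isqrt_sa.
- apply/eqP => H0; have := cfc_ge sz ch (top_spectrum pz); rewrite H0 nm0.
  rewrite leNgt normr_gt0 gt_eqF // lt_max subr_gt0 /c.
  by apply/orP; right; rewrite ltr_pdivrMr // ltr_pMr ?nm_gt0 // ltr1n.
- by move/(congr1 star): FH; rewrite starM sF sH.
Qed.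

Lemma nm_closed_eq0 (L : A -> A) (C : R) :
  (forall a b, nm (L a - L b) <= C * nm (a - b)) -> closed [set a | L a = 0].
Proof.
move=> HL; apply: closed_nm => a H /=; apply: nm_small_eq0 => e e0.
pose D := `|C| + 1; have D0 : 0 < D by rewrite ltr_wpDl.
have [b /= Lb hb] := H (e / D) (divr_gt0 e0 D0).
rewrite -[L a]subr0 -Lb; apply: le_trans (HL _ _) _.
rewrite ltr_pdivlMr // in hb; apply: le_trans (ltW hb); rewrite mulrC.
by rewrite ler_wpM2l ?nm_ge0 // (le_trans (ler_norm C)) // lerDl.
Qed.

Definition annihilator k : set A := [set b : A | b * k = 0 /\ k * b = 0].

(** For [0 <= star c * c <= b] with [b] killed by [k], conjugating the difference by [k] makes
    [- star (c k) * (c k)] positive, so [c k = 0]. Taking [k = 1 - F] gives the hereditary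
    subalgebra on which [F] is a unit. *)
Lemma annihilator_hereditary k : selfadjoint k ->
  cstar_subalgebra (annihilator k) /\ hereditary (annihilator k).
Proof.
move=> sk; split; last first.
  move=> a b pa pb ba [bk kb].
  have [c _ ac] := pa; suff ck : c * k = 0.
    by rewrite ac; split; [rewrite -mulrA ck mulr0 | rewrite mulrA -{1}sk -starM ck star0 mul0r].
  apply: nonneg_opp_star_mul.
  have -> : - (star (c * k) * (c * k)) = star k * (b - a) * k.
    by rewrite sk mulrBr kb sub0r mulNr starM sk ac; ncring.
  by apply: nonneg_conj; exact: positive_nonneg ba.
split.
- have -> : annihilator k = [set b : A | b * k = 0] `&` [set b : A | k * b = 0] by [].
  apply: closedI; apply: (nm_closed_eq0 (C := nm k)) => a b.
    by rewrite -mulrBl mulrC cstar_normM.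
  by rewrite -mulrBr cstar_normM.
- by rewrite /annihilator /= mul0r mulr0.
- by move=> a b [h1 h2] [h3 h4]; rewrite /annihilator /= mulrDl mulrDr h1 h2 h3 h4 addr0.
- by move=> l a [h1 h2]; rewrite /annihilator /= -scalerAl -scalerAr h1 h2 scaler0.
split=> [a b [h1 h2] [h3 h4]|a [h1 h2]]; rewrite /annihilator /=;
  first by rewrite -mulrA h3 mulr0 mulrA h2 mul0r.
by split; rewrite -sk -starM ?h1 ?h2 star0.
Qed.

Lemma ideal_closure e : exists J, [/\ closed_ideal J, J e &
  forall a, J a -> forall d : R, 0 < d -> exists s : seq (A * A),
    nm (a - \sum_(x <- s) x.1 * e * x.2) < d].
Proof.
pose J a := forall d : R, 0 < d -> exists s : seq (A * A),
    nm (a - \sum_(x <- s) x.1 * e * x.2) < d.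
have JM (a b u v : A) : J a -> J (u * a * v).
  move=> Ja d d0; pose D := nm u * nm v + 1.
  have D0 : 0 < D by rewrite ltr_wpDl // mulr_ge0 ?nm_ge0.
  have [s hs] := Ja (d / D) (divr_gt0 d0 D0).
  exists [seq (u * w.1, w.2 * v) | w <- s]; rewrite big_map.
  have -> : \sum_(w <- s) (u * w.1, w.2 * v).1 * e * (u * w.1, w.2 * v).2 =
            u * (\sum_(x <- s) x.1 * e * x.2) * v.
    by rewrite mulr_sumr mulr_suml; apply: eq_bigr => w _ /=; rewrite !mulrA.
  rewrite -mulrBl -mulrBr; apply: le_lt_trans (cstar_normM _ _) _.
  rewrite ltr_pdivlMr // in hs; apply: le_lt_trans hs.
  apply: le_trans (ler_wpM2r (nm_ge0 v) (cstar_normM _ _)) _.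
  rewrite mulrAC mulrC ler_wpM2l ?nm_ge0 // /D lerDl //.
exists J; split => //; last first.
  by move=> d d0; exists [:: (1, 1)]; rewrite big_seq1 mul1r mulr1 subrr nm0.
split.
- apply: closed_nm => a H d d0; have d2 : 0 < d / 2 by rewrite divr_gt0.
  have [b Jb hb] := H _ d2; have [s hs] := Jb _ d2; exists s.
  by apply: le_lt_trans (nm_subT b _ _) _; rewrite [ltRHS]splitr ltrD.
- by move=> d d0; exists [::]; rewrite big_nil subrr nm0.
- move=> a b Ja Jb d d0; have d2 : 0 < d / 2 by rewrite divr_gt0.
  have [s hs] := Ja _ d2; have [t ht] := Jb _ d2; exists (s ++ t).
  rewrite big_cat /= opprD addrACA; apply: le_lt_trans (cstar_normD _ _) _.
  by rewrite [ltRHS]splitr ltrD.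
- by move=> l a /(JM _ 0 l%:A 1); rewrite mulr1 -scalerAl mul1r.
- move=> a b Jb; split; first by have := JM b 0 a 1 Jb; rewrite mulr1.
  by have := JM b 0 1 a Jb; rewrite mul1r.
Qed.

(** By simplicity some [y], a sum of terms [u e v], is within [1 / 2] of [1], whence
    [y + star y >= 1]. Each [u e v] plus its adjoint is at most [u e (star u) + (star v) e v], the
    defect being a square; so the symmetric sum [Q] is at least [1], and conjugation by its inverse
    square root normalizes it. *)
Lemma full_projection e : simple_cstar A -> selfadjoint e -> e * e = e -> e != 0 ->
  exists s : seq A, \sum_(x <- s) star x * e * x = 1.
Proof.
move=> hs se ee e0; have [J [idJ Je HJ]] := ideal_closure e.
have [J0|JT] := hs J idJ; first by move: Je e0; rewrite J0 => /= ->; rewrite eqxx.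
have [|s hs1] := HJ 1 _ (1 / 2) ltac:(lra); first by rewrite JT.
set y := \sum_(x <- s) _ in hs1.
pose Q := \sum_(x <- [seq star w.1 | w <- s] ++ [seq w.2 | w <- s]) star x * e * x.
have QE : Q = \sum_(x <- s) (x.1 * e * star x.1 + star x.2 * e * x.2).
  rewrite /Q big_cat /= !big_map -big_split /=; apply: eq_bigr => x _.
  by rewrite starK.
have p1 : nonneg (Q - (y + star y)).
  have -> : Q - (y + star y) = \sum_(x <- s)
      star (e * (star x.1 - x.2)) * (e * (star x.1 - x.2)).
    rewrite QE /y star_sum -big_split -sumrB /=; apply: eq_bigr => x _.
    rewrite !starM !starB starK se.
    have -> : (x.1 - star x.2) * e * (e * (star x.1 - x.2)) =
      (x.1 - star x.2) * (e * e) * (star x.1 - x.2) by ncring.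
    rewrite ee; ncring.
  by apply: nonneg_sum => x; exact: star_mul_nonneg.
have p2 : nonneg ((y + star y) - 1%:C%:A).
  have sh : selfadjoint (1 + 1 - (y + star y)).
    by rewrite starB !starD !star1 starK [star y + y]addrC.
  have -> : (y + star y) - 1%:C%:A = 1%:C%:A - (1 + 1 - (y + star y)).
    by rewrite rmorph1 scale1r; ncring.
  apply: nonneg_rsub => //.
  have -> : 1 + 1 - (y + star y) = (1 - y) + star (1 - y).
    by rewrite starB star1; ncring.
  apply: le_trans (cstar_normD _ _) _; rewrite nm_star; lra.
have pQ : nonneg (Q - 1%:C%:A).
  have -> : Q - 1%:C%:A = (Q - (y + star y)) + ((y + star y) - 1%:C%:A) by ncring.
  exact: nonnegD.
have sQ : selfadjoint Q.
  by rewrite -(subrK (1%:C%:A) Q) starD pQ.1 starZr star1.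
have := isqrt_inv ltr01 pQ; set g := isqrt 1 Q.
have sg : selfadjoint g by exact: isqrt_sa.
rewrite {1}/Q => hg.
exists [seq x * g | x <- [seq star w.1 | w <- s] ++ [seq w.2 | w <- s]].
rewrite big_map -hg mulr_sumr mulr_suml; apply: eq_bigr => x _.
by rewrite starM sg; ncring.
Qed.

Lemma star_mul_eq0 x : star x * x = 0 -> x = 0.
Proof.
by move/eqP; rewrite -nm_eq0 cstar_norm_starM sqrf_eq0 nm_eq0 => /eqP.
Qed.

Lemma mvn_subprojection p q v : projection p -> projection q -> nonneg (p - q) ->
  star v * v = p -> v * star v = q -> [/\ v * p = v, p * v = v & q * p = q].
Proof.
move=> [sp pp] [sq qq] pq vv vv'.
have qp : q * p = q.
  suff : q * (1 - p) = 0 by rewrite mulrBr mulr1 => /eqP; rewrite subr_eq0 => /eqP.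
  apply: nonneg_opp_star_mul.
  have -> : - (star (q * (1 - p)) * (q * (1 - p))) = star (1 - p) * (p - q) * (1 - p).
    rewrite starM starB star1 sp sq.
    have -> : (1 - p) * (p - q) * (1 - p) =
      (p - p * p) * (1 - p) - (1 - p) * q * (1 - p) by ncring.
    by rewrite pp subrr mul0r sub0r -{3}qq; ncring.
  exact: nonneg_conj.
have pq' : p * q = q by move/(congr1 star): qp; rewrite starM sq sp.
split=> //.
- apply/eqP; rewrite -subr_eq0; apply/eqP/star_mul_eq0; rewrite starB starM sp.
  have -> : (p * star v - star v) * (v * p - v) =
    p * (star v * v) * p - p * (star v * v) - (star v * v) * p + star v * v by ncring.
  by rewrite vv !pp; ncring.
- apply: (can_inj (@starK _ _)); apply/eqP; rewrite -subr_eq0 -starB.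
  apply/eqP/star_mul_eq0; rewrite starK starB starM sp.
  have -> : (p * v - v) * (star v * p - star v) =
    p * (v * star v) * p - p * (v * star v) - (v * star v) * p + v * star v by ncring.
  by rewrite vv' !pq' !qp; ncring.
Qed.

(* The partial isometries v^i e, for a proper isometry v of pAp and e = p - v v*,
   have pairwise orthogonal ranges. *)
Lemma infinite_projection_isometries p (hs : simple_cstar A) :
  infinite_projection p -> exists r1 r2 : A,
  [/\ star r1 * r1 = 1, star r2 * r2 = 1, star r1 * r2 = 0, p * r1 = r1 & p * r2 = r2].
Proof.
move=> [hp [q [hq qp nqp [v [vv vv']]]]].
have [vp pv qp'] := mvn_subprojection hp hq (positive_nonneg qp) vv vv'.
have [sp pp] := hp; have [sq qq] := hq.
have pq' : p * q = q by move/(congr1 star): qp'; rewrite starM sq sp.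
pose e := p - q.
have se : selfadjoint e by rewrite /e starB sp sq.
have ee : e * e = e.
  by rewrite /e mulrBl !mulrBr pp qp' pq' qq subrr subr0.
have e0 : e != 0 by rewrite subr_eq0; apply/eqP => h; exact: nqp.
have ev : e * v = 0 by rewrite /e mulrBl pv -vv' -mulrA vv vp subrr.
have pe : p * e = e by rewrite /e mulrBr pp pq'.
pose V i := v ^+ i * e.
have pV i : p * V i = V i.
  by case: i => [|i]; rewrite /V ?expr0 ?mul1r // exprS -!mulrA mulrA pv.
have VS i : V i.+1 = v * V i by rewrite /V exprS mulrA.
have V0 : V 0%N = e by rewrite /V expr0 mul1r.
have VV i j : star (V i) * V j = if i == j then e else 0.
  elim: i j => [|i IH] [|j].
  - by rewrite V0 se ee.
  - by rewrite V0 se VS mulrA ev mul0r.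
  - by rewrite V0 VS -[LHS]starK starM starK se mulrA ev mul0r star0.
  - rewrite !VS starM; have -> : star (V i) * star v * (v * V j) =
      star (V i) * ((star v * v) * V j) by ncring.
    by rewrite vv pV IH eqSS.
have [s hS] := full_projection hs se ee e0.
pose n := size s; pose X i := nth 0 s i.
have hX : \sum_(i < n) star (X i) * e * X i = 1 by rewrite -hS (big_nth 0) big_mkord.
(* Orthogonality of the [V i] reduces [star (T m) * T m] to the sum in [hX]. [T 0] and [T n] use
   disjoint blocks of indices, so their ranges are orthogonal. *)
pose T m := \sum_(i < n) V (m + i)%N * X i.
have TT m m' : star (T m) * T m' =
    \sum_(i < n) \sum_(j < n) star (X i) * (star (V (m + i)%N) * V (m' + j)%N) * X j.
  rewrite /T star_sum mulr_suml; apply: eq_bigr => i _.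
  rewrite mulr_sumr; apply: eq_bigr => j _; rewrite starM; ncring.
have T1 m : star (T m) * T m = 1.
  rewrite TT -hX; apply: eq_bigr => i _.
  rewrite (bigD1 i) //= VV eqxx big1 ?addr0 // => j ji.
  rewrite VV eqn_add2l ifN ?mulr0 ?mul0r // eq_sym; exact: ji.
exists (T 0%N), (T n); split=> //.
- rewrite TT big1 // => i _; rewrite big1 // => j _.
  rewrite VV add0n ifN ?mulr0 ?mul0r //.
  by rewrite neq_ltn (leq_trans (ltn_ord i)) // leq_addr.
- by rewrite /T mulr_sumr; apply: eq_bigr => i _; rewrite mulrA pV.
- by rewrite /T mulr_sumr; apply: eq_bigr => i _; rewrite mulrA pV.
Qed.

(** The annihilator of [1 - F], with [F = G z G], contains [H], so it contains an infinite
    projection [p], and [F p = p]. On elements of the form [p a], compressing [z] by [G] therefore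
    does nothing, and the two isometries below [p] give [r1] and [r2]. *)
Theorem purely_infinite_compress z : simple_cstar A -> purely_infinite A ->
  nonneg z -> z != 0 -> exists r1 r2 : A,
  [/\ star r1 * z * r1 = 1, star r2 * z * r2 = 1 & star r1 * z * r2 = 0].
Proof.
move=> hs hpi pz z0; have [G [H [sG sH H0 FH HF]]] := local_unit pz z0.
pose F := G * z * G; pose k := 1 - F.
have sF : selfadjoint F by rewrite /F !starM sG pz.1 mulrA.
have sk : selfadjoint k by rewrite /k starB star1 sF.
have [h1 h2] := annihilator_hereditary sk.
have [|p [pk kp] ip] := hpi _ h1 h2.
  move=> h3; have : annihilator k H.
    by rewrite /annihilator /= /k mulrBr mulrBl mulr1 mul1r FH HF subrr.
  by rewrite h3 /= => h; rewrite h eqxx in H0.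
have Fp : F * p = p.
  by move: kp; rewrite /k mulrBl mul1r => /eqP; rewrite subr_eq0 eq_sym => /eqP.
have [r1 [r2 [r11 r22 r12 pr1 pr2]]] := infinite_projection_isometries hs ip.
have key a b : p * b = b -> star (G * a) * z * (G * b) = star a * b.
  move=> pb; rewrite starM sG.
  have -> : star a * G * z * (G * b) = star a * (F * b) by rewrite /F; ncring.
  by rewrite -pb (mulrA F) Fp.
by exists (G * r1), (G * r2); rewrite !key.
Qed.

End PurelyInfinite.

(** * Cuntz subequivalence *)

Section Cuntz.
Context {R : realType} {A : cstarAlgType R}.
Implicit Types (a b c x y s : A) (B : set A) (T : @infmx R A).

Lemma nm_cvg_eventually (u : nat -> A) a N :
  (forall n, (N <= n)%N -> u n = a) -> nm_cvg u a.
Proof. by move=> H e e0; exists N => n /H ->; rewrite subrr nm0. Qed.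

Lemma xget_nm_cvg (u : nat -> A) a : nm_cvg u a ->
  xget 0 [set l | u @ \oo --> l] = a.
Proof.
move=> /nm_cvgP ua; have : [set l : A | u @ \oo --> l] (xget 0 [set l | u @ \oo --> l]).
  by apply: xgetPex; exists a.
by move=> /nm_cvgP h; apply: nm_cvg_unique h _; exact/nm_cvgP.
Qed.

Lemma infmx_mul_cornerr (S : @infmx R A) b i k :
  infmx_mul S (infmx_corner b) i k = if k == 0%N then S i 0%N * b else 0.
Proof.
apply: xget_nm_cvg; apply: (nm_cvg_eventually (N := 1)) => -[//|n] _.
rewrite big_ord_recl big1 ?addr0 /infmx_corner /= => [|j _]; last by rewrite mulr0.
by case: eqP => // _; rewrite mulr0.
Qed.

Lemma infmx_mul_col0 (S T : @infmx R A) i j :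
  (forall k, k != 0%N -> S i k = 0) -> infmx_mul S T i j = S i 0%N * T 0%N j.
Proof.
move=> H; apply: xget_nm_cvg; apply: (nm_cvg_eventually (N := 1)) => -[//|n] _.
by rewrite big_ord_recl big1 ?addr0 //= => k _; rewrite H // mul0r.
Qed.

Lemma infmx_conj_corner (T : @infmx R A) b i j :
  infmx_mul (infmx_mul (infmx_star T) (infmx_corner b)) T i j =
  star (T 0%N i) * b * T 0%N j.
Proof.
rewrite infmx_mul_col0 ?infmx_mul_cornerr //= => k k0.
by rewrite infmx_mul_cornerr (negbTE k0).
Qed.

Lemma column_norm1 (x : 'cV[A]_1) : column_norm x = nm (x ord0 ord0).
Proof. by rewrite /column_norm big_ord1 cstar_norm_starM sqrtr_sqr ger0_norm ?nm_ge0. Qed.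

Lemma matrix_norm1 (M : 'M[A]_1) : nm (M ord0 ord0) <= matrix_norm M.
Proof.
apply: sup_ubound.
  exists (nm (M ord0 ord0)) => _ [x /= hx <-].
  rewrite column_norm1 in hx; rewrite column_norm1 mxE big_ord1.
  apply: le_trans (cstar_normM _ _) _.
  by rewrite ler_piMr ?nm_ge0.
exists (\matrix_(i, j) 1) => /=; first by rewrite column_norm1 mxE nm1.
by rewrite column_norm1 mxE big_ord1 mxE mulr1.
Qed.

Lemma infmx_norm_entry T : ((nm (T 0%N 0%N))%:E <= infmx_norm T)%E.
Proof.
apply: (@le_trans _ _ (matrix_norm (\matrix_(i < 1, j < 1) T i j))%:E).
  by rewrite lee_fin; apply: le_trans (matrix_norm1 _); rewrite mxE.
by apply: ereal_sup_ubound; exists 1%N.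
Qed.

Lemma infmx_norm0 : infmx_norm (0 : @infmx R A) = 0%E.
Proof.
rewrite /infmx_norm; have -> : [set (matrix_norm (\matrix_(i < n, j < n) (0 : @infmx R A) i j))%:E
            | n in [set: nat]] = [set 0%E]; last exact: ereal_sup1.
have mn n : matrix_norm (\matrix_(i < n, j < n) (0 : @infmx R A) i j) = 0.
  have cz : column_norm (0 : 'cV[A]_n) = 0.
    rewrite /column_norm big1 ?nm0 ?sqrtr0 // => i _.
    by rewrite mxE mulr0.
  have mz (x : 'cV[A]_n) : (\matrix_(i < n, j < n) (0 : @infmx R A) i j) *m x = 0.
    apply/matrixP => i j; rewrite !mxE big1 // => k _.
    by rewrite mxE mul0r.
  rewrite /matrix_norm.
  have -> : [set column_norm ((\matrix_(i < n, j < n) (0 : @infmx R A) i j) *m x)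
      | x in [set x | column_norm x <= 1]] = [set 0]; last exact: sup1.
  apply/seteqP; split => [_ [x _ <-]|_ /= ->] /=; first by rewrite mz cz.
  by exists 0; rewrite /= ?mz cz.
apply/seteqP; split => [_ [n _ <-]|_ /= ->] /=; first by rewrite mn.
by exists 0%N => //; rewrite mn.
Qed.

Lemma stabilization_entry B T : closed B -> stabilization B T -> B (T 0%N 0%N).
Proof.
move=> cB HT; apply: nm_closed => // e e0.
have [F [_ FB hF]] := HT (e / 2) (divr_gt0 e0 (ltr0n _ 2)).
exists (F 0%N 0%N) => //.
have := le_trans (infmx_norm_entry (T - F)) hF; rewrite lee_fin => h.
by apply: le_lt_trans h _; lra.
Qed.

(** Conjugating a corner matrix involves only the top row of [r n], and the norm of a matrix
    dominates that of its top left entry. So the entry [(0,0)] of [r n] already does the comparison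
    inside [B]. *)
Lemma cuntz_in_approx B a b (e : R) : closed B -> cuntz_in B a b -> 0 < e ->
  exists2 s, B s & nm (star s * b * s - a) < e.
Proof.
move=> cB [r [rB cr]] e0.
have /cr [N _ HN] : nbhs (0%E : \bar R) [set x : \bar R | (x < e%:E)%E].
  by apply: open_nbhs_nbhs; split; [exact: open_ereal_lt_ereal|rewrite /= lte_fin].
exists (r N 0%N 0%N); first exact: (stabilization_entry cB (rB N)).
have /= := HN N (leqnn _); move=> h; rewrite -lte_fin.
apply: le_lt_trans h; rewrite -infmx_conj_corner.
exact: infmx_norm_entry (_ - _).
Qed.

Lemma cuntz_in_exact B a b s : B 0 -> B s -> star s * b * s = a -> cuntz_in B a b.
Proof.
move=> B0 Bs <-; exists (fun=> infmx_corner s); split=> [_ e e0|].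
  exists (infmx_corner s); split=> [|i j|].
  - by exists 1%N => -[|i] [|j].
  - by rewrite /infmx_corner; case: ifP.
  - by rewrite subrr infmx_norm0 lee_fin ltW.
rewrite (_ : (fun _ => _) = fun=> 0%E); first exact: cvg_cst.
apply/funext => n; rewrite -infmx_norm0; congr infmx_norm.
apply/funext => i; apply/funext => j.
have -> : forall S T : @infmx R A, (S - T) i j = S i j - T i j by [].
rewrite infmx_conj_corner /infmx_corner /=.
by case: i => [|i]; case: j => [|j]; rewrite /= ?star0 ?mulr0 ?mul0r subrr.
Qed.

End Cuntz.

(** * The fixed point algebra *)

Section Action.
Context {R : realType} {A : cstarAlgType R} {G : topologicalGroupType}.
Variable alpha : G -> A -> A.
Hypothesis halpha : cstar_action alpha.
Implicit Types (a b x y : A) (g h k : G) (s : seq G).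

Lemma actM g h a : alpha (g * h)%g a = alpha g (alpha h a).
Proof. by have [_ H _] := halpha. Qed.

Lemma act_mulr g a b : alpha g (a * b) = alpha g a * alpha g b.
Proof. by have [/(_ g)[_ _ H _] _ _] := halpha. Qed.

Lemma act_star g a : alpha g (star a) = star (alpha g a).
Proof. by have [/(_ g)[_ _ _ H] _ _] := halpha. Qed.

Lemma actlin g (c : R[i]) a b : alpha g (c *: a + b) = c *: alpha g a + alpha g b.
Proof. by have [/(_ g)[_ H _ _] _ _] := halpha. Qed.

Lemma actD g a b : alpha g (a + b) = alpha g a + alpha g b.
Proof. by have := actlin g 1 a b; rewrite !scale1r. Qed.

Lemma act0 g : alpha g 0 = 0.
Proof. by apply: (addrI (alpha g 0)); rewrite -actD !addr0. Qed.

Lemma actZ g (c : R[i]) a : alpha g (c *: a) = c *: alpha g a.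
Proof. by have := actlin g c a 0; rewrite act0 !addr0. Qed.

Lemma actN g a : alpha g (- a) = - alpha g a.
Proof. by rewrite -scaleN1r actZ scaleN1r. Qed.

Lemma actB g a b : alpha g (a - b) = alpha g a - alpha g b.
Proof. by rewrite actD actN. Qed.

Lemma act_sum g I (r : seq I) (F : I -> A) :
  alpha g (\sum_(i <- r) F i) = \sum_(i <- r) alpha g (F i).
Proof. by elim/big_rec2: _ => [|i y1 y2 _ <-]; rewrite ?act0 ?actD. Qed.

Lemma act_id a : alpha 1%g a = a.
Proof.
have [/(_ 1%g)[b _ _ _] _ _] := halpha.
by apply: (bij_inj b); rewrite -actM mulg1.
Qed.

Lemma act1 g : alpha g 1 = 1.
Proof.
have [/(_ g)[[f fK Kf] _ _ _] _ _] := halpha.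
by rewrite -[LHS]mulr1 -{2}(Kf 1) -act_mulr mul1r Kf.
Qed.

Lemma actK g a : alpha g^-1%g (alpha g a) = a.
Proof. by rewrite -actM mulVg act_id. Qed.

Lemma act_spectrum g a (l : R[i]) : spectrum (alpha g a) l -> spectrum a l.
Proof.
move=> H [b [h1 h2]]; apply: H; exists (alpha g b).
have -> : alpha g a - l%:A = alpha g (a - l%:A) by rewrite actB actZ act1.
by rewrite -!act_mulr h1 h2 act1.
Qed.

(** Isometry is derived: an automorphism does not enlarge spectra, and the norm of [star b * b] is
    read off its spectrum; the inverse gives equality. *)
Lemma nm_act g a : nm (alpha g a) = nm a.
Proof.
have le k b : nm (alpha k b) <= nm b.
  rewrite -(@ler_pXn2r _ 2) ?nnegrE ?nm_ge0 // -!cstar_norm_starM -act_star -act_mulr.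
  have sb : selfadjoint (star b * b) by rewrite starM starK.
  have [|t /act_spectrum ht <-] := @spectral_radius _ _ (alpha k (star b * b)).
    by rewrite -act_star sb.
  exact: spectrum_abs ht.
by apply/eqP; rewrite eq_le le /= -{1}(actK g a) le.
Qed.

Lemma act_cont a g0 (e : R) : 0 < e ->
  \forall g \near g0, nm (alpha g a - alpha g0 a) < e.
Proof.
move=> e0; have [_ _ H] := halpha.
apply: (H a g0 [set b | nm (b - alpha g0 a) < e]).
by apply/nbhs_nmP; exists e => // b; rewrite nmC.
Qed.

Lemma fixed_closed : closed (fixed_algebra alpha).
Proof.
apply: closed_nm => a H g /=; apply/eqP; rewrite -subr_eq0; apply/eqP.
apply: nm_small_eq0 => e e0; have [b fb hb] := H _ (divr_gt0 e0 (ltr0n _ 2)).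
apply: le_trans (nm_subT b _ _) _; rewrite [leRHS]splitr lerD //; last first.
  by rewrite nmC ltW.
by rewrite -{1}(fb g) -actB nm_act ltW.
Qed.

Lemma fixed1 : fixed_algebra alpha 1.
Proof. by move=> g; exact: act1. Qed.

Lemma fixed0 : fixed_algebra alpha 0.
Proof. by move=> g; exact: act0. Qed.

Lemma fixedD a b : fixed_algebra alpha a -> fixed_algebra alpha b ->
  fixed_algebra alpha (a + b).
Proof. by move=> ha hb g; rewrite actD ha hb. Qed.

Lemma fixedN a : fixed_algebra alpha a -> fixed_algebra alpha (- a).
Proof. by move=> ha g; rewrite actN ha. Qed.

Lemma fixedB a b : fixed_algebra alpha a -> fixed_algebra alpha b ->
  fixed_algebra alpha (a - b).
Proof. by move=> ha hb; apply: fixedD => //; exact: fixedN. Qed.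

Lemma fixedM a b : fixed_algebra alpha a -> fixed_algebra alpha b ->
  fixed_algebra alpha (a * b).
Proof. by move=> ha hb g; rewrite act_mulr ha hb. Qed.

Lemma fixedZ (l : R[i]) a : fixed_algebra alpha a -> fixed_algebra alpha (l *: a).
Proof. by move=> ha g; rewrite actZ ha. Qed.

Lemma fixed_star a : fixed_algebra alpha a -> fixed_algebra alpha (star a).
Proof. by move=> ha g; rewrite act_star ha. Qed.

Lemma fixed_cfc a (f : R -> R) : selfadjoint a -> continuous f ->
  fixed_algebra alpha a -> fixed_algebra alpha (cfc a f).
Proof.
move=> sa cf fa; apply: cfc_in => // [|p]; first exact: fixed_closed.
apply: rpoly_ind => [|x r fx]; first exact: fixed0.
by apply: fixedD; [exact: fixedM|apply: fixedZ; exact: fixed1].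
Qed.

Hypothesis hcompact : compact [set: G].

(** * Finite nets in the group and averaging into the fixed point algebra *)

Lemma compact_net (osc : G -> G -> G -> R) :
  (forall g0 h0 (e : R), 0 < e -> \forall h \near h0 & g \near g0, osc g g0 h < e) ->
  forall e : R, 0 < e -> exists (s : seq G) (c : G -> G),
    forall g, c g \in s /\ forall h, osc g (c g) h < e.
Proof.
move=> H e e0; pose U g0 := [set g | forall h, osc g g0 h < e].
have nU g0 : nbhs g0 (U g0).
  have := (compact_near_coveringP [set: G]).1 hcompact G (nbhs g0)
    (fun g h => osc g g0 h < e) (nbhs_filter g0) (fun h _ => H g0 h e e0).
  by apply: filterS => g Hg h; exact: Hg.
(* Filter of lists ordered by inclusion: what holds near each point for all large enough lists holds
   for one list at all points. This encodes the extraction of a finite subcover. *)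
pose F : set_system (seq G) :=
  filter_from [set: seq G] (fun s => [set t : seq G | {subset s <= t}]).
have FF : Filter F.
  apply: filter_from_filter; first by exists [::].
  by move=> s t _ _; exists (s ++ t) => // u hu; split => g hg; apply: hu;
    rewrite mem_cat hg ?orbT.
have [g0 _|s _ Hs] := (compact_near_coveringP [set: G]).1 hcompact (seq G) F
    (fun s g => exists k, k \in s /\ forall h, osc g k h < e) FF _.
  exists (U g0, [set t : seq G | {subset [:: g0] <= t}]).
    by split=> //; exists [:: g0].
  by move=> [g s] [/= hg hs]; exists g0; split=> //; apply: hs; rewrite inE.
have Hs' g : exists k, k \in s /\ forall h, osc g k h < e by exact: (Hs s).
have [c Hc] := choice Hs'.
by exists s, c.
Qed.

Definition mean s a : A := ((size s)%:R^-1 : R)%:C *: \sum_(g <- s) alpha g a.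

Lemma nm_mean_le s (F : G -> A) (d : R) : (0 < size s)%N -> (forall g, nm (F g) <= d) ->
  nm (((size s)%:R^-1 : R)%:C *: \sum_(g <- s) F g) <= d.
Proof.
move=> s0 H; rewrite nmZr ger0_norm ?invr_ge0 // mulrC ler_pdivrMr ?ltr0n //.
apply: le_trans (nm_sum _ _ _) _; apply: (@le_trans _ _ (\sum_(g <- s) d)).
  by apply: ler_sum => g _; exact: H.
by rewrite big_const_seq count_predT iter_addr_0 mulr_natr.
Qed.

Lemma mean_cst s a : (0 < size s)%N ->
  ((size s)%:R^-1 : R)%:C *: \sum_(g <- s) a = a.
Proof.
move=> s0; rewrite big_const_seq count_predT iter_addr_0 -[a *+ _]scaler_nat scalerA.
rewrite -(rmorph_nat (real_complex R)) -rmorphM mulVf ?rmorph1 ?scale1r //.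
by rewrite pnatr_eq0 -lt0n.
Qed.

(* Kakutani's averaging argument: averaging over a k/2-net of G pulls the
   diameter of the orbit towards k/2, since each translate of y is k/2-close to
   at least one term of the mean. *)
Lemma mean_orbit (s : seq G) (c : G -> G) (y : A) (d k : R) :
  (forall g, c g \in s) -> (forall g, nm (alpha g y - alpha (c g) y) <= k / 2) ->
  (forall g, nm (alpha g y - y) <= d) ->
  forall g, nm (alpha g (mean s y) - mean s y) <=
    (1 - (size s)%:R^-1) * d + (size s)%:R^-1 * (k / 2).
Proof.
move=> cs hc hd g.
have s0 : (0 < size s)%N by have := cs g; case: (s).
have m0 : 0 < (size s)%:R :> R by rewrite ltr0n.
have hd' h h' : nm (alpha h y - alpha h' y) <= d.
  have -> : alpha h y = alpha h' (alpha (h'^-1 * h)%g y) by rewrite -actM mulgA mulgV mul1g.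
  by rewrite -actB nm_act.
rewrite {1}/mean actZ act_sum -(mean_cst (mean s y) s0) -scalerBr -sumrB.
apply: nm_mean_le => // h; rewrite -actM /mean.
rewrite -{1}(mean_cst (alpha (g * h)%g y) s0) -scalerBr -sumrB nmZr.
rewrite ger0_norm ?invr_ge0 // (perm_big _ (perm_to_rem (cs (g * h)%g))) big_cons.
rewrite mulrC ler_pdivrMr //; apply: le_trans (cstar_normD _ _) _.
have -> : ((1 - (size s)%:R^-1) * d + (size s)%:R^-1 * (k / 2)) * (size s)%:R =
  k / 2 + ((size s)%:R - 1) * d by field; rewrite gt_eqF.
apply: lerD; first exact: hc.
apply: le_trans (nm_sum _ _ _) _.
apply: le_trans (_ : \sum_(h' <- rem (c (g * h)%g) s) d <= _).
  by apply: ler_sum => h' _; exact: hd'.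
rewrite big_const_seq count_predT iter_addr_0 size_rem // -[d *+ _]mulr_natl.
by rewrite -subn1 natrB.
Qed.

(** Iterated means contract the orbit diameter towards [k / 2] at rate [1 - 1 / size s]. One net
    serves all rounds because its property is required for every right translate [g * h], a form
    that averaging preserves. *)
Lemma act_small_orbit x (d k : R) : (forall g, nm (alpha g x - x) <= d) -> 0 < k ->
  exists2 y, nm (y - x) <= d & forall g, nm (alpha g y - y) <= k.
Proof.
move=> hd k0; have d0 : 0 <= d := le_trans (nm_ge0 _) (hd 1%g).
have [|s [c hc]] := @compact_net (fun g g' h => nm (alpha (g * h)%g x - alpha (g' * h)%g x)) _
    (k / 2) (divr_gt0 k0 (ltr0n _ 2)).
  move=> g0 h0 e e0.
  have e2 : 0 < e / 2 by rewrite divr_gt0.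
  have /= := act_cont x (g0 * h0)%g e2.
  move=> /(@mulg_continuous G (g0, h0)) [[U V] /= [U1 V1] UV].
  exists (V, U) => // -[h g] [/= Vh Ug].
  apply: le_lt_trans (nm_subT (alpha (g0 * h0)%g x) _ _) _; rewrite [ltRHS]splitr ltrD //.
    by apply: (UV (g, h)).
  by rewrite nmC; apply: (UV (g0, h)); split=> //=; exact: nbhs_singleton.
have cs g : c g \in s by case: (hc g).
have s0 : (0 < size s)%N by have := cs 1%g; case: (s).
have m0 : 0 < (size s)%:R :> R by rewrite ltr0n.
pose r : R := 1 - (size s)%:R^-1.
have r1 : r < 1 by rewrite /r gtrBl invr_gt0.
have r0 : 0 <= r by rewrite /r subr_ge0 invf_le1 // ler1n.
have step n : exists y, [/\ forall g, nm (alpha g y - x) <= d,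
    forall g h, nm (alpha (g * h)%g y - alpha (c g * h)%g y) <= k / 2 &
    forall g, nm (alpha g y - y) <= k / 2 + r ^+ n * d].
  elim: n => [|n [y [y1 y2 y3]]].
    exists x; split=> [//|g h|g]; first by have [_ /(_ h)/ltW] := hc g.
    by rewrite expr0 mul1r (le_trans (hd g)) // lerDr divr_ge0 // ltW.
  exists (mean s y); split.
  - move=> g; rewrite -(mean_cst x s0) /mean actZ act_sum -scalerBr -sumrB.
    by apply: nm_mean_le => // h; rewrite -actM.
  - move=> g h; rewrite /mean !actZ !act_sum -scalerBr -sumrB.
    by apply: nm_mean_le => // l; rewrite -!actM -!mulgA.
  - move=> g; have y2' h : nm (alpha h y - alpha (c h) y) <= k / 2.
      by have := y2 h 1%g; rewrite !mulg1.
    apply: le_trans (mean_orbit cs y2' y3 g) _; rewrite -/r.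
    have -> : (size s)%:R^-1 = 1 - r by rewrite /r opprB addrC subrK.
    rewrite exprS le_eqVlt; apply/orP; left; apply/eqP; ring.
pose D := d + 1; have D0 : 0 < D by rewrite ltr_wpDl.
have [N HN] := expr_small r0 r1 (divr_gt0 (divr_gt0 k0 (ltr0n _ 2)) D0).
have [y [y1 _ y3]] := step N; exists y; first by have := y1 1%g; rewrite act_id.
move=> g; apply: le_trans (y3 g) _; rewrite {2}[k]splitr lerD2l.
have := HN N (leqnn _); rewrite ltr_pdivlMr // => /ltW; apply: le_trans.
by rewrite ler_wpM2l ?exprn_ge0 // lerDl.
Qed.

(** Halving the diameter at each round costs moves of [d], [d / 2], [d / 4] and so on: the sequence
    is Cauchy, its limit is fixed, and the total move is at most [2 * d]. *)
Theorem act_near_fixed x (d : R) : (forall g, nm (alpha g x - x) <= d) ->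
  exists2 y, fixed_algebra alpha y & nm (y - x) <= 2 * d.
Proof.
move=> hd; have d0 : 0 <= d := le_trans (nm_ge0 _) (hd 1%g).
have [de|dp] := eqVneq d 0.
  exists x; last by rewrite subrr nm0 mulr_ge0.
  move=> g; apply/eqP; rewrite -subr_eq0 -nm_eq0 eq_le nm_ge0 andbT.
  by rewrite -de hd.
have {d0 dp} d0 : 0 < d by rewrite lt_def dp.
pose w n : R := d * (2^-1) ^+ n.
have w0 n : 0 < w n by rewrite mulr_gt0 // exprn_gt0.
have wS n : w n.+1 = w n / 2 by rewrite /w exprSr mulrA.
have HF (p : nat * A) : exists y, (forall g, nm (alpha g p.2 - p.2) <= w p.1) ->
    nm (y - p.2) <= w p.1 /\ forall g, nm (alpha g y - y) <= w p.1.+1.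
  have [h|h] := pselect (forall g, nm (alpha g p.2 - p.2) <= w p.1); last by exists 0.
  by have [y h1 h2] := act_small_orbit h (w0 p.1.+1); exists y.
have [F HF'] := choice HF.
pose u := fix u n := if n is n'.+1 then F (n', u n') else x.
have uO n : forall g, nm (alpha g (u n) - u n) <= w n.
  elim: n => [|n IH] g; first by rewrite /w expr0 mulr1; exact: hd.
  by have [_ /(_ g)] := HF' (n, u n) IH.
have uS n : nm (u n.+1 - u n) <= w n by have [] := HF' (n, u n) (uO n).
have uD n m : nm (u (n + m)%N - u n) <= 2 * w n - 2 * w (n + m)%N.
  elim: m => [|m IH]; first by rewrite addn0 !subrr nm0.
  rewrite addnS; apply: le_trans (nm_subT (u (n + m)%N) _ _) _.
  by have := uS (n + m)%N; rewrite wS; lra.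
have uD' n m : (n <= m)%N -> nm (u m - u n) <= 2 * w n.
  by move=> nm; rewrite -(subnKC nm); apply: le_trans (uD _ _) _; rewrite gerBl mulr_ge0 // ltW.
have wsmall (e : R) : 0 < e -> exists N, forall n, (N <= n)%N -> w n < e.
  move=> e0; have [||N HN] := @expr_small _ (2^-1 : R) (e / d) _ _ (divr_gt0 e0 d0).
  - by rewrite invr_ge0.
  - by rewrite invf_lt1 // ltr1n.
  by exists N => n /HN; rewrite ltr_pdivlMr // mulrC.
have [y hy] : exists y, nm_cvg u y.
  apply: nm_cauchy_cvg => e e0; have [N HN] := wsmall _ (divr_gt0 e0 (ltr0n _ 4)).
  exists N => n m Nn Nm; apply: le_lt_trans (nm_subT (u N) _ _) _.
  have := HN N (leqnn _); have := uD' _ _ Nn; have := uD' _ _ Nm; rewrite (nmC (u N)).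
  lra.
exists y.
- move=> g; apply/eqP; rewrite -subr_eq0; apply/eqP/nm_small_eq0 => e e0.
  have e3 : 0 < e / 3 by rewrite divr_gt0.
  have [N HN] := wsmall _ e3; have [N' HN'] := hy _ e3.
  pose n := maxn N N'; have h1 := HN n (leq_maxl _ _); have h2 := HN' n (leq_maxr _ _).
  have h3 := uO n g.
  have -> : alpha g y - y = alpha g (y - u n) + (alpha g (u n) - u n) + (u n - y).
    by rewrite actB; ncring.
  apply: le_trans (cstar_normD _ _) _; rewrite nmC in h2.
  have := cstar_normD (alpha g (y - u n)) (alpha g (u n) - u n); rewrite nm_act.
  rewrite (nmC (u n)); lra.
- apply/ler_addgt0Pl => e e0; have [N HN] := hy _ e0.
  apply: le_trans (nm_subT (u N) _ _) _; rewrite nmC; apply: lerD.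
    exact/ltW/HN.
  by have := uD' _ _ (leq0n N); rewrite /w expr0 mulr1.
Qed.

End Action.

(** * Asymptotic sequences *)

Section Asymptotics.
Context {R : realType} {A : cstarAlgType R}.
Implicit Types (a b x y : A) (u v w : nat -> A).

Definition vanish u := forall e : R, 0 < e -> exists N, forall n, (N <= n)%N -> nm (u n) < e.

Definition bounded_seq u := exists M : R, forall n, nm (u n) <= M.

Lemma vanish_eq u v : (forall n, u n = v n) -> vanish u -> vanish v.
Proof. by move=> e h d /h[N HN]; exists N => n /HN; rewrite e. Qed.

Lemma vanishD u v : vanish u -> vanish v -> vanish (fun n => u n + v n).
Proof.
move=> hu hv e e0; have e2 : 0 < e / 2 by rewrite divr_gt0.
have [N HN] := hu _ e2; have [M HM] := hv _ e2.
exists (maxn N M) => n; rewrite geq_max => /andP[/HN h1 /HM h2].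
by apply: le_lt_trans (cstar_normD _ _) _; rewrite [ltRHS]splitr ltrD.
Qed.

Lemma vanishN u : vanish u -> vanish (fun n => - u n).
Proof. by move=> hu e /hu[N HN]; exists N => n /HN; rewrite nmN. Qed.

Lemma vanish0 : vanish (fun=> 0).
Proof. by move=> e e0; exists 0%N => n _; rewrite nm0. Qed.

Lemma vanish_sum I (r : seq I) (F : I -> nat -> A) : (forall i, vanish (F i)) ->
  vanish (fun n => \sum_(i <- r) F i n).
Proof.
move=> H; elim: r => [|i r IH]; first by apply: vanish_eq vanish0 => n; rewrite big_nil.
by apply: vanish_eq (vanishD (H i) IH) => n; rewrite big_cons.
Qed.

Lemma vanishMl u v : bounded_seq u -> vanish v -> vanish (fun n => u n * v n).
Proof.
move=> [M HM] hv e e0; pose D := `|M| + 1; have D0 : 0 < D by rewrite ltr_wpDl.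
have [N HN] := hv (e / D) (divr_gt0 e0 D0); exists N => n /HN.
rewrite ltr_pdivlMr // => h; apply: le_lt_trans (cstar_normM _ _) _.
apply: le_lt_trans h; rewrite mulrC ler_wpM2l ?nm_ge0 //.
by rewrite (le_trans (HM n)) // (le_trans (ler_norm M)) // lerDl.
Qed.

Lemma vanishMr u v : bounded_seq v -> vanish u -> vanish (fun n => u n * v n).
Proof.
move=> [M HM] hv e e0; pose D := `|M| + 1; have D0 : 0 < D by rewrite ltr_wpDl.
have [N HN] := hv (e / D) (divr_gt0 e0 D0); exists N => n /HN.
rewrite ltr_pdivlMr // => h; apply: le_lt_trans (cstar_normM _ _) _.
apply: le_lt_trans h; rewrite ler_wpM2l ?nm_ge0 //.
by rewrite (le_trans (HM n)) // (le_trans (ler_norm M)) // lerDl.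
Qed.

Lemma bounded_seqM u v : bounded_seq u -> bounded_seq v -> bounded_seq (fun n => u n * v n).
Proof.
move=> [M HM] [N HN]; exists (M * N) => n; apply: le_trans (cstar_normM _ _) _.
by rewrite ler_pM ?nm_ge0.
Qed.

Lemma bounded_seq_cst a : bounded_seq (fun=> a).
Proof. by exists (nm a). Qed.

(** For bounded sequences this is equality in the quotient of bounded by null sequences, where
    approximate relations become exact. *)
Definition asym u v := vanish (fun n => u n - v n).

Lemma asym_eq u v : (forall n, u n = v n) -> asym u v.
Proof. by move=> h; apply: vanish_eq vanish0 => n; rewrite h subrr. Qed.

Lemma asym_sym u v : asym u v -> asym v u.
Proof. by move=> /vanishN; apply: vanish_eq => n; rewrite opprB. Qed.

Lemma asym_trans v u w : asym u v -> asym v w -> asym u w.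
Proof. by move=> h1 h2; apply: vanish_eq (vanishD h1 h2) => n; rewrite addrA subrK. Qed.

Lemma asym_mulMr v v' u w : asym v v' -> bounded_seq u -> bounded_seq w ->
  asym (fun n => u n * v n * w n) (fun n => u n * v' n * w n).
Proof.
move=> h bu bw; apply: vanish_eq (vanishMr bw (vanishMl bu h)) => n.
by rewrite mulrBr mulrBl.
Qed.

Lemma asym_sum I (r : seq I) (F F' : I -> nat -> A) : (forall i, asym (F i) (F' i)) ->
  asym (fun n => \sum_(i <- r) F i n) (fun n => \sum_(i <- r) F' i n).
Proof.
by move=> H; apply: vanish_eq (vanish_sum r H) => n; rewrite sumrB.
Qed.

Lemma asymMr u v v' : asym v v' -> bounded_seq u ->
  asym (fun n => v n * u n) (fun n => v' n * u n).
Proof.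
by move=> h bu; apply: vanish_eq (vanishMr bu h) => n; rewrite mulrBl.
Qed.

(** The sum lies between [-m Q] and [m Q] in the order, so the number of terms does not enter. The
    alternative [q k = 0] serves functions vanishing identically, for which nothing is known about
    [b k]. *)
Lemma sum_conj_sa_le (K : Type) (r : seq K) (q b : K -> A) (m : R) :
  (forall k, selfadjoint (q k)) -> (forall k, selfadjoint (b k)) ->
  (forall k, q k = 0 \/ nm (b k) <= m) -> 0 <= m ->
  nm (\sum_(k <- r) q k * b k * q k) <= m * nm (\sum_(k <- r) q k * q k).
Proof.
move=> sq sb H m0; set Q := \sum_(k <- r) q k * q k.
have pQ : nonneg Q by apply: nonneg_sum => k; apply: sqr_nonneg.
have key (c : K -> A) : (forall k, selfadjoint (c k)) ->
    (forall k, q k = 0 \/ nm (c k) <= m) ->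
    nonneg (m%:C *: Q - \sum_(k <- r) q k * c k * q k).
  move=> sc Hc; have -> : m%:C *: Q - \sum_(k <- r) q k * c k * q k =
      \sum_(k <- r) star (q k) * (m%:C%:A - c k) * q k.
    rewrite /Q scaler_sumr -sumrB; apply: eq_bigr => k _.
    by rewrite sq mulrBr mulrBl -scalerAr mulr1 -scalerAl.
  apply: nonneg_sum => k; case: (Hc k) => [->|hk].
    by rewrite mulr0 -(mulr0 (star (0 : A))); exact: star_mul_nonneg.
  by apply: nonneg_conj; exact: nonneg_rsub.
have sS : selfadjoint (\sum_(k <- r) q k * b k * q k).
  by rewrite star_sum; apply: eq_bigr => k _; rewrite !starM sq sb mulrA.
have pm : nonneg ((m * nm Q)%:C%:A - m%:C *: Q).
  apply: nonneg_rsub; first by rewrite starZr pQ.1.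
  by rewrite nmZr ger0_norm.
apply: sa_abs_le => //.
- by rewrite -(subrK (m%:C *: Q) (_%:A)) -addrA; apply: nonnegD => //; exact: key.
- rewrite -(subrK (m%:C *: Q) (_%:A)) -addrA; apply: nonnegD => //.
  have := key (fun k => - b k); rewrite (eq_bigr (fun k => - (q k * b k * q k))).
    rewrite sumrN opprK; apply; first by move=> k; rewrite starN sb.
    by move=> k; rewrite nmN.
  by move=> k _; rewrite mulrN mulNr.
Qed.

(** Real and imaginary parts are treated separately, whence the factor [2]. *)
Lemma sum_conj_le (K : Type) (r : seq K) (q b : K -> A) (m : R) :
  (forall k, selfadjoint (q k)) ->
  (forall k, q k = 0 \/ nm (b k) <= m) -> 0 <= m ->
  nm (\sum_(k <- r) q k * b k * q k) <= 2 * m * nm (\sum_(k <- r) q k * q k).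
Proof.
move=> sq H m0.
pose h k := (2^-1)%:C *: (b k + star (b k)).
pose j k := (2^-1)%:C *: ('i%C *: (b k - star (b k))).
have bE k : b k = h k - 'i%C *: j k.
  rewrite /h /j (scalerA (2^-1)%:C 'i%C) mulrC -(scalerA 'i%C) scalerA -expr2 sqr_i scaleN1r.
  rewrite opprK -scalerDr addrACA subrr addr0 scale_halfD //.
have half_le (x y : A) : nm x <= m -> nm y <= m -> nm ((2^-1)%:C *: (x + y)) <= m.
  move=> hx hy; rewrite nmZr ger0_norm ?invr_ge0 // mulrC ler_pdivrMr //.
  by apply: le_trans (cstar_normD _ _) _; lra.
have nmi x : nm ('i%C *: x) = nm x.
  by rewrite cstar_normZ normc_def /= expr0n expr1n /= add0r sqrtr1 mul1r.
have hh k : q k = 0 \/ nm (h k) <= m.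
  by case: (H k) => [|hk]; [left|right; apply: half_le; rewrite ?nm_star].
have hj k : q k = 0 \/ nm (j k) <= m.
  case: (H k) => [|hk]; [by left|right].
  by rewrite /j scalerBr; apply: half_le; rewrite ?nmN nmi ?nm_star.
have sh k : selfadjoint (h k) by rewrite /h starZr starD starK addrC.
have sj k : selfadjoint (j k).
  rewrite /j starZr starZ starB starK -[star (b k) - b k]opprB scalerN -scaleNr.
  congr (_ *: (_ *: _)); by apply/eqP; rewrite eq_complex /= oppr0 opprK !eqxx.
have -> : \sum_(k <- r) q k * b k * q k = \sum_(k <- r) q k * h k * q k -
    'i%C *: \sum_(k <- r) q k * j k * q k.
  rewrite scaler_sumr -sumrB; apply: eq_bigr => k _.
  rewrite {1}bE; move: (h k) (j k) => hk jk.
  by rewrite mulrBr mulrBl -scalerAr -scalerAl.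
apply: le_trans (nmB _ _) _; rewrite nmi.
have := sum_conj_sa_le r sq sh hh m0; have := sum_conj_sa_le r sq sj hj m0; lra.
Qed.

End Asymptotics.

(** * Real functions on the group as elements of [C(G)] *)

Section RealFunctions.
Context {R : realType} {G : topologicalGroupType}.
Implicit Types (f h : G -> R) (g : G).

Definition cfun f : G -> R[i]^o := fun x => (f x)%:C.

Lemma cfun_CG f : continuous f -> CG (cfun f).
Proof.
move=> cf x U /nbhs_ballP[e /= e0 HU].
have er : e = (complex.Re e)%:C by rewrite RRe_real // gtr0_real.
have re0 : 0 < complex.Re e by move: e0; rewrite er ltcR.
have /cvgrPdist_lt/(_ _ re0) := cf x.
rewrite /nbhs /=; apply: filterS => y hy; apply: HU.
by rewrite /ball /= /cfun -rmorphB er normc_def /= expr0n addr0 sqrtr_sqr ltcR.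
Qed.

Lemma cfunM f h : cfun (fun x => f x * h x) = cfun f * cfun h.
Proof. by apply/funext => x; rewrite /cfun rmorphM. Qed.

Lemma cfun_star f : CG_star (cfun f) = cfun f.
Proof. by apply/funext => x; rewrite /CG_star /cfun conj_Creal // complex_real. Qed.

Lemma cfun_Lt g f : Lt g (cfun f) = cfun (fun x => f (g^-1 * x)%g).
Proof. by []. Qed.

Lemma cfun_norm f (M : R) : (forall x, `|f x| <= M) -> CG_norm (cfun f) <= M.
Proof.
move=> H; apply: ge_sup; first by exists (complex.Re `|cfun f 1%g|), 1%g.
by move=> _ [x _ <-]; rewrite /cfun ReC_norm.
Qed.

Lemma continuous_translate f g : continuous f -> continuous (fun x => f (g^-1 * x)%g).
Proof.
move=> cf x; apply: (@continuous_comp _ _ _ (fun x => (g^-1 * x)%g) f); last exact: cf.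
apply: (@continuous_comp _ _ _ (fun x => (g^-1%g, x)) (fun p : G * G => (p.1 * p.2)%g)).
  by apply: cvg_pair => /=; [exact: cvg_cst|exact: cvg_id].
exact: mulg_continuous.
Qed.

End RealFunctions.

(** * Partitions of unity along orbits *)

Section RealContinuity.
Context {R : realType} {T : topologicalType}.
Implicit Types (f k : T -> R).

Lemma continuous_mulr f k : continuous f -> continuous k ->
  continuous (fun x => f x * k x).
Proof. by move=> cf ch x; apply: cvgM; [exact: cf|exact: ch]. Qed.

Lemma continuous_addr f k : continuous f -> continuous k ->
  continuous (fun x => f x + k x).
Proof. by move=> cf ch x; apply: cvgD; [exact: cf|exact: ch]. Qed.

Lemma continuous_oppr f : continuous f -> continuous (fun x => - f x).
Proof. by move=> cf x; apply: cvgN; exact: cf. Qed.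

Lemma continuous_sumr I (r : seq I) (F : I -> T -> R) : (forall i, continuous (F i)) ->
  continuous (fun x => \sum_(i <- r) F i x).
Proof.
move=> H; elim: r => [|i r IH].
  by under eq_fun do rewrite big_nil; exact: cst_continuous.
by under eq_fun do rewrite big_cons; exact: continuous_addr.
Qed.

Lemma continuous_sqrtT f : continuous f -> continuous (fun x => Num.sqrt (f x)).
Proof.
by move=> cf x; apply: (@continuous_comp _ _ _ f Num.sqrt); [exact: cf|exact: sqrt_continuous].
Qed.

End RealContinuity.

Section RokhlinData.
Context {R : realType} {A : cstarAlgType R} {G : topologicalGroupType}.
Variable alpha : G -> A -> A.
Hypothesis halpha : cstar_action alpha.
Hypothesis hcompact : compact [set: G].
Implicit Types (a b y d : A) (f k : G -> R) (g h : G).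

Lemma continuous_boundedG f : continuous f -> exists M : R, forall x, `|f x| <= M.
Proof.
move=> cf; have [|M [_ HM]] := (compact_near_coveringP [set: G]).1 hcompact R (pinfty_nbhs R)
    (fun M x => `|f x| <= M) _.
  move=> x _; have /cvgrPdist_lt/(_ _ ltr01) hx := cf x.
  exists ([set y | `|f x - f y| < 1], [set M | `|f x| + 1 < M]).
    by split=> //=; exact: nbhs_pinfty_gt (num_real _).
  move=> [y M] /= [h1 h2].
  have -> : f y = f x - (f x - f y) by ring.
  by apply: le_trans (ler_normB _ _) _; lra.
by exists (M + 1) => x; apply: HM => //; rewrite ltrDl.
Qed.

Lemma act_cont_dist a b : continuous (fun g => nm (alpha g a - b)).
Proof.
move=> g0; apply/cvgrPdist_lt => e e0.
have := act_cont halpha a g0 e0; apply: filterS => g hg.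
apply: le_lt_trans (nm_sub_abs _ _) _.
have -> : alpha g0 a - b - (alpha g a - b) = alpha g0 a - alpha g a by ncring.
by rewrite nmC.
Qed.

(* The w i are normalized bump functions of the orbit pseudometric of (a, b). *)
Lemma orbit_partition a b (e : R) : 0 < e ->
  exists (n : nat) (x : 'I_n -> G) (w : 'I_n -> G -> R),
  [/\ forall i, continuous (w i), forall i h, 0 <= w i h,
      forall h, \sum_i w i h * w i h = 1 &
      forall i h, w i h != 0 -> nm (alpha h a - alpha (x i) a) + nm (alpha h b - alpha (x i) b) < e].
Proof.
move=> e0; pose rho g h := nm (alpha g a - alpha h a) + nm (alpha g b - alpha h b).
have [|s [c Hc]] := @compact_net _ G hcompact (fun g g' _ => rho g g') _ (e / 2)
  (divr_gt0 e0 (ltr0n _ 2)).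
  move=> g0 h0 d d0; have d2 : 0 < d / 2 by rewrite divr_gt0.
  have h1 := act_cont halpha a g0 d2; have h2 := act_cont halpha b g0 d2.
  exists ([set: G], [set g | nm (alpha g a - alpha g0 a) < d / 2 /\
    nm (alpha g b - alpha g0 b) < d / 2]).
    by split=> /=; [exact: filterT|exact: filterI].
  by move=> [h g] [/= _ [h3 h4]]; rewrite /rho [ltRHS]splitr ltrD.
pose n := size s; pose x (i : 'I_n) := nth 1%g s i.
pose bump (i : 'I_n) h := Num.max 0 (e - rho h (x i)).
have cb i : continuous (bump i).
  move=> h; apply: (@continuous_comp _ _ _ (fun h => e - rho h (x i)) (Num.max 0)).
    apply: cvgB; first exact: cvg_cst.
    by apply: cvgD; exact: act_cont_dist.
  exact: continuous_maxr.
have b0 i h : 0 <= bump i h by rewrite le_max lexx.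
pose D h := \sum_i bump i h.
have D0 h : 0 < D h.
  have [cs /(_ h) hc] := Hc h.
  have ci : (index (c h) s < n)%N by rewrite index_mem.
  rewrite /D (bigD1 (Ordinal ci)) //= ltr_pwDl //; last by apply: sumr_ge0.
  by rewrite lt_max /x nth_index // subr_gt0; apply/orP; right; apply: lt_trans hc _; lra.
have cD : continuous D by exact: continuous_sumr.
have cDV : continuous (fun h => (D h)^-1).
  by move=> h; apply: cvgV; [rewrite gt_eqF|exact: cD].
have t0 i h : 0 <= bump i h / D h by rewrite divr_ge0 // ltW.
exists n, x, (fun i h => Num.sqrt (bump i h / D h)); split.
- by move=> i; apply: continuous_sqrtT; exact: continuous_mulr.
- by move=> i h; exact: sqrtr_ge0.
- move=> h; under eq_bigr do rewrite -expr2 sqr_sqrtr //.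
  by rewrite -mulr_suml; apply: mulfV; rewrite gt_eqF //; exact: D0.
- move=> i h; rewrite sqrtr_eq0 -ltNge; rewrite pmulr_lgt0 ?invr_gt0 //.
  by rewrite lt_max ltxx /= subr_gt0.
Qed.

(** What is kept of a Rokhlin pair, for real functions and [x = 1]. In [rd_small] one [e] comes from
    the Cuntz approximation and the other from replacing [(1 - d - e)_+] by [1 - d]. *)
Record rokhlin_data (e : R) (F : set A) (S : set (G -> R)) (y d : A)
    (q : (G -> R) -> A) := RokhlinData {
  rd_fixed : fixed_algebra alpha d;
  rd_pos : nonneg d;
  rd_le1 : nm d <= 1;
  rd_big : 1 - e < nm (d * d);
  rd_add : forall f k, continuous f -> continuous k ->
    q (fun x => f x + k x) = q f + q k;
  rd_opp : forall f, continuous f -> q (fun x => - f x) = - q f;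
  rd_le : forall f (M : R), continuous f -> (forall x, `|f x| <= M) -> nm (q f) <= M;
  rd_nonneg : forall f, continuous f -> (forall x, 0 <= f x) -> nonneg (q f);
  rd_1 : q (fun=> 1) = d;
  rd_mul : forall f k, S f -> S k -> nm (d * q (fun x => f x * k x) - q f * q k) < e;
  rd_com : forall f a, S f -> F a -> nm (q f * a - a * q f) < e;
  rd_act : forall f g, S f -> nm (q (fun x => f (g^-1 * x)%g) - alpha g (q f)) < e;
  rd_small : exists2 s, fixed_algebra alpha s & nm (star s * y * s - (1 - d)) < 2 * e
}.

Lemma cutdown_close a (e : R) : 0 <= e -> nonneg a -> nm (cutdown a e - a) <= e.
Proof.
move=> e0 [sa pa]; rewrite nmC -{1}(rpolyX a); apply: cfc_close => //.
  by apply: continuous_max0_comp => t; apply: cvgB; [exact: cvg_id|exact: cst_continuous].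
move=> t /pa t0; rewrite hornerX ler_norml /Num.max; case: ltP => h; lra.
Qed.

Lemma rokhlin_data_ex (hrok : weak_tracial_rokhlin alpha) (e : R) (F : set A)
    (S : set (G -> R)) y :
  0 < e -> finite_set F -> finite_set S -> (forall f, S f -> continuous f) ->
  positive_in (fixed_algebra alpha) y -> y <> 0 ->
  exists d q, rokhlin_data e F S y d q.
Proof.
move=> e0 fF fS cS py y0.
have p1 : positive_in [set: A] 1 by exists 1; rewrite // star1 mulr1.
have SC : cfun @` S `<=` CG by move=> _ [f /cS cf <-]; exact: cfun_CG.
have [d [psi [[pd d1] [_ psil psin psip] [hm hc hs] psi1 [_ hy hx]]]] :=
  hrok e F (cfun @` S) 1 y e0 fF (finite_image _ fS) SC p1 (nm1 (A:=A)) py y0.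
have cf1 : continuous (fun _ : G => 1 : R) by exact: cst_continuous.
have add f k : continuous f -> continuous k ->
    psi (cfun (fun x => f x + k x)) = psi (cfun f) + psi (cfun k).
  move=> cf ch; rewrite -[X in X + _]scale1r -psil; [|exact: cfun_CG|exact: cfun_CG].
  congr psi; apply/funext => x.
  by rewrite -[RHS]/(1 * (f x)%:C + (k x)%:C) mul1r -rmorphD.
have opp f : continuous f -> psi (cfun (fun x => - f x)) = - psi (cfun f).
  move=> cf; apply/eqP; rewrite -addr_eq0 -add //; last exact: continuous_oppr.
  have := add _ _ cf (continuous_oppr cf).
  have z0 : psi (cfun (fun=> 0)) = 0.
    by have := add (fun=> 0) (fun=> 0) (@cst_continuous _ _ 0) (@cst_continuous _ _ 0);
       under eq_fun do rewrite addr0; move=> /eqP; rewrite -subr_eq subrr eq_sym => /eqP.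
  by move=> _; under eq_fun do rewrite addNr; rewrite z0.
have le f (M : R) : continuous f -> (forall x, `|f x| <= M) -> nm (psi (cfun f)) <= M.
  move=> cf H; apply: le_trans (psin _ (cfun_CG cf)) _; exact: cfun_norm.
have pos f : continuous f -> (forall x, 0 <= f x) -> nonneg (psi (cfun f)).
  move=> cf f0; have cs := continuous_sqrtT cf.
  (* Positivity is complete positivity for matrices of size [1], applied to [f] as the square of
     [Num.sqrt f]. *)
  have [|W _ HW] := psip 1%N (\matrix_(i, j) cfun f).
    exists (\matrix_(i, j) cfun (fun x => Num.sqrt (f x))) => [i j|].
      by rewrite mxE; exact: cfun_CG.
    apply/matrixP => i j; rewrite !mxE big_ord1 !mxE cfun_star -cfunM.
    by congr cfun; apply/funext => x; rewrite -expr2 sqr_sqrtr.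
  have := congr1 (fun M : 'M[A]_1 => M ord0 ord0) HW.
  by rewrite !mxE big_ord1 !mxE => ->; exact: star_mul_nonneg.
exists d, (psi \o cfun); split => //=.
- by case: pd => b fb ->; apply: (fixedM halpha) => //; exact: fixed_star.
- exact: positive_nonneg pd.
- by move: hx; rewrite mulr1.

- by move=> f k Sf Sk; rewrite cfunM -psi1; apply: hm; [exists f|exists k].
- by move=> f a Sf Fa; apply: hc => //; exists f.
- move=> f g Sf; have cf := cS _ Sf.
  apply: le_lt_trans (hs (cfun f) _); last by exists f.
  (* [sup] bounds its elements only when the set is bounded above, so a bound uniform over the group
     is supplied. *)
  apply: sup_ubound; last by exists g.
  have [M HM] := continuous_boundedG cf.
  exists (M + M) => _ [h _ <-]; apply: le_trans (nmB _ _) _.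
  apply: lerD; last by rewrite (nm_act halpha); exact: le.
  rewrite cfun_Lt; apply: (le (fun u => f (h^-1 * u)%g)) => //.
  exact: (continuous_translate cf).
- have [s fs hs'] := cuntz_in_approx (fixed_closed halpha) hy e0.
  exists s => //; apply: le_lt_trans (nm_subT (cutdown (1 - d) e) _ _) _.
  rewrite mulr_natl mulr2n ltr_leD //; apply: cutdown_close; first exact: ltW.
  have -> : 1 - d = 1%:C%:A - d by rewrite rmorph1 scale1r.
  by apply: nonneg_rsub => //; case: (positive_nonneg pd).
Qed.

End RokhlinData.

(** * Approximately multiplicative maps from a Rokhlin sequence *)

Section RokhlinSequence.
Context {R : realType} {A : cstarAlgType R} {G : topologicalGroupType}.
Variable alpha : G -> A -> A.
Hypothesis halpha : cstar_action alpha.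
Hypothesis hcompact : compact [set: G].
Variables (F : set A) (S : set (G -> R)) (y : A).
Variables (d : nat -> A) (q : nat -> (G -> R) -> A).
Hypothesis Hq : forall n, rokhlin_data alpha n.+1%:R^-1 F S y (d n) (q n).
Hypothesis cS : forall f, S f -> continuous f.
Implicit Types (a b : A) (f : G -> R) (g h : G) (n : nat).

Lemma harmonic_small (e : R) : 0 < e -> exists N, forall n, (N <= n)%N -> n.+1%:R^-1 < e.
Proof.
move=> e0; have /cvgrPdist_lt/(_ _ e0)[N _ HN] := @cvg_harmonic R.
by exists N => n /HN; rewrite /= sub0r normrN ger0_norm ?invr_ge0.
Qed.

Lemma vanish_harmonic (u : nat -> A) : (forall n, nm (u n) < n.+1%:R^-1) -> vanish u.
Proof.
move=> H e /harmonic_small[N HN]; exists N => n /HN; apply: lt_trans; exact: H.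
Qed.

Lemma d_bounded : bounded_seq d.
Proof. by exists 1 => n; exact: rd_le1 (Hq n). Qed.

Lemma q_bounded f : continuous f -> bounded_seq (q ^~ f).
Proof.
move=> cf; have [M HM] := continuous_boundedG hcompact cf.
by exists M => n; exact: rd_le (Hq n) _ _ cf HM.
Qed.

Lemma q_sa f n : continuous f -> (forall x, 0 <= f x) -> selfadjoint (q n f).
Proof. by move=> cf f0; case: (rd_nonneg (Hq n) cf f0). Qed.

Lemma q_eq0 f n : (forall x, f x = 0) -> q n f = 0.
Proof.
move=> f0; have -> : f = fun=> 0 by apply/funext.
apply: nm_small_eq0 => e e0; apply: le_trans (ltW e0).
by apply: (rd_le (Hq n)) => [|x]; [exact: cst_continuous|rewrite normr0].
Qed.

Lemma q_sum I (r : seq I) (f : I -> G -> R) n : (forall i, continuous (f i)) ->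
  q n (fun x => \sum_(i <- r) f i x) = \sum_(i <- r) q n (f i).
Proof.
move=> cf; elim: r => [|i r IH].
  by rewrite big_nil; apply: q_eq0 => x; rewrite big_nil.
rewrite big_cons -IH -(rd_add (Hq n)) //; last exact: continuous_sumr.
by congr (q n _); apply/funext => x; rewrite big_cons.
Qed.

Lemma q_mul_asym f f' : S f -> S f' ->
  asym (fun n => d n * q n (fun x => f x * f' x)) (fun n => q n f * q n f').
Proof. by move=> Sf Sk; apply: vanish_harmonic => n; exact: (rd_mul (Hq n)). Qed.

Lemma q_com_asym f a : S f -> F a -> asym (fun n => q n f * a) (fun n => a * q n f).
Proof. by move=> Sf Fa; apply: vanish_harmonic => n; exact: (rd_com (Hq n)). Qed.

Lemma asym_step (v v' u w s t : nat -> A) : asym v v' -> bounded_seq u -> bounded_seq w ->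
  (forall n, s n = u n * v n * w n) -> (forall n, t n = u n * v' n * w n) -> asym s t.
Proof.
move=> h bu bw es et; apply: vanish_eq (asym_mulMr h bu bw) => n.
by rewrite es et.
Qed.

Definition sq f : G -> R := fun h => f h * f h.

Lemma sum_dq (K : finType) (f : K -> G -> R) n : (forall k, continuous (f k)) ->
  (forall x, \sum_k f k x * f k x = 1) -> \sum_k d n * q n (sq (f k)) = d n * d n.
Proof.
move=> cf f1; rewrite -mulr_sumr -q_sum; last by move=> k; exact: continuous_mulr.
congr (_ * _); rewrite -(rd_1 (Hq n)); congr (q n _).
exact/funext.
Qed.

(** Approximate multiplicativity and centrality turn the sum into [\sum_k q(f k) b(k) q(f k)], and
    the squares [q(f k) q(f k)] add up asymptotically to [d * d], of norm at most [1]. Only the size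
    of [b k] where [f k] is nonzero matters, and the number of terms does not. *)
Lemma limsup_sum (K : finType) (f : K -> G -> R) (b : K -> A) (m : R) :
  (forall k, S (f k)) -> (forall k x, 0 <= f k x) ->
  (forall x, \sum_k f k x * f k x = 1) -> (forall k, F (b k)) ->
  (forall k x, f k x != 0 -> nm (b k) <= m) -> 0 <= m ->
  forall e : R, 0 < e -> exists N, forall n, (N <= n)%N ->
    nm (\sum_k d n * q n (sq (f k)) * b k) <= 2 * m + e.
Proof.
move=> Sf f0 f1 Fb Hb m0 e e0.
have cf k : continuous (f k) by exact: cS.
pose X n := \sum_k q n (f k) * b k * q n (f k).
have UX : asym (fun n => \sum_k d n * q n (sq (f k)) * b k) X.
  apply: asym_sum => k.
  apply: (asym_trans (v := fun n => q n (f k) * q n (f k) * b k)).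
    exact: (asymMr (q_mul_asym (Sf k) (Sf k)) (bounded_seq_cst (b k))).
  apply: (asym_step (q_com_asym (Sf k) (Fb k)) (q_bounded (cf k)) (bounded_seq_cst 1)) => n.
    by rewrite mulr1 mulrA.
  by rewrite mulr1 mulrA.
have Q1 : asym (fun n => \sum_k q n (f k) * q n (f k)) (fun n => d n * d n).
  apply: (asym_trans (v := fun n => \sum_k d n * q n (sq (f k)))).
    by apply: asym_sum => k; apply: asym_sym; exact: q_mul_asym.
  by apply: asym_eq => n; exact: sum_dq.
(* An error [e / D] in the sum of squares costs [2 * m * (e / D) <= e / 2]. *)
pose D := 4 * m + 1; have D0 : 0 < D by rewrite ltr_wpDl // mulr_ge0.
have [N HN] := UX _ (divr_gt0 e0 (ltr0n _ 2)).
have [N' HN'] := Q1 _ (divr_gt0 e0 D0).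
exists (maxn N N') => n; rewrite geq_max => /andP[/HN h1 /HN' h2].
have nQ : nm (\sum_k q n (f k) * q n (f k)) <= 1 + e / D.
  rewrite -(subrK (d n * d n) (\sum_k _)) addrC.
  apply: le_trans (cstar_normD _ _) _; apply: lerD; last exact: ltW.
  apply: le_trans (cstar_normM _ _) _; have := rd_le1 (Hq n); have := nm_ge0 (d n); nra.
have nX : nm (X n) <= 2 * m * nm (\sum_k q n (f k) * q n (f k)).
  apply: sum_conj_le => // k; first exact: q_sa.
  have [[x hx]|h] := pselect (exists x, f k x != 0); first by right; exact: Hb hx.
  left; apply: q_eq0 => x; apply/eqP/negPn/negP => hx; apply: h; by exists x.
rewrite -(subrK (X n) (\sum_k _)); apply: le_trans (cstar_normD _ _) _.
have eD : e / D * D = e by rewrite divfK // gt_eqF.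
have : 0 < e / D by rewrite divr_gt0.
have : 2 * m * nm (\sum_k q n (f k) * q n (f k)) <= 2 * m * (1 + e / D).
  by rewrite ler_wpM2l // mulr_ge0.
rewrite /D in eD *; nra.
Qed.

Variables (z : A) (r : bool -> A) (m : nat) (x : 'I_m -> G) (w : 'I_m -> G -> R).
Variables (C dl : R).
Hypothesis fz : fixed_algebra alpha z.
Hypothesis rz : forall j k, star (r j) * z * r k = if j == k then 1 else 0.
Hypothesis w0 : forall i h, 0 <= w i h.
Hypothesis w1 : forall h, \sum_i w i h * w i h = 1.
Hypothesis wd : forall i h, w i h != 0 -> forall k, nm (alpha h (r k) - alpha (x i) (r k)) <= dl.
Hypothesis dl0 : 0 <= dl.
Hypothesis C1 : 1 <= C.
Hypothesis rC : forall k, nm (r k) <= C.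
Hypothesis zC : nm z <= C.

Definition conjB (p : 'I_m * 'I_m) j k : A :=
  star (alpha (x p.1) (r j)) * z * alpha (x p.2) (r k).

Hypothesis S1 : S (fun=> 1).
Hypothesis Sw : forall i, S (w i).
Hypothesis Sww : forall i, S (sq (w i)).
Hypothesis Sw2 : forall p : 'I_m * 'I_m, S (fun h => w p.1 h * w p.2 h).
Hypothesis Fr : forall i k, F (alpha (x i) (r k)).
Hypothesis Frs : forall i k, F (star (alpha (x i) (r k))).
Hypothesis Frz : forall i k, F (star (alpha (x i) (r k)) * z).
Hypothesis FB : forall p j k, F (conjB p j k - (if j == k then 1 else 0)).

Definition T n k : A := \sum_i d n * q n (sq (w i)) * alpha (x i) (r k).

Lemma cw i : continuous (w i). Proof. exact: cS. Qed.
Lemma cww i : continuous (sq (w i)). Proof. exact: cS. Qed.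

Lemma T_bounded : exists N, forall n, (N <= n)%N -> forall k, nm (T n k) <= 2 * C + 1.
Proof.
have C0 : 0 <= C by rewrite (le_trans _ C1).
have H k : exists N, forall n, (N <= n)%N -> nm (T n k) <= 2 * C + 1.
  apply: (limsup_sum (f := w) (b := fun i => alpha (x i) (r k))) => //.
  by move=> i h _; rewrite (nm_act halpha).
have [N HN] := H true; have [N' HN'] := H false.
exists (maxn N N') => n; rewrite geq_max => /andP[h1 h2] [].
  exact: HN. exact: HN'.
Qed.

(** Where both weights are nonzero, each of the two translates of [r k] is within [dl] of
    [alpha h (r k)]. With equal translates the product would be the image of [star (r j) * z * r k],
    as [z] is fixed. *)
Lemma conjB_close p h j k : w p.1 h * w p.2 h != 0 ->
  nm (conjB p j k - (if j == k then 1 else 0)) <= C * C * (2 * dl).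
Proof.
rewrite mulf_eq0 negb_or => /andP[h1 h2].
have C0 : 0 <= C by rewrite (le_trans _ C1).
have -> : conjB p j k - (if j == k then 1 else 0) =
    star (alpha (x p.1) (r j)) * z * (alpha (x p.2) (r k) - alpha (x p.1) (r k)).
  rewrite mulrBr; congr (_ - _).
  have -> : (if j == k then 1 else 0) = alpha (x p.1) (if j == k then 1 else 0).
    by case: (j == k); rewrite ?(act1 halpha) ?(act0 halpha).
  by rewrite -rz !(act_mulr halpha) (act_star halpha) fz.
apply: le_trans (cstar_normM _ _) _; apply: ler_pM; rewrite ?nm_ge0 //.
  apply: le_trans (cstar_normM _ _) _; apply: ler_pM; rewrite ?nm_ge0 //.
  by rewrite nm_star (nm_act halpha).
apply: le_trans (nm_subT (alpha h (r k)) _ _) _.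
rewrite mulr_natl mulr2n lerD ?wd //; by rewrite nmC wd.
Qed.

Lemma d_com_asym a : F a -> asym (fun n => d n * a) (fun n => a * d n).
Proof.
move=> Fa; have := q_com_asym S1 Fa; apply: vanish_eq => n.
by rewrite (rd_1 (Hq n)).
Qed.

Lemma d_q_asym f : S f -> asym (fun n => d n * q n f) (fun n => q n f * d n).
Proof.
move=> Sf; have := q_mul_asym Sf S1; apply: vanish_eq => n.
rewrite (rd_1 (Hq n)); congr (_ * q n _ - _).
by apply/funext => h; rewrite mulr1.
Qed.

(** The factors [d] and [q] are moved to the left past the coefficients and [z], one adjacent
    exchange at a time; the two [q] factors then merge at the price of one more [d]. *)
Lemma TT_asym j k : asym (fun n => star (T n j) * z * T n k)
  (fun n => d n * d n * (\sum_p d n * q n (sq (fun h => w p.1 h * w p.2 h)) * conjB p j k)).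
Proof.
have bd := d_bounded.
have bq i : bounded_seq (q ^~ (sq (w i))) by exact: (q_bounded (cS (Sww i))).
have b1 := bounded_seq_cst (1 : A).
apply: (asym_trans (v := fun n => \sum_(p : 'I_m * 'I_m)
    star (alpha (x p.1) (r j)) * q n (sq (w p.1)) * d n * z * d n *
    q n (sq (w p.2)) * alpha (x p.2) (r k))).
  apply: asym_eq => n; rewrite -(pair_bigA _ (fun i l =>
    star (alpha (x i) (r j)) * q n (sq (w i)) * d n * z * d n * q n (sq (w l)) *
    alpha (x l) (r k))) /=.
  rewrite /T star_sum !mulr_suml; apply: eq_bigr => i _.
  rewrite mulr_sumr; apply: eq_bigr => l _; rewrite !starM (rd_pos (Hq n)).1.
  rewrite (q_sa _ (@cww i)); first by ncring.
  by move=> h; rewrite /sq mulr_ge0.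
apply: (asym_trans (v := fun n => \sum_(p : 'I_m * 'I_m)
    d n * d n * (d n * q n (sq (fun h => w p.1 h * w p.2 h)) * conjB p j k))); last first.
  by apply: asym_eq => n; rewrite mulr_sumr.
apply: asym_sum => -[i l] /=.
set a := star (alpha (x i) (r j)); set a' := alpha (x l) (r k).
pose Q n := q n (sq (w i)); pose Q' n := q n (sq (w l)).
have Fa : F a by exact: Frs.
have Faz : F (a * z) by exact: Frz.
have aQ : asym (fun n => a * Q n) (fun n => Q n * a) by apply: asym_sym; exact: q_com_asym.
have ad : asym (fun n => a * d n) (fun n => d n * a) by apply: asym_sym; exact: d_com_asym.
have azd : asym (fun n => a * z * d n) (fun n => d n * (a * z))
  by apply: asym_sym; exact: d_com_asym.
have azQ : asym (fun n => a * z * Q' n) (fun n => Q' n * (a * z))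
  by apply: asym_sym; exact: q_com_asym.
have Qd : asym (fun n => Q n * d n) (fun n => d n * Q n) by apply: asym_sym; exact: d_q_asym.
have QQ : asym (fun n => Q n * Q' n) (fun n => d n * q n (sq (fun h => w i h * w l h))).
  apply: asym_sym; have := q_mul_asym (Sww i) (Sww l); apply: vanish_eq => n.
  congr (_ * q n _ - _); apply/funext => h; rewrite /sq; ring.
have bc (c : A) : bounded_seq (fun=> c) by exact: bounded_seq_cst.
have bM := @bounded_seqM R A.
apply: (asym_trans (v := fun n => Q n * a * d n * z * d n * Q' n * a')).
  apply: (asym_step aQ b1 (bM _ _ (bM _ _ (bM _ _ (bM _ _ bd (bc z)) bd) (bq l)) (bc a'))) => n;
    rewrite -/(Q n) -/(Q' n); ncring.
apply: (asym_trans (v := fun n => Q n * d n * a * z * d n * Q' n * a')).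
  apply: (asym_step ad (bq i) (bM _ _ (bM _ _ (bM _ _ (bc z) bd) (bq l)) (bc a'))) => n;
    rewrite -/(Q n) -/(Q' n); ncring.
apply: (asym_trans (v := fun n => Q n * d n * d n * a * z * Q' n * a')).
  apply: (asym_step azd (bM _ _ (bq i) bd) (bM _ _ (bq l) (bc a'))) => n;
    rewrite -/(Q n) -/(Q' n); ncring.
apply: (asym_trans (v := fun n => Q n * d n * d n * Q' n * a * z * a')).
  apply: (asym_step azQ (bM _ _ (bM _ _ (bq i) bd) bd) (bc a')) => n;
    rewrite -/(Q n) -/(Q' n); ncring.
apply: (asym_trans (v := fun n => d n * Q n * d n * Q' n * a * z * a')).
  apply: (asym_step Qd b1 (bM _ _ (bM _ _ bd (bq l)) (bM _ _ (bM _ _ (bc a) (bc z)) (bc a')))) => n;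
    rewrite -/(Q n) -/(Q' n); ncring.
apply: (asym_trans (v := fun n => d n * d n * Q n * Q' n * a * z * a')).
  apply: (asym_step Qd bd (bM _ _ (bq l) (bM _ _ (bM _ _ (bc a) (bc z)) (bc a')))) => n;
    rewrite -/(Q n) -/(Q' n); ncring.
apply: (asym_step QQ (bM _ _ bd bd) (bc (a * z * a'))) => n; first by ncring.
by rewrite /conjB /= -/a -/a'; ncring.
Qed.

Lemma sumsq_pair (u v : 'I_m -> R) :
  \sum_p (u p.1 * v p.2) * (u p.1 * v p.2) = (\sum_i u i * u i) * (\sum_i v i * v i).
Proof.
rewrite -(pair_bigA _ (fun i l => (u i * v l) * (u i * v l))) /= big_distrlr /=.
by apply: eq_bigr => i _; apply: eq_bigr => l _; rewrite mulrACA.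
Qed.

Lemma TT_close (e : R) : 0 < e -> exists N, forall n, (N <= n)%N -> forall j k,
  nm (star (T n j) * z * T n k - (if j == k then 1 else 0) * (d n * d n * d n * d n)) <=
  2 * (C * C * (2 * dl)) + e.
Proof.
move=> e0; have e2 : 0 < e / 2 by rewrite divr_gt0.
have C0 : 0 <= C by rewrite (le_trans _ C1).
have H j k : exists N, forall n, (N <= n)%N ->
    nm (star (T n j) * z * T n k - (if j == k then 1 else 0) * (d n * d n * d n * d n)) <=
    2 * (C * C * (2 * dl)) + e.
  have [N HN] := TT_asym j k e2.
  have [|||||N' HN'] := @limsup_sum _ (fun (p : 'I_m * 'I_m) h => w p.1 h * w p.2 h)
      (fun p => conjB p j k - (if j == k then 1 else 0)) (C * C * (2 * dl)) Sw2 _ _ _ _ _ _ e2.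
  - by move=> p h; rewrite mulr_ge0.
  - by move=> h; rewrite (sumsq_pair (w ^~ h) (w ^~ h)) !w1 mulr1.
  - by move=> p; exact: FB.
  - by move=> p h; exact: conjB_close.
  - by rewrite !mulr_ge0.
  exists (maxn N N') => n; rewrite geq_max => /andP[/HN h1 /HN' h2].
  set X := \sum_p _ in h2.
  (* The weights sum to [d * d], so subtracting the constant from each coefficient removes exactly
     that constant times the fourth power of [d]. *)
  have e1 : d n * d n * X = d n * d n *
      (\sum_p d n * q n (sq (fun h => w p.1 h * w p.2 h)) * conjB p j k)
     - (if j == k then 1 else 0) * (d n * d n * d n * d n).
    have Q1 := sum_dq n (fun p => cS (Sw2 p)) (fun h => _).
    rewrite /X; under eq_bigr do rewrite mulrBr; rewrite sumrB -mulr_suml Q1.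
      by case: (j == k); ncring.
    by move=> h; rewrite (sumsq_pair (w ^~ h) (w ^~ h)) !w1 mulr1.
  rewrite -(subrK (d n * d n * X) (_ - _)); apply: le_trans (cstar_normD _ _) _.
  have -> : 2 * (C * C * (2 * dl)) + e = e / 2 + (2 * (C * C * (2 * dl)) + e / 2) by lra.
  apply: lerD.
    rewrite e1 opprB addrA subrK; exact: ltW.
  have nd := rd_le1 (Hq n); have nd0 := nm_ge0 (d n); have nX0 := nm_ge0 X.
  apply: le_trans (cstar_normM _ _) _; apply: le_trans h2.
  rewrite ler_piMl //; apply: le_trans (cstar_normM _ _) _; nra.
have [N1 H1] := H true true; have [N2 H2] := H true false.
have [N3 H3] := H false true; have [N4 H4] := H false false.
exists (maxn (maxn N1 N2) (maxn N3 N4)) => n; rewrite !geq_max.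
move=> /andP[/andP[h1 h2] /andP[h3 h4]] [] [].
- exact: H1.
- exact: H2.
- exact: H3.
- exact: H4.
Qed.

Lemma w_sq_le1 i h : sq (w i) h <= 1.
Proof.
rewrite -(w1 h) /sq (bigD1 i) //= lerDl.
by apply: sumr_ge0 => l _; rewrite mulr_ge0.
Qed.

(** [alpha g] translates the partition, and the old and the translated partitions are refined to
    their products. Where a product is nonzero at [h], both [alpha g (alpha (x i) (r k))] and
    [alpha (x l) (r k)] are within [dl] of [alpha h (r k)], so [limsup_sum] applies. *)
Lemma act_T_close g (e : R) : 0 < e ->
  (forall p : 'I_m * 'I_m, S (fun h => w p.2 h * w p.1 (g^-1 * h)%g)) ->
  (forall (p : 'I_m * 'I_m) k, F (alpha g (alpha (x p.1) (r k)) - alpha (x p.2) (r k))) ->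
  exists N, forall n, (N <= n)%N -> forall k,
    nm (alpha g (T n k) - T n k) <= 2 * (2 * dl) + e.
Proof.
move=> e0 Sg Fg.
pose f (p : 'I_m * 'I_m) h := w p.2 h * w p.1 (g^-1 * h)%g.
have cf p : continuous (f p) by exact: (cS (Sg p)).
have w1g h : \sum_i w i (g^-1 * h)%g * w i (g^-1 * h)%g = 1 by exact: w1.
have sqE p h : sq (f p) h = sq (w p.2) h * sq (w p.1) (g^-1 * h)%g.
  by rewrite /sq /f mulrACA.
have csq p : continuous (sq (f p)) by exact: continuous_mulr.
pose V n k := \sum_i d n * q n (fun h => sq (w i) (g^-1 * h)%g) * alpha g (alpha (x i) (r k)).
have VT n k : V n k - T n k = \sum_p d n * q n (sq (f p)) *
    (alpha g (alpha (x p.1) (r k)) - alpha (x p.2) (r k)).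
  under [RHS]eq_bigr do rewrite mulrBr.
  rewrite sumrB -(pair_bigA _ (fun i l => d n * q n (sq (f (i, l))) * alpha g (alpha (x i) (r k)))).
  rewrite -(pair_bigA _ (fun i l => d n * q n (sq (f (i, l))) * alpha (x l) (r k))) /=.
  congr (_ - _).
    apply: eq_bigr => i _; rewrite -mulr_suml -mulr_sumr -q_sum //.
    congr (_ * q n _ * _); apply/funext => h.
    by under eq_bigr do rewrite sqE /=; rewrite -mulr_suml [X in X * _]w1 mul1r.
  rewrite exchange_big; apply: eq_bigr => l _; rewrite -mulr_suml -mulr_sumr -q_sum //.
  congr (_ * q n _ * _); apply/funext => h.
  by under eq_bigr do rewrite sqE /=; rewrite -mulr_sumr [X in _ * X]w1g mulr1.
have aV k : asym (fun n => alpha g (T n k)) (V ^~ k).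
  apply: (asym_trans (v := fun n =>
    \sum_i d n * alpha g (q n (sq (w i))) * alpha g (alpha (x i) (r k)))).
    apply: asym_eq => n; rewrite (act_sum halpha); apply: eq_bigr => i _.
    by rewrite !(act_mulr halpha) (rd_fixed (Hq n)).
  apply: asym_sum => i; apply: asym_mulMr; [|exact: d_bounded|exact: bounded_seq_cst].
  apply: asym_sym; apply: vanish_harmonic => n; exact: (rd_act (Hq n)).
have e2 : 0 < e / 2 by rewrite divr_gt0.
have H k : exists N, forall n, (N <= n)%N -> nm (alpha g (T n k) - T n k) <= 2 * (2 * dl) + e.
  have [N HN] := aV k _ e2.
  have [|||||N' HN'] := @limsup_sum _ f
      (fun p => alpha g (alpha (x p.1) (r k)) - alpha (x p.2) (r k)) (2 * dl) Sg _ _ _ _ _ _ e2.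
  - by move=> p h; rewrite mulr_ge0.
  - move=> h; have := sumsq_pair (fun i => w i (g^-1 * h)%g) (w ^~ h).
    by rewrite !w1 mulr1 => <-; apply: eq_bigr => p _; rewrite /f; ring.
  - by move=> p; exact: Fg.
  - move=> p h; rewrite mulf_eq0 negb_or => /andP[h1 h2].
    apply: le_trans (nm_subT (alpha h (r k)) _ _) _; rewrite mulr_natl mulr2n.
    apply: lerD; last exact: wd.
    have -> : alpha h (r k) = alpha g (alpha (g^-1 * h)%g (r k)).
      by rewrite -(actM halpha) mulgA mulgV mul1g.
    by rewrite -(actB halpha) (nm_act halpha) nmC wd.
  - by rewrite mulr_ge0.
  exists (maxn N N') => n; rewrite geq_max => /andP[/HN h1 /HN' h2].
  apply: le_trans (nm_subT (V n k) _ _) _; rewrite VT; lra.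
have [N HN] := H true; have [N' HN'] := H false.
exists (maxn N N') => n; rewrite geq_max => /andP[h1 h2] [].
  exact: HN.
exact: HN'.
Qed.

(** The asymptotic estimate handles finitely many [g] at a time, hence the net. From [g] to [c g]
    the terms are compared one by one: the triangle inequality is affordable here because [ka] is
    small relative to [m]. *)
Lemma act_T_uniform (s : seq G) (c : G -> G) (ka e : R) : 0 < e -> 0 <= ka ->
  (forall g, c g \in s) ->
  (forall g, g \in s -> forall p : 'I_m * 'I_m, S (fun h => w p.2 h * w p.1 (g^-1 * h)%g)) ->
  (forall g, g \in s -> forall (p : 'I_m * 'I_m) k,
     F (alpha g (alpha (x p.1) (r k)) - alpha (x p.2) (r k))) ->
  (forall g i h, `|sq (w i) (g^-1 * h)%g - sq (w i) ((c g)^-1 * h)%g| <= ka) ->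
  (forall g i k, nm (alpha g (alpha (x i) (r k)) - alpha (c g) (alpha (x i) (r k))) <= ka) ->
  m%:R * (ka * C + ka) <= dl ->
  exists N, forall n, (N <= n)%N -> forall g k,
    nm (alpha g (T n k) - T n k) <= 5 * dl + e.
Proof.
move=> e0 ka0 cs Ss Fs wc rc kd.
have C0 : 0 <= C by rewrite (le_trans _ C1).
have e2 : 0 < e / 2 by rewrite divr_gt0.
have [N HN] : exists N, forall n, (N <= n)%N -> forall g, g \in s -> forall k,
    nm (alpha g (T n k) - T n k) <= 2 * (2 * dl) + e / 2.
  elim: (s) Ss Fs => [|g t IH] St Ft; first by exists 0%N.
  have [N1 H1] := act_T_close e2 (St g (mem_head _ _)) (Ft g (mem_head _ _)).
  have [||N2 H2] := IH.
  - by move=> g' g't; apply: St; rewrite inE g't orbT.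
  - by move=> g' g't; apply: Ft; rewrite inE g't orbT.
  exists (maxn N1 N2) => n; rewrite geq_max => /andP[/H1 h1 /H2 h2] g'.
  by rewrite inE => /orP[/eqP->//|]; exact: h2.
pose D := 4 * (m%:R * C) + 1.
have D0 : 0 < D by rewrite ltr_wpDl // !mulr_ge0.
have [N' HN'] := harmonic_small (divr_gt0 e0 D0).
exists (maxn N N') => n; rewrite geq_max => /andP[/HN h1 /HN' h2] g k.
apply: le_trans (nm_subT (alpha (c g) (T n k)) _ _) _.
have := h1 (c g) (cs g) k.
suff : nm (alpha g (T n k) - alpha (c g) (T n k)) <= dl + e / 2 by lra.
pose b : R := (2 * n.+1%:R^-1 + ka) * C + ka.
apply: (@le_trans _ _ (\sum_(i < m) b)).
  rewrite /T !(act_sum halpha) -sumrB; apply: le_trans (nm_sum _ _ _) _.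
  apply: ler_sum => i _; rewrite !(act_mulr halpha) !(rd_fixed (Hq n)).
  set Q := q n (sq (w i)); set a := alpha (x i) (r k).
  have -> : d n * alpha g Q * alpha g a - d n * alpha (c g) Q * alpha (c g) a =
     d n * ((alpha g Q - alpha (c g) Q) * alpha g a + alpha (c g) Q * (alpha g a - alpha (c g) a)).
    by ncring.
  apply: le_trans (cstar_normM _ _) _.
  apply: (@le_trans _ _ (1 * b)); last by rewrite mul1r.
  apply: ler_pM; rewrite ?nm_ge0 ?(rd_le1 (Hq n)) //.
  apply: le_trans (cstar_normD _ _) _; apply: lerD.
    apply: le_trans (cstar_normM _ _) _; apply: ler_pM; rewrite ?nm_ge0 //; last first.
      by rewrite !(nm_act halpha).
    have a1 := rd_act (Hq n) g (Sww i); have a2 := rd_act (Hq n) (c g) (Sww i).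
    set f1 := (fun h => _) in a1; set f2 := (fun h => _) in a2.
    have c1 : continuous f1 by exact: (continuous_translate (@cww i)).
    have c2 : continuous f2 by exact: (continuous_translate (@cww i)).
    have a3 : nm (q n f1 - q n f2) <= ka.
      rewrite -(rd_opp (Hq n)) // -(rd_add (Hq n)) //; last exact: continuous_oppr.
      apply: (rd_le (Hq n)); first by apply: continuous_addr => //; exact: continuous_oppr.
      by move=> h; exact: wc.
    apply: le_trans (nm_subT (q n f1) _ _) _; rewrite (nmC (alpha g Q)).
    apply: (@le_trans _ _ (n.+1%:R^-1 + (ka + n.+1%:R^-1))); last first.
      by move: (n.+1%:R^-1) => v; lra.
    apply: lerD; first exact: ltW.
    by apply: le_trans (nm_subT (q n f2) _ _) _; apply: lerD => //; exact: ltW.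
  apply: le_trans (cstar_normM _ _) _.
  apply: (@le_trans _ _ (1 * ka)); last by rewrite mul1r.
  apply: ler_pM; rewrite ?nm_ge0 ?rc // (nm_act halpha).
  apply: (rd_le (Hq n)); first exact: cww.
  by move=> h; rewrite ger0_norm ?w_sq_le1 // /sq mulr_ge0.
rewrite sumr_const card_ord -[b *+ m]mulr_natl /b.
move: h2; move: (n.+1%:R^-1) => v h2.
have eD : e / D * D = e by rewrite divfK // gt_eqF.
have m0 : 0 <= m%:R * C by rewrite mulr_ge0.
have ed : 0 < e / D by rewrite divr_gt0.
have -> : m%:R * ((2 * v + ka) * C + ka) = 2 * (m%:R * C * v) + m%:R * (ka * C + ka).
  by ring.
have : m%:R * C * v <= m%:R * C * (e / D) by rewrite ler_wpM2l // ltW.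
rewrite /D in eD ed *; lra.
Qed.

End RokhlinSequence.

(** * Transfer to the fixed point algebra *)

Section Transfer.
Context {R : realType} {A : cstarAlgType R} {G : topologicalGroupType}.
Variable alpha : G -> A -> A.
Hypothesis halpha : cstar_action alpha.
Hypothesis hcompact : compact [set: G].
Hypothesis hrok : weak_tracial_rokhlin alpha.
Implicit Types (a b c d s t v w x y z : A) (g h : G).

Lemma continuous_normr (T : topologicalType) (f : T -> R) : continuous f ->
  continuous (fun u => `|f u|).
Proof. by move=> cf u; apply: cvg_norm; exact: cf. Qed.

(** One net must control all translated weights and both families of orbits, so their oscillations
    are added into a single function that vanishes at [g = g0]. *)
Lemma equicontinuous_net m (x : 'I_m -> G) (w : 'I_m -> G -> R) (r : bool -> A) (e : R) :
  (forall i, continuous (w i)) -> 0 < e ->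
  exists (s : seq G) (c : G -> G), [/\ forall g, c g \in s,
    forall g i h, `|sq (w i) (g^-1 * h)%g - sq (w i) ((c g)^-1 * h)%g| <= e &
    forall g i k, nm (alpha g (alpha (x i) (r k)) - alpha (c g) (alpha (x i) (r k))) <= e].
Proof.
move=> cw e0; have cs i : continuous (sq (w i)) by exact: continuous_mulr.
pose term g g' h i := `|sq (w i) (g^-1 * h)%g - sq (w i) (g'^-1 * h)%g| +
  (nm (alpha g (alpha (x i) (r true)) - alpha g' (alpha (x i) (r true))) +
   nm (alpha g (alpha (x i) (r false)) - alpha g' (alpha (x i) (r false)))).
have term0 g g' h i : 0 <= term g g' h i by rewrite !addr_ge0 ?nm_ge0.
have cinv : continuous (fun p : G * G => (p.2^-1 * p.1)%g).
  move=> p; apply: (@continuous_comp _ _ _ (fun p => (p.2^-1%g, p.1))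
    (fun p : G * G => (p.1 * p.2)%g)).
    apply: cvg_pair => /=; last exact: cvg_fst.
    by apply: (@continuous_comp _ _ _ snd (fun g : G => g^-1%g));
      [exact: cvg_snd|exact: invg_continuous].
  exact: mulg_continuous.
have cterm g0 h0 i : continuous (fun p : G * G =>
    `|sq (w i) (p.2^-1 * p.1)%g - sq (w i) (g0^-1 * p.1)%g| +
    (nm (alpha p.2 (alpha (x i) (r true)) - alpha g0 (alpha (x i) (r true))) +
   nm (alpha p.2 (alpha (x i) (r false)) - alpha g0 (alpha (x i) (r false))))).
  apply: continuous_addr.
    have -> : (fun p : G * G => `|sq (w i) (p.2^-1 * p.1)%g - sq (w i) (g0^-1 * p.1)%g|) =
      (fun p : G * G => `|sq (w i) (p.2^-1 * p.1)%g + - sq (w i) (g0^-1 * p.1)%g|) by [].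
    apply: continuous_normr; apply: continuous_addr.
      by move=> p; apply: (@continuous_comp _ _ _ (fun p : G * G => (p.2^-1 * p.1)%g) (sq (w i)));
        [exact: cinv|exact: cs].
    apply: continuous_oppr => p.
    apply: (@continuous_comp _ _ _ fst (fun h => sq (w i) (g0^-1 * h)%g)); first exact: cvg_fst.
    exact: (continuous_translate (cs i)).
  apply: continuous_addr => p.
    apply: (@continuous_comp _ _ _ snd (fun g => nm (alpha g (alpha (x i) (r true)) -
      alpha g0 (alpha (x i) (r true))))); [exact: cvg_snd|exact: act_cont_dist].
  apply: (@continuous_comp _ _ _ snd (fun g => nm (alpha g (alpha (x i) (r false)) -
    alpha g0 (alpha (x i) (r false))))); [exact: cvg_snd|exact: act_cont_dist].
have [|s [c Hc]] := @compact_net _ G hcompact (fun g g' h => \sum_i term g g' h i) _ e e0.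
  move=> g0 h0 d d0.
  have /cvgrPdist_lt/(_ _ d0) := continuous_sumr (r := index_enum 'I_m) (cterm g0 h0) (x := (h0, g0)).
  apply: filterS => -[h g] /=; rewrite big1 => [|i _]; last first.
    by rewrite !subrr normr0 !nm0 !addr0.
  by rewrite sub0r normrN; apply: le_lt_trans; exact: ler_norm.
exists s, c; split=> [g|g i h|g i k]; first by have [] := Hc g.
  have [_ /(_ h)/ltW] := Hc g; apply: le_trans.
  rewrite (bigD1 i) //= -[leLHS]addr0 lerD ?sumr_ge0 // lerDl addr_ge0 ?nm_ge0 //.
have [_ /(_ 1%g)/ltW] := Hc g; apply: le_trans.
rewrite (bigD1 i) //= -[leLHS]addr0 lerD ?sumr_ge0 // /term.
have n1 := nm_ge0 (alpha g (alpha (x i) (r true)) - alpha (c g) (alpha (x i) (r true))).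
have n2 := nm_ge0 (alpha g (alpha (x i) (r false)) - alpha (c g) (alpha (x i) (r false))).
have n3 := normr_ge0 (sq (w i) (g^-1 * 1)%g - sq (w i) ((c g)^-1 * 1)%g).
by case: k; lra.
Qed.

Lemma finite_family (K : finType) (T : Type) (f : K -> T) : finite_set (f @` [set: K]).
Proof. by apply: finite_image; exact: finite_finset. Qed.

(* The map a |-> d sum_i psi(p_i) alpha_{x_i}(a), for a fine partition of unity
   p_i = w_i^2, is almost multiplicative up to powers of d and almost takes values in
   the fixed point algebra; it carries the relations of r1, r2 to t1, t2. *)
Lemma rokhlin_transfer z (r : bool -> A) y (e : R) : fixed_algebra alpha z ->
  (forall j k, star (r j) * z * r k = if j == k then 1 else 0) ->
  positive_in (fixed_algebra alpha) y -> y <> 0 -> 0 < e ->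
  exists (d : A) (t : bool -> A) (s : A),
  [/\ [/\ fixed_algebra alpha d, nonneg d, nm d <= 1 & 1 - e < nm (d * d)],
      forall k, fixed_algebra alpha (t k), fixed_algebra alpha s,
      forall j k, nm (star (t j) * z * t k - (if j == k then 1 else 0) * (d * d * d * d)) <= e &
      nm (star s * y * s - (1 - d)) <= e].
Proof.
move=> fz rz py y0 e0.
pose C := 1 + nm z + nm (r true) + nm (r false).
have nz := nm_ge0 z; have n1 := nm_ge0 (r true); have n2 := nm_ge0 (r false).
have C1 : 1 <= C by rewrite /C; lra.
have zC : nm z <= C by rewrite /C; lra.
have rC k : nm (r k) <= C by case: k; rewrite /C; lra.
have C0 : 0 < C by rewrite (lt_le_trans ltr01).
(* [1 / 12] keeps the correction [12 * dl] of [T] below [1]. The factor [100] covers [84] from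
   replacing [T] by fixed elements, [4] from [TT_close] and [1] from its extra error [dl]. *)
pose dl := Num.min (1 / 12) (e / (100 * (C * C))).
have CC : 0 < 100 * (C * C) by rewrite !mulr_gt0.
have dl0 : 0 < dl by rewrite lt_min !divr_gt0.
have dl12' : dl <= 1 / 12 by rewrite ge_min lexx.
have dl12 : 12 * dl <= 1 by lra.
have dle : dl * (100 * (C * C)) <= e by rewrite -ler_pdivlMr // ge_min lexx orbT.
have [m [x [w [cw w0 w1 wd]]]] := orbit_partition halpha hcompact (r true) (r false) dl0.
have wd' i h : w i h != 0 -> forall k, nm (alpha h (r k) - alpha (x i) (r k)) <= dl.
  move=> /wd H; have p1 := nm_ge0 (alpha h (r true) - alpha (x i) (r true)).
  have p2 := nm_ge0 (alpha h (r false) - alpha (x i) (r false)).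
  by case; lra.
pose ka := dl / ((m%:R + 1) * (C + 1)).
have mC0 : 0 < (m%:R + 1) * (C + 1).
  by apply: mulr_gt0; [rewrite ltr_wpDl|rewrite addr_gt0].
have ka0 : 0 < ka by rewrite divr_gt0.
have kad : m%:R * (ka * C + ka) <= dl.
  have -> : dl = ka * ((m%:R + 1) * (C + 1)) by rewrite /ka divfK // gt_eqF.
  have : 0 <= ka * (C + 1) by rewrite mulr_ge0 ?addr_ge0 // ltW.
  lra.
have [s [c [cs wc rc]]] := equicontinuous_net x r cw ka0.
pose g_ (i : 'I_(size s)) := nth 1%g s i.
(* Among translated weights, only those by elements of the net [s] enter, which keeps [S] and [F]
   finite. *)
pose S : set (G -> R) := [set (fun=> 1)] `|` (w @` [set: 'I_m]) `|`
  ((fun i => sq (w i)) @` [set: 'I_m]) `|`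
  ((fun p : 'I_m * 'I_m => (fun h => w p.1 h * w p.2 h)) @` [set: 'I_m * 'I_m]) `|`
  ((fun p : 'I_m * 'I_m * 'I_(size s) => (fun h => w p.1.2 h * w p.1.1 ((g_ p.2)^-1 * h)%g))
     @` [set: 'I_m * 'I_m * 'I_(size s)]).
pose F : set A := ((fun p : 'I_m * bool => alpha (x p.1) (r p.2)) @` [set: 'I_m * bool]) `|`
  ((fun p : 'I_m * bool => star (alpha (x p.1) (r p.2))) @` [set: 'I_m * bool]) `|`
  ((fun p : 'I_m * bool => star (alpha (x p.1) (r p.2)) * z) @` [set: 'I_m * bool]) `|`
  ((fun p : 'I_m * 'I_m * bool * bool =>
      conjB alpha z r x p.1.1 p.1.2 p.2 - (if p.1.2 == p.2 then 1 else 0))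
     @` [set: 'I_m * 'I_m * bool * bool]) `|`
  ((fun p : 'I_m * 'I_m * bool * 'I_(size s) =>
      alpha (g_ p.2) (alpha (x p.1.1.1) (r p.1.2)) - alpha (x p.1.1.2) (r p.1.2))
     @` [set: 'I_m * 'I_m * bool * 'I_(size s)]).
have fS : finite_set S by rewrite !finite_setU; do !split=> //; exact: finite_family.
have fF : finite_set F by rewrite !finite_setU; do !split=> //; exact: finite_family.
have cS f : S f -> continuous f.
  move=> [[[[->|[i _ <-]]|[i _ <-]]|[p _ <-]]|[p _ <-]].
  - exact: cst_continuous.
  - exact: cw.
  - by apply: continuous_mulr; exact: cw.
  - by apply: continuous_mulr; exact: cw.
  - by apply: continuous_mulr; [exact: cw|exact: continuous_translate (cw _)].
have S1 : S (fun=> 1) by do 4! left.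
have Sw i : S (w i) by do 3! left; right; exists i.
have Sww i : S (sq (w i)) by do 2! left; right; exists i.
have Sw2 (p : 'I_m * 'I_m) : S (fun h => w p.1 h * w p.2 h) by left; right; exists p.
have Fr i k : F (alpha (x i) (r k)) by do 4! left; exists (i, k).
have Frs i k : F (star (alpha (x i) (r k))) by do 3! left; right; exists (i, k).
have Frz i k : F (star (alpha (x i) (r k)) * z) by do 2! left; right; exists (i, k).
have FB p j k : F (conjB alpha z r x p j k - (if j == k then 1 else 0)).
  by left; right; exists (p, j, k).
have Ss g : g \in s -> forall p : 'I_m * 'I_m, S (fun h => w p.2 h * w p.1 (g^-1 * h)%g).
  move=> gs p; have ig : (index g s < size s)%N by rewrite index_mem.
  by right; exists (p, Ordinal ig) => //=; rewrite /g_ /= nth_index.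
have Fs g : g \in s -> forall (p : 'I_m * 'I_m) k,
    F (alpha g (alpha (x p.1) (r k)) - alpha (x p.2) (r k)).
  move=> gs p k; have ig : (index g s < size s)%N by rewrite index_mem.
  by right; exists (p, k, Ordinal ig) => //=; rewrite /g_ /= nth_index.
have HR n : exists p : A * ((G -> R) -> A), rokhlin_data alpha n.+1%:R^-1 F S y p.1 p.2.
  have n0 : 0 < n.+1%:R^-1 :> R by rewrite invr_gt0.
  by have [d [q Hq]] := rokhlin_data_ex halpha hcompact hrok n0 fF fS cS py y0; exists (d, q).
have [dq Hdq] := choice HR.
pose d n := (dq n).1; pose q n := (dq n).2.
have Hq n : rokhlin_data alpha n.+1%:R^-1 F S y (d n) (q n) by exact: Hdq.
have [N1 H1] := T_bounded halpha hcompact Hq cS w0 w1 C1 rC Sw Fr.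
have [N2 H2] := TT_close halpha hcompact Hq cS fz rz w0 w1 wd' (ltW dl0)
  C1 rC zC S1 Sww Sw2 Frs Frz FB dl0.
have [N3 H3] := act_T_uniform halpha hcompact Hq cS w0 w1 wd' (ltW dl0)
  C1 rC Sww dl0 (ltW ka0) cs Ss Fs wc rc kad.
have [N4 H4] := harmonic_small (divr_gt0 e0 (ltr0n R 2)).
pose n := maxn (maxn N1 N2) (maxn N3 N4).
have h1 := H1 n (leq_trans (leq_maxl _ _) (leq_maxl _ _)).
have h2 := H2 n (leq_trans (leq_maxr _ _) (leq_maxl _ _)).
have h3 := H3 n (leq_trans (leq_maxl _ _) (leq_maxr _ _)).
have h4 := H4 n (leq_trans (leq_maxr _ _) (leq_maxr _ _)).
(* The orbit of [T] oscillates by at most [5 * dl + dl], and passing to a fixed element doubles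
   this. *)
have Ht k : exists t, fixed_algebra alpha t /\ nm (t - T alpha d q r x w n k) <= 12 * dl.
  have [t ft ht] := act_near_fixed halpha hcompact (h3 ^~ k).
  by exists t; split => //; apply: le_trans ht _; lra.
have [t Hft] := choice Ht.
have [s' fs' hs'] := rd_small (Hq n).
exists (d n), t, s'; split => //.
- split; [exact: rd_fixed (Hq n)|exact: rd_pos (Hq n)|exact: rd_le1 (Hq n)|].
  apply: lt_trans (rd_big (Hq n)); move: h4; move: (n.+1%:R^-1) => v h4; lra.
- by move=> k; have [] := Hft k.
- move=> j k; set Tj := T alpha d q r x w n j in h2 *; set Tk := T alpha d q r x w n k.
  have := h2 j k; set D4 := _ * (d n * d n * d n * d n); rewrite -/Tj -/Tk => h2'.
  apply: le_trans (nm_subT (star Tj * z * Tk) _ _) _.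
  have [_ hj] := Hft j; have [_ hk] := Hft k; rewrite -/Tj in hj; rewrite -/Tk in hk.
  have e1 : nm (star (t j) * z * t k - star Tj * z * Tk) <= 84 * (C * C) * dl.
    have -> : star (t j) * z * t k - star Tj * z * Tk =
      (star (t j) - star Tj) * z * t k + star Tj * z * (t k - Tk) by ncring.
    have bk : nm (t k) <= 4 * C.
      rewrite -(subrK Tk (t k)); apply: le_trans (cstar_normD _ _) _.
      by have := h1 k; rewrite -/Tk; lra.
    have bj : nm (star Tj) <= 3 * C by rewrite nm_star; have := h1 j; rewrite -/Tj; lra.
    rewrite -starB; apply: le_trans (cstar_normD _ _) _.
    have -> : 84 * (C * C) * dl = (12 * dl) * C * (4 * C) + (3 * C) * C * (12 * dl) by ring.
    apply: lerD.
      apply: le_trans (cstar_normM _ _) _; apply: ler_pM; rewrite ?nm_ge0 //.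
      by apply: le_trans (cstar_normM _ _) _; apply: ler_pM; rewrite ?nm_ge0 ?nm_star.
    apply: le_trans (cstar_normM _ _) _; apply: ler_pM; rewrite ?nm_ge0 //.
    by apply: le_trans (cstar_normM _ _) _; apply: ler_pM; rewrite ?nm_ge0.
  have CC1 : dl <= C * C * dl by rewrite ler_peMl ?(ltW dl0) // mulr_ege1.
  apply: le_trans (lerD e1 h2') _; lra.
- apply: le_trans (ltW hs') _; move: h4; move: (n.+1%:R^-1) => v h4; lra.
Qed.

(** * Compressing fixed positive elements to the unit *)

Hypothesis hsimple : simple_cstar A.
Hypothesis hpi : purely_infinite A.

Lemma sqr_small_contra a b p : selfadjoint a -> nonneg p -> a * a + p = b ->
  1 / 2 <= nm a -> nm b <= 1 / 16 -> False.
Proof.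
have key (u v : R) : 1 / 2 <= u -> v <= 1 / 16 -> u ^+ 2 <= v -> False by move=> *; nra.
move=> sa pp ab ha hb; have e : b - a * a = p by rewrite -ab addrAC subrr add0r.
apply: (key _ _ ha hb); rewrite -nm_sa_sqr //.
by apply: nm_mono; [exact: sqr_nonneg|rewrite e].
Qed.

Lemma compress_bool z : nonneg z -> z != 0 -> exists r : bool -> A,
  forall j k, star (r j) * z * r k = if j == k then 1 else 0.
Proof.
move=> pz z0; have [r1 [r2 [h1 h2 h3]]] := purely_infinite_compress hsimple hpi pz z0.
exists (fun k => if k then r1 else r2) => -[] [] //=.
by apply: (can_inj (@starK _ _)); rewrite star0 -h3 !starM starK pz.1 mulrA.
Qed.

(** If the positive part vanished, [v1 * star v1 <= v2 * star v2]; conjugating by [v1] bounds the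
    square of [star v1 * v1] by a product of [star v1 * v2] with its adjoint, which is too small.
    The negative part is symmetric. *)
Lemma parts_neq0 (v1 v2 k : A) : selfadjoint k -> 3 / 4 <= nm k ->
  nm (star v1 * v1 - k) <= 1 / 16 -> nm (star v2 * v2 - k) <= 1 / 16 ->
  nm (star v1 * v2) <= 1 / 16 ->
  pos_part (v1 * star v1 - v2 * star v2) != 0 /\
  neg_part (v1 * star v1 - v2 * star v2) != 0.
Proof.
move=> sk hk h1 h2 h12; set c := v1 * star v1 - v2 * star v2.
have sc : selfadjoint c by rewrite /c starB !starM !starK.
have big v : nm (star v * v - k) <= 1 / 16 -> 1 / 2 <= nm (star v * v).
  by move=> h; have := le_trans (nm_sub_abs _ _) h; rewrite ler_norml => /andP[]; lra.
have sv v : selfadjoint (star v * v) by rewrite starM starK.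
have ne : nm (star v1 * v2 * star (star v1 * v2)) <= 1 / 16.
  apply: le_trans (cstar_normM _ _) _; rewrite nm_star; have := nm_ge0 (star v1 * v2); nra.
have ne' : nm (star (star v1 * v2) * (star v1 * v2)) <= 1 / 16.
  apply: le_trans (cstar_normM _ _) _; rewrite nm_star; have := nm_ge0 (star v1 * v2); nra.
split; apply/eqP => c0.
- have cE : c = - neg_part c by rewrite {1}(pos_neg_sub sc) c0 sub0r.
  apply: (sqr_small_contra (sv v1) (nonneg_conj v1 (neg_part_nonneg sc)) _ (big _ h1) ne).
  have -> : neg_part c = - c by rewrite {2}cE opprK.
  by rewrite /c !starM !starK; ncring.
- have cE : c = pos_part c by rewrite {1}(pos_neg_sub sc) c0 subr0.
  apply: (sqr_small_contra (sv v2) (nonneg_conj v2 (pos_part_nonneg sc)) _ (big _ h2) ne').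
  by rewrite -cE /c !starM !starK; ncring.
Qed.

Theorem fixed_compress d : positive_in (fixed_algebra alpha) d -> d <> 0 ->
  exists2 n, fixed_algebra alpha n & star n * d * n = 1.
Proof.
move=> pd d0; have nd := positive_nonneg pd; have [b fb dE] := pd.
have fd : fixed_algebra alpha d.
  by rewrite dE; apply: (fixedM halpha) => //; exact: fixed_star.
have [r rd] := compress_bool nd (introN eqP d0).
have p1 : positive_in (fixed_algebra alpha) 1.
  by exists 1; [exact: fixed1|rewrite star1 mulr1].
have n1 : (1 : A) <> 0 by apply/eqP; exact: oner_neq0.
have [|d1 [t [s1 [[fd1 nd1 ld1 bd1] ft _ ht _]]]] := rokhlin_transfer fd rd p1 n1 (e := 1 / 16).
  by lra.
pose v k := b * t k.
have vv j k : star (v j) * v k = star (t j) * d * t k by rewrite /v starM dE; ncring.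
pose k4 := d1 * d1 * d1 * d1.
have k4E : k4 = (d1 * d1) * (d1 * d1) by rewrite /k4; ncring.
have sd1 : selfadjoint (d1 * d1) by rewrite starM nd1.1.
have sk : selfadjoint k4 by rewrite k4E starM sd1.
(* [nm (d1 * d1)] exceeds [15 / 16], whose square exceeds [3 / 4]. *)
have hk : 3 / 4 <= nm k4.
  by rewrite k4E nm_sa_sqr // expr2; nra.
pose c := v true * star (v true) - v false * star (v false).
have [cp0 cn0] : pos_part c != 0 /\ neg_part c != 0.
  apply: (parts_neq0 sk hk).
  - by have := ht true true; rewrite vv eqxx mul1r.
  - by have := ht false false; rewrite vv eqxx mul1r.
  - by have := ht true false; rewrite vv (_ : (true == false) = false) // mul0r subr0.
have sc : selfadjoint c by rewrite /c starB !starM !starK.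
have fv k : fixed_algebra alpha (v k) by exact: fixedM.
have fc : fixed_algebra alpha c.
  by apply: fixedB => //; apply: fixedM => //; apply: fixed_star.
have fcp : fixed_algebra alpha (pos_part c) by apply: fixed_cfc => //; exact: continuous_maxr.
have fcn : fixed_algebra alpha (neg_part c) by apply: fixed_cfc => //; exact: continuous_neg.
have scp := pos_part_sa sc; have scn := neg_part_sa sc.
have pn := pos_neg_mul sc; have np := pos_neg_comm sc; have cE := pos_neg_sub sc.
set cp := pos_part c in cp0 fcp scp pn np cE; set cn := neg_part c in cn0 fcn scn pn np cE.
have ccp : c * cp = cp * cp by rewrite cE mulrBl np subr0.
have ccn : c * cn = - (cn * cn) by rewrite cE mulrBl pn sub0r.
(* Here [c * cp] is the square of [cp] and [c * cn] is minus that of [cn], so the two are orthogonal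
   and the cross terms of [star u * u] vanish below. *)
pose Z := star (c * cp) * (c * cp); pose Y := star (c * cn) * (c * cn).
have sq_neq0 a : selfadjoint a -> a != 0 -> a * a != 0.
  by move=> sa a0; rewrite -nm_eq0 nm_sa_sqr // sqrf_eq0 nm_eq0.
have Z0 : Z != 0.
  rewrite -nm_eq0 cstar_norm_starM sqrf_eq0 nm_eq0 ccp; exact: sq_neq0.
have Y0 : Y <> 0.
  apply/eqP; rewrite -nm_eq0 cstar_norm_starM sqrf_eq0 nm_eq0 ccn oppr_eq0; exact: sq_neq0.
have fZ : fixed_algebra alpha Z by do ?[apply: fixedM => //; try apply: fixed_star => //].
have pY : positive_in (fixed_algebra alpha) Y by exists (c * cn) => //; exact: fixedM.
have [r' rd'] := compress_bool (star_mul_nonneg (c * cp)) Z0.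
have [|d2 [t' [s [[fd2 nd2 ld2 _] ft' fs ht' hs]]]] := rokhlin_transfer fZ rd' pY Y0 (e := 1 / 16).
  by lra.
pose u := c * cp * t' true + c * cn * s.
pose m := t true * star (t true) - t false * star (t false).
pose n := m * star b * (cp * t' true + cn * s).
have uE : u = b * n.
  have cm : c = b * m * star b by rewrite /c /v /m !starM; ncring.
  by rewrite /u /n {1 2}cm; ncring.
have QE : star n * d * n = star u * u by rewrite uE dE (starM b n); ncring.
have uu : star u * u = star (t' true) * Z * t' true + star s * Y * s.
  have x1 : star (c * cp) * (c * cn) = 0.
    rewrite ccp ccn starM scp mulrN.
    have -> : cp * cp * (cn * cn) = cp * (cp * cn) * cn by ncring.
    by rewrite pn mulr0 mul0r oppr0.
  have x2 : star (c * cn) * (c * cp) = 0.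
    by move/(congr1 star): x1; rewrite starM starK star0.
  rewrite /u starD (starM (c * cp)) (starM (c * cn)).
  have -> : (star (t' true) * star (c * cp) + star s * star (c * cn)) *
      (c * cp * t' true + c * cn * s) = star (t' true) * Z * t' true + star s * Y * s +
      (star (t' true) * (star (c * cp) * (c * cn)) * s +
       star s * (star (c * cn) * (c * cp)) * t' true) by rewrite /Z /Y; ncring.
  by rewrite x1 x2 !mulr0 !mul0r !addr0.
have fm : fixed_algebra alpha m.
  by apply: fixedB => //; apply: fixedM => //; apply: fixed_star.
have fn : fixed_algebra alpha n.
  rewrite /n; apply: (fixedM halpha); last by apply: fixedD => //; exact: fixedM.
  by apply: (fixedM halpha) => //; exact: fixed_star.
clearbody n u.
have [Q QD] : exists Q, Q = star u * u by exists (star u * u).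
pose E := Q - (d2 * d2 * d2 * d2 + (1 - d2)).
have nE : nm E <= 1 / 8.
  have -> : E = (star (t' true) * Z * t' true - 1 * (d2 * d2 * d2 * d2)) +
      (star s * Y * s - (1 - d2)) by rewrite /E QD uu; ncring.
  apply: le_trans (cstar_normD _ _) _.
  by have := ht' true true; rewrite eqxx => h; apply: le_trans (lerD h hs) _; lra.
have sd2 := nd2.1.
have sQ : selfadjoint Q by rewrite QD starM starK.
have sE : selfadjoint E.
  by rewrite /E starB starD starB star1 !starM !sd2 sQ; ncring.
have pQ : nonneg (Q - (1 / 4)%:C%:A).
  pose h : A := (1 / 2)%:C%:A.
  have sh : selfadjoint h by rewrite /h starZr star1.
  have e1 := nonneg_rsub (a := - E) (m := 1 / 8); rewrite starN sE nmN in e1.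
  have {}e1 := e1 erefl nE.
  have e2 : nonneg ((d2 * d2 - h) * (d2 * d2 - h)).
    by apply: sqr_nonneg; rewrite starB starM sd2 sh.
  have e3 : nonneg ((d2 - h) * (d2 - h)) by apply: sqr_nonneg; rewrite starB sd2 sh.
  pose o : A := (1 / 8)%:C%:A; pose f4 : A := (1 / 4)%:C%:A.
  have e4 : nonneg o.
    by rewrite /o -(subr0 (_%:A)); apply: nonneg_rsub; rewrite ?star0 // nm0; lra.
  have addA (r1 r2 : R) : r1%:C%:A + r2%:C%:A = (r1 + r2)%:C%:A :> A.
    by rewrite rmorphD scalerDl.
  have oo : o + o = f4 by rewrite addA; congr ((_%:C)%:A); lra.
  have hh1 : h + h = 1.
    by rewrite addA -[RHS]scale1r -(rmorph1 (real_complex R)); congr ((_%:C)%:A); lra.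
  have hh : h * h = f4.
    by rewrite {1}/h -scalerAl (mul1r h) scalerA -rmorphM; congr ((_%:C)%:A); lra.
  have one : f4 + f4 + f4 + f4 = 1.
    rewrite !addA -[RHS]scale1r -(rmorph1 (real_complex R)); congr ((_%:C)%:A); lra.
  have hd a : h * a + a * h = a by rewrite /h scalar_comm -mulrDr -/h hh1 mulr1.
  (* From [d^4 - d + 1 = (d^2 - 1/2)^2 + (d - 1/2)^2 + 1/2]: of the last [1/2], one quarter is
     subtracted, [1/8] absorbs the error [E], and [1/8] is left. *)
  have -> : Q - (1 / 4)%:C%:A = (d2 * d2 - h) * (d2 * d2 - h) + (d2 - h) * (d2 - h) +
      ((1 / 8)%:C%:A - - E) + o.
    rewrite -/o -/f4; set d4 := d2 * d2.
    have -> : (d4 - h) * (d4 - h) + (d2 - h) * (d2 - h) + (o - - E) + o =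
      d4 * d4 - (h * d4 + d4 * h) + h * h + d2 * d2 - (h * d2 + d2 * h) + h * h + (o + o) + E
      by ncring.
    rewrite !hd hh oo /E /d4.
    have -> : d2 * d2 * (d2 * d2) - d2 * d2 + f4 + d2 * d2 - d2 + f4 + f4 +
      (Q - (d2 * d2 * d2 * d2 + (1 - d2))) = (Q - f4) + (f4 + f4 + f4 + f4 - 1) by ncring.
    by rewrite one subrr addr0.
  by do 3! apply: nonnegD => //.
have sg : selfadjoint (isqrt (1 / 4) Q) by apply: isqrt_sa => //; lra.
have gQ := isqrt_inv (c := 1 / 4) ltac:(lra) pQ.
have fg : fixed_algebra alpha (isqrt (1 / 4) Q).
  apply: fixed_cfc => //; first by apply: continuous_isqrt; lra.
  by rewrite QD -QE; do ?[apply: fixedM => //; try apply: fixed_star => //].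
exists (n * isqrt (1 / 4) Q); first exact: fixedM.
set g := isqrt (1 / 4) Q in gQ sg *.
rewrite starM sg; have -> : g * star n * d * (n * g) = g * (star n * d * n) * g by ncring.
by rewrite QE -QD; exact: gQ.
Qed.

End Transfer.

Theorem proposition6p21 (R : realType) (A : cstarAlgType R)
    (hsimple : simple_cstar A) (hsep : separable_cstar A)
    (hinf : infinite_dimensional A)
    (G : topologicalGroupType) (hcompact : compact [set: G])
    (hhausdorff : hausdorff_space G) (hcountable : @second_countable G)
    (alpha : G -> A -> A) (halpha : cstar_action alpha)
    (hrokhlin : weak_tracial_rokhlin alpha)
    (hpi : purely_infinite A) :
  weak_tracial_rokhlin_comparison alpha.
Proof.
move=> e F S x y e0 fF fS SC px nx py y0.
have [d [psi H]] := hrokhlin e F S x y e0 fF fS SC px nx py y0.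
exists d, psi; split=> //; have [[pd d1] _ _ _ [_ _ hx]] := H.
have f0 := fixed0 halpha; have nd := positive_nonneg pd.
have nd' : nonneg (1 - d).
  by have := nonneg_rsub nd.1 d1; rewrite rmorph1 scale1r.
(* When [d = 0], condition (6) forces [e >= 1], so the function defining the cutdown vanishes on the
   spectrum of [1] and the comparison is trivial. *)
have [d0|d0] := eqVneq d 0.
  apply: (@cuntz_in_exact _ _ _ _ _ 0) => //; rewrite d0 mulr0.
  have e1 : 1 <= e.
    by move: hx; rewrite d0 mulr0 nm0 subr_lt0 => /ltW.
  rewrite subr0 /cutdown (@cfc_rpoly _ _ _ _ 0) ?star1 //.
  - by rewrite /rpoly !rmorph0.
  - by apply: continuous_max0_comp => t; apply: cvgB; [exact: cvg_id|exact: cst_continuous].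
  - move=> t /spectrum_abs; rewrite nm1 horner0 => t1; apply: max_l.
    by rewrite subr_le0 (le_trans (ler_norm t)) // (le_trans t1).
have [n fn hn] := fixed_compress halpha hcompact hrokhlin hsimple hpi pd (elimN eqP d0).
have cf : continuous (fun t : R => Num.max 0 (t - e)).
  by apply: continuous_max0_comp => t; apply: cvgB; [exact: cvg_id|exact: cst_continuous].
(* Square root of [(1 - d - e)_+]. Since [star n * d * n = 1], conjugating [d] by [n * b] gives
   exactly the square of [b]. *)
pose b := cfc (1 - d) (fun t => Num.sqrt (Num.max 0 (t - e))).
have sb : selfadjoint b by apply: cfc_sa; [exact: nd'.1|exact: continuous_sqrt_comp].
apply: (@cuntz_in_exact _ _ _ _ _ (n * b)) => //.
  apply: (fixedM halpha) => //; apply: (fixed_cfc halpha).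
  - exact: nd'.1.
  - exact: continuous_sqrt_comp.
  - apply: (fixedB halpha); first exact: fixed1.
    by case: pd => a fa ->; apply: (fixedM halpha) => //; exact: fixed_star.
rewrite starM sb; have -> : b * star n * d * (n * b) = b * (star n * d * n) * b by ncring.
rewrite hn mulr1 /b -cfc_sqrt_sqr //; first exact: nd'.1.
by move=> t _; rewrite le_max lexx.
Qed.
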